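(* Let $1<p<\infty$ and suppose that the metric measure space $X=(X,d,\mu)$, with $\mu$ doubling, supports the improved Poincaré inequalities (PI): there are $1<p_0<p$, $C_P>0$ and $\tau\ge1$ such that $X$ supports the $(q,q)$-Poincaré inequality with constants $C_P$ and $\tau$ for every $p_0\le q\le p$. Assume that $E\subset X$ is a uniformly $p$-fat closed set, let $w\in E$ and $0<r<(1/8)\operatorname{diam}(X)$, and let $E_B\subset E\cap\overline{B}$ be the truncation of $E$ to $B=B(w,r)$ (defined in the context). Then there exist constants $0<\varepsilon<p-p_0$, with $\varepsilon=\varepsilon_{X,p_0,p,C_H}$ depending only on the data of $X$, $p_0$, $p$ and $C_H$, and $C>0$ such that the inequality $$\int_{12\tau^2B\setminus E_B}\frac{|u(x)|^{p-\varepsilon}}{d_{E_B}(x)^{p-\varepsilon}}\,d\mu(x)\le C\int_{12\tau^3B}\operatorname{Lip}(u,x)^{p-\varepsilon}\,d\mu(x)$$ holds whenever $u\in\operatorname{Lip}_0(X\setminus E)$. Here $C_H=C_{X,p,c_0}$ is the constant of the local $p$-Hardy inequality recalled in the context, depending only on the data of $X$, $p$ and the constant $c_0$ of uniform $p$-fatness of $E$.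
   Context: Setting: $X=(X,d,\mu)$ is a metric space (not assumed to be complete) with metric $d$ and a positive complete Borel measure $\mu$ (extended as a Borel regular outer measure) such that $0<\mu(B(x,r))<\infty$ for all balls $B(x,r)=\{y\in X: d(y,x)<r\}$. For $B=B(x,r)$ and $t>0$, $tB=B(x,tr)$; $\overline{A}$ is the closure of $A$ (so $\overline{B}$ is the closure of the ball $B$). $\mu$ is doubling: there is a constant $C_D\ge 1$ with $\mu(2B)\le C_D\,\mu(B)$ for all balls $B$. Notation: $d_A(x)=\operatorname{dist}(x,A)$. Lipschitz functions: $\operatorname{Lip}(X)$ is the set of Lipschitz functions $u\colon X\to\mathbb{R}$, and for $A\subset X$, $\operatorname{Lip}_0(A)=\{u\in\operatorname{Lip}(X): u=0\text{ in }X\setminus A\}$. The upper pointwise Lipschitz constant is $\operatorname{Lip}(u,x)=\limsup_{r\to0}\sup_{y\in B(x,r)}\frac{|u(y)-u(x)|}{r}$. Weak upper gradients: a curve is a nonconstant rectifiable continuous map from a compact interval to $X$. A Borel function $g\ge 0$ on $X$ is an upper gradient of an extended real-valued function $u$ on $X$ if for all curves $\gamma$ joining arbitrary points $x,y\in X$ we have $|u(x)-u(y)|\le\int_\gamma g\,ds$ whenever $u(x),u(y)$ are both finite, and $\int_\gamma g\,ds=\infty$ otherwise. For $1\le p<\infty$, a measurable $g\ge0$ on $X$ is a $p$-weak upper gradient of $u$ if this holds for $p$-almost every curve, i.e. there is a non-negative Borel function $\rho\in L^p(X)$ with $\int_\gamma\rho\,ds=\infty$ for every curve $\gamma$ for which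 the condition fails. $(q,q)$-Poincaré inequality with constants $C_P$, $\tau$: for all balls $B\subset X$, all measurable functions $u$ on $X$ and all $q$-weak upper gradients $g$ of $u$, $$\frac1{\mu(B)}\int_B|u-u_B|^q\,d\mu\le C_P\operatorname{diam}(B)^q\,\frac1{\mu(\tau B)}\int_{\tau B}g^q\,d\mu,$$ where $u_B=\frac1{\mu(B)}\int_B u\,d\mu$ and the left-hand side is interpreted as $\infty$ if $u_B$ is not defined. Capacity: for a bounded open $\Omega\subset X$ and a closed set $K\subset\Omega$, $\operatorname{cap}_p(K,\Omega)=\inf\int_\Omega g^p\,d\mu$, the infimum over all $u\in\operatorname{Lip}_0(\Omega)$ with $u\ge1$ in $K$ and all $p$-weak upper gradients $g$ of $u$ ($=\infty$ if there are no such $u$). Uniform fatness: a closed set $E\subset X$ is uniformly $p$-fat if there is a constant $0<c_0\le1$ such that $\operatorname{cap}_p(E\cap\overline{B(x,r)},B(x,2r))\ge c_0\operatorname{cap}_p(\overline{B(x,r)},B(x,2r))$ for all $x\in E$ and all $0<r<(1/8)\operatorname{diam}(X)$. Truncation: for closed $E$, $w\in E$, $r>0$, $B=B(w,r)$, put $E_B^0=E\cap\overline{\tfrac12B}$, inductively $E_B^j=\bigcup_{x\in E_B^{j-1}}E\cap\overline{B(x,2^{-j-1}r)}$ for $j=1,2,\dots$, and $E_B=\overline{\bigcup_{j\ge0}E_B^j}$. Data of $X$: a constant $C_{X,*,\dots,*}$ depends only on the quantities indicated by the $*$'s and possibly on $C_D$, on $C_P$ and $\tau$, and on the constants $C$ in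 the following two known inequalities (valid under a $(1,p)$-Poincaré inequality): (capacitary Poincaré) $\frac1{\mu(B)}\int_B|u|^p\,d\mu\le\frac{C}{\operatorname{cap}_p(\overline{2^{-1}B}\cap\{u=0\},B)}\int_{\tau B}g^p\,d\mu$ for all balls $B$, Lipschitz $u$ on $X$ and $p$-weak upper gradients $g$ of $u$; (comparison) $\frac{\mu(F)}{Cr^p}\le\operatorname{cap}_p(F,2B)\le\frac{C_D\,\mu(B)}{r^p}$ for all balls $B=B(x,r)$ with $0<r<(1/8)\operatorname{diam}(X)$ and closed $F\subset\overline{B}$. The constant $C_H=C_{X,p,c_0}$: it is a constant such that, for every $w\in E$, $0<r<(1/8)\operatorname{diam}(X)$, $B=B(w,r)$, $$\int_{8\tau B\setminus E_B}\frac{|v|^p}{d_{E_B}^p}\,d\mu\le C_H\int_{8\tau^2B}g^p\,d\mu$$ whenever $v\in\operatorname{Lip}(X)$ and $g$ is a $p$-weak upper gradient of $v$ such that $v=0=g$ in an open set $U\subset X$ with $\operatorname{dist}(E_B,X\setminus U)>0$ or $U=X$. *)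

(* Defs.v *)
From HB Require Import structures.
From mathcomp Require Import all_boot all_order all_algebra.
From mathcomp Require Import all_classical all_reals all_analysis measurable_realfun.

Set Implicit Arguments.
Unset Strict Implicit.
Unset Printing Implicit Defensive.

Import Order.TTheory GRing.Theory Num.Theory.
Import numFieldNormedType.Exports.

Local Open Scope classical_set_scope.
Local Open Scope ring_scope.

(* No compatibility between the two structures is built in: that the
   measurable sets are the completed Borel sets is part of
   [complete_borel_measure] below. *)
#[short(type="metricMeasurableType")]
HB.structure Definition MetricMeasurable (d : measure_display) (R : realType) :=
  {T of Measurable d T & Metric R T}.

Section metric_notions.
Context {d : measure_display} {R : realType} {X : metricMeasurableType d R}.
Implicit Types (A B E : set X) (u v : X -> R).

Definition diam A : \bar R :=
  ereal_sup [set (mdist z.1 z.2)%:E | z in A `*` A].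

(* [d_A(x)]; only meaningful for nonempty [A] *)
Definition dist_to A (x : X) : R := inf [set mdist x y | y in A].

(* equal to [+oo] if [A] or [B] is empty *)
Definition set_dist A B : \bar R :=
  ereal_inf [set (mdist z.1 z.2)%:E | z in A `*` B].

Definition Lip u : Prop :=
  exists L : R, forall x y : X, `|u x - u y| <= L * mdist x y.

Definition Lip0 A u : Prop := Lip u /\ forall x, ~ A x -> u x = 0.

Definition pointwise_lip u (x : X) : \bar R :=
  limf_esup (fun r : R => ereal_sup [set (`|u y - u x| / r)%:E | y in ball x r])
    0^'+.

Definition borel_set A : Prop := <<s (@open X) >> A.

Definition borel_fun (f : X -> \bar R) : Prop :=
  measurable_fun setT (f : g_sigma_algebraType (@open X) -> \bar R).

Fixpoint trunc_step E (w : X) (r : R) (j : nat) : set X :=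
  match j with
  | 0%N => E `&` closure (ball w (r / 2))
  | i.+1 => \bigcup_(x in trunc_step E w r i)
              (E `&` closure (ball x (2 ^- i.+2 * r)))
  end.

(* [E_B] for [B = B(w, r)] *)
Definition trunc E (w : X) (r : R) : set X :=
  closure (\bigcup_j trunc_step E w r j).

End metric_notions.

Section curves.
Context {d : measure_display} {R : realType} {X : metricMeasurableType d R}.
Implicit Types (a b : R) (c : R -> X).

Definition curve_length c a b : \bar R :=
  ereal_sup [set (\sum_(0 <= n < size s)
                    mdist (c (nth b (a :: s) n)) (c (nth b (a :: s) n.+1)))%:E
            | s in itv_partition a b].

(* A curve is the restriction to [`[a, b]] of a map [c : R -> X]; the values
   of [c] elsewhere play no role. *)
Definition is_curve c a b : Prop :=
  [/\ {within `[a, b], continuous c},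
      (curve_length c a b < +oo)%E &
      exists s t, [/\ s \in `[a, b], t \in `[a, b] & c s <> c t]].

(* The parameter [s] such that the length of [c] on [`[a, s]] is [t] need not
   be unique, but [c] is constant on the set of such [s]. *)
Definition arc_length_param c a b (t : R) : X :=
  c (xget a [set s | s \in `[a, b] /\ curve_length c a s = t%:E]).

(* The integral of a nonnegative function is the supremum of the integrals of
   the Borel simple functions below it, so for Lebesgue measurable integrands
   it is the integral with respect to the completed Lebesgue measure. *)
Definition line_integral c a b (g : X -> \bar R) : \bar R :=
  (\int[@lebesgue_measure R]_(t in `[0%R, fine (curve_length c a b)])
     g (arc_length_param c a b t))%E.

Definition ug_inequality (u g : X -> \bar R) c a b : Prop :=
  let fin := (u (c a) \is a fin_num) && (u (c b) \is a fin_num) in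
  (fin -> (`|u (c a) - u (c b)| <= line_integral c a b g)%E) /\
  (~~ fin -> line_integral c a b g = +oo%E).

End curves.

Section analysis_on_metric_measure_space.
Context {d : measure_display} {R : realType} {X : metricMeasurableType d R}.
Variable mu : {measure set X -> \bar R}.
Implicit Types (E K : set X) (u v : X -> R) (p q : R).

Definition complete_borel_measure : Prop :=
  [/\ forall U : set X, open U -> measurable U,
      measure_is_complete mu &
      forall A : set X, measurable A ->
        exists B, [/\ borel_set B, A `<=` B & mu A = mu B]].

Definition positive_finite_on_balls : Prop :=
  forall (x : X) (r : R), 0 < r -> (0 < mu (ball x r) < +oo)%E.

Definition doubling (CD : R) : Prop :=
  forall (x : X) (r : R), 0 < r ->
    (mu (ball x (2 * r)) <= CD%:E * mu (ball x r))%E.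

Definition weak_upper_gradient p (u g : X -> \bar R) : Prop :=
  [/\ measurable_fun setT g,
      forall x, (0 <= g x)%E &
      exists rho : X -> \bar R,
        [/\ borel_fun rho,
            forall x, (0 <= rho x)%E,
            (\int[mu]_x (rho x `^ p) < +oo)%E &
            forall c a b, is_curve c a b -> ~ ug_inequality u g c a b ->
              line_integral c a b rho = +oo%E]].

Definition average (f : X -> \bar R) (A : set X) : \bar R :=
  ((\int[mu]_(x in A) f x) / mu A)%E.

(* [u_B] is taken to be defined when [u] is integrable on [B]. *)
Definition poincare q (CP tau : R) : Prop :=
  forall (x : X) (r : R), 0 < r ->
  forall u g : X -> \bar R,
    measurable_fun setT u -> weak_upper_gradient q u g ->
    let B := ball x r in
    let rhs := (CP%:E * diam B `^ q *
                average (fun y => g y `^ q) (ball x (tau * r)))%E in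
    (mu.-integrable B u ->
       (average (fun y => `|u y - average u B| `^ q) B <= rhs)%E) /\
    (~ mu.-integrable B u -> rhs = +oo%E).

Definition capacity p (K Omega : set X) : \bar R :=
  ereal_inf [set I | exists u (g : X -> \bar R),
    [/\ Lip0 Omega u,
        forall x, K x -> 1 <= u x,
        weak_upper_gradient p (EFin \o u) g &
        I = (\int[mu]_(x in Omega) (g x `^ p))%E]].

Definition uniformly_fat p E : Prop :=
  exists c0 : R, 0 < c0 <= 1 /\
  forall (x : X) (r : R), E x -> 0 < r ->
    (r%:E < (8^-1)%:E * diam [set: X])%E ->
    (c0%:E * capacity p (closure (ball x r)) (ball x (2 * r)) <=
     capacity p (E `&` closure (ball x r)) (ball x (2 * r)))%E.

(* [CH] is admissible as the constant of the local [p]-Hardy inequality *)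
Definition local_hardy p (tau : R) E (CH : R) : Prop :=
  forall (w : X) (r : R), E w -> 0 < r ->
    (r%:E < (8^-1)%:E * diam [set: X])%E ->
  let EB := trunc E w r in
  forall v (g : X -> \bar R) (U : set X),
    Lip v -> weak_upper_gradient p (EFin \o v) g -> open U ->
    (0 < set_dist EB (~` U))%E \/ U = setT ->
    (forall x, U x -> v x = 0 /\ g x = 0%E) ->
    (\int[mu]_(x in ball w (8 * tau * r) `\` EB)
        (`|v x| `^ p / dist_to EB x `^ p)%R%:E <=
     CH%:E * \int[mu]_(x in ball w (8 * tau ^+ 2 * r)) (g x `^ p))%E.

End analysis_on_metric_measure_space.

(* Main.v *)
Require Import Defs.
From HB Require Import structures.
From mathcomp Require Import all_boot all_order all_algebra.
From mathcomp Require Import all_classical all_reals all_analysis measurable_realfun.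
From mathcomp Require Import lra ring.

Set Implicit Arguments.
Unset Strict Implicit.
Unset Printing Implicit Defensive.

Import Order.TTheory GRing.Theory Num.Theory.
Import numFieldNormedType.Exports.

Local Open Scope classical_set_scope.
Local Open Scope ring_scope.

(** The argument is the Koskela-Zhong self-improvement scheme. Write [d] for the
distance to the truncated set [E_B], [f = |u| / d], [g = Lip(u, .)] and
[q = p - eps].

For a level [lam] let [F] be the set of points of [8 tau^2 B] at which [f],
[g] and the averages of [g^p0] over all small balls containing the point are
at most [lam] (in the sense made precise by [bad_set]). By the Poincare
inequality with exponent [p0] and a chain of balls, [u] is
[kap lam]-Lipschitz on the union of [F] and [E_B] ([good_lipschitz_near]), so
it extends from there to a [kap lam]-Lipschitz function [v] on the whole space
([mcshane]), and [g] on [F] together with the constant [kap lam] off [F] is an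
upper gradient of [v] ([glued_weak_upper_gradient]). The [p]-Hardy inequality
applied to truncations of [v] vanishing near [E_B] therefore bounds the
integral of [f^p] over [F] by the integral of [g^p] over [F] plus
[(kap lam)^p] times the measure of the complement of [F] ([hardy_level]).

These inequalities are multiplied by weights that are the increments of
[lam^-eps] along the dyadic sequence of levels [lam = L / 2^n], and added up
([hardy_summation]). The terms with [f^p] and [g^p] become [f^q] and [g^q].
The complements of [F] contribute [eps] times the integrals of [f^q] and [g^q]
and the sum of [lam^q] times the measures of the bad sets; the latter is
controlled by the integral of [g^q] through a weak-type estimate for [g^p0],
because [p0 < q] ([weak_type], [geometric_level_sum]). Hence the integral of
[f^q] over [8 tau B] is at most a constant times the integral of [g^q], plus
[eps] times a constant times the integral of [f^q] over [8 tau^2 B].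

Outside [8 tau B] the distance [d] is comparable to [r], so a
Poincare inequality with exponent [q] on [12 tau^2 B] bounds the integral of
[f^q] over that larger ball by the integrals of [f^q] over [8 tau B] and of
[g^q] over [12 tau^3 B] ([outer_estimate]). For small [eps], chosen in terms of
the data only, the term with [f^q] is absorbed; it is finite because [f] is
bounded by the Lipschitz constant of [u].

That the glued function is an upper gradient is a one-dimensional statement.
Along an arc-length parametrized curve a Lipschitz function is controlled by
the integral of any almost everywhere upper bound of its right Dini derivative
([le_primitive_dini]), and at a density point of the preimage of [F] the Dini
derivatives of [v] and [u] along the curve agree ([glued_along]). *)

(** * Arc-length parametrization of rectifiable curves *)
Section metric_basics.
Context {d : measure_display} {R : realType} {X : metricMeasurableType d R}.

Lemma ball_mdist (x y : X) (r : R) : ball x r y <-> mdist x y < r.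
Proof. by rewrite ballEmdist. Qed.

End metric_basics.

Section curve_length.
Context {d : measure_display} {R : realType} {X : metricMeasurableType d R}.
Variable c : R -> X.
Implicit Types (a b m : R) (s t : seq R).

(** Recursion along the partition, rather than a sum over its indices, makes
concatenation and induction over partitions immediate. *)
Fixpoint polygon_length a s : R :=
  if s is x :: s' then mdist (c a) (c x) + polygon_length x s' else 0.

Lemma polygon_lengthE a b s :
  \sum_(0 <= n < size s)
    mdist (c (nth b (a :: s) n)) (c (nth b (a :: s) n.+1)) = polygon_length a s.
Proof.
elim: s a => [|x s ih] a /=; first by rewrite big_nil.
by rewrite big_nat_recl//= -ih.
Qed.

Lemma polygon_length_cat a s t :
  polygon_length a (s ++ t) = polygon_length a s + polygon_length (last a s) t.
Proof. by elim: s a => [|x s ih] a /=; rewrite ?add0r// ih addrA. Qed.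

Local Open Scope ereal_scope.

Lemma curve_length_ub a b s : itv_partition a b s ->
  (polygon_length a s)%:E <= curve_length c a b.
Proof.
by move=> abs; apply: ereal_sup_ubound; exists s => //; rewrite polygon_lengthE.
Qed.

Lemma curve_length_le a b (y : \bar R) :
  (forall s, itv_partition a b s -> (polygon_length a s)%:E <= y) ->
  curve_length c a b <= y.
Proof. by move=> h; apply: ge_ereal_sup => _ [s + <-]; rewrite polygon_lengthE; exact: h. Qed.

Lemma mdist_le_length a b : (a <= b)%R ->
  (mdist (c a) (c b))%:E <= curve_length c a b.
Proof.
rewrite le_eqVlt => /predU1P[<-|ab].
  have := @curve_length_ub a a [::]; rewrite /= mdistxx; apply.
  by split => //=.
have := @curve_length_ub a b [:: b]; rewrite /= addr0; apply.
exact: itv_partition1.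
Qed.

Lemma curve_length_ge0 a b : (a <= b)%R -> 0 <= curve_length c a b.
Proof. by move=> ab; rewrite (le_trans _ (mdist_le_length ab))// lee_fin mdist_ge0. Qed.

Lemma curve_length_superD m a b : (a <= m)%R -> (m <= b)%R ->
  curve_length c a m + curve_length c m b <= curve_length c a b.
Proof.
move=> am mb.
have [->|abfin] := eqVneq (curve_length c a b) +oo; first exact: leey.
have fab : curve_length c a b \is a fin_num.
  by rewrite ge0_fin_numE ?ltey// curve_length_ge0// (le_trans am).
have key s t : itv_partition a m s -> itv_partition m b t ->
   (polygon_length a s)%:E + (polygon_length m t)%:E <= curve_length c a b.
  move=> [ps /eqP ls] pt; rewrite -EFinD.
  have -> : (polygon_length a s + polygon_length m t = polygon_length a (s ++ t))%R.
    by rewrite polygon_length_cat ls.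
  apply: curve_length_ub; apply: itv_partition_cat pt.
  by split => //; apply/eqP.
have key2 s : itv_partition a m s ->
   (polygon_length a s)%:E + curve_length c m b <= curve_length c a b.
  move=> ps; rewrite -leeBrDl//; apply: curve_length_le => t pt.
  by rewrite leeBrDl//; exact: key.
have [s0 ps0] : exists s, itv_partition a m s.
  move: am; rewrite le_eqVlt => /predU1P[<-|am].
    by exists [::]; split => //=.
  by exists [:: m]; exact: itv_partition1.
have fmb : curve_length c m b \is a fin_num.
  rewrite ge0_fin_numE ?curve_length_ge0// ltey; apply/eqP => moo.
  have := key2 s0 ps0; rewrite moo addey// leye_eq => /eqP E.
  by rewrite E in abfin.
rewrite -leeBrDr//; apply: curve_length_le => s ps.
by rewrite leeBrDr//; exact: key2.
Qed.

(** Inserting [m] into a partition only splits one of its edges, which by the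
triangle inequality does not shorten the polygon. *)
Lemma curve_length_subD m a b : (a <= m)%R -> (m <= b)%R ->
  curve_length c a b <= curve_length c a m + curve_length c m b.
Proof.
move=> am mb; apply: curve_length_le => s.
elim: s a am => [|x s ih] a am.
  by move=> _ /=; rewrite adde_ge0// curve_length_ge0.
move=> xs; have ps := itv_partition_cons xs.
have xb := itv_partition_le ps.
have ax : (a < x)%R by case: xs => /= /andP[].
rewrite /= EFinD; have [xm|mx] := leP x m.
  apply: (le_trans (leeD2l _ (ih x xm ps))); rewrite addeA leeD2r//.
  apply: le_trans (curve_length_superD (ltW ax) xm).
  by rewrite leeD2r// mdist_le_length// ltW.
have := metric_triangle (c a) (c m) (c x); rewrite -lee_fin EFinD => h.
apply: (@le_trans _ _ (((mdist (c a) (c m))%:E + (mdist (c m) (c x))%:E) + (polygon_length x s)%:E)).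
  by rewrite leeD2r.
rewrite -addeA leeD// ?mdist_le_length//.
apply: le_trans (curve_length_superD (ltW mx) xb).
by rewrite leeD// ?curve_length_ub// mdist_le_length// ltW.
Qed.

Lemma curve_lengthD m a b : (a <= m)%R -> (m <= b)%R ->
  curve_length c a b = curve_length c a m + curve_length c m b.
Proof.
by move=> am mb; apply/eqP; rewrite eq_le curve_length_subD// curve_length_superD.
Qed.

End curve_length.

Section arc_length.
Context {d : measure_display} {R : realType} {X : metricMeasurableType d R}.
Variables (c : R -> X) (a b : R).
Hypothesis ab : a <= b.
Hypothesis cc : {within `[a, b], continuous c}.
Hypothesis rect : (curve_length c a b < +oo)%E.

Local Notation ell s := (fine (curve_length c a s)).

Lemma sub_length_fin s t : a <= s -> s <= t -> t <= b ->
  curve_length c s t \is a fin_num.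
Proof.
move=> as_ st tb; rewrite ge0_fin_numE ?curve_length_ge0//.
apply: le_lt_trans rect.
rewrite (curve_lengthD c as_ (le_trans st tb)).
rewrite (curve_lengthD c st tb) addeA -[leLHS]adde0 leeD// ?curve_length_ge0//.
by rewrite -[leLHS]add0e leeD// curve_length_ge0.
Qed.

Lemma ellD s t : a <= s -> s <= t -> t <= b ->
  ell t = ell s + fine (curve_length c s t).
Proof.
move=> as_ st tb; rewrite (curve_lengthD c as_ st) fineD//; apply: sub_length_fin => //.
by rewrite (le_trans st).
Qed.

Lemma mdist_le_ell s t : a <= s -> s <= t -> t <= b ->
  mdist (c s) (c t) <= ell t - ell s.
Proof.
move=> as_ st tb; rewrite (ellD as_ st tb) addrC addKr -lee_fin fineK ?mdist_le_length//.
exact: sub_length_fin.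
Qed.

Lemma curve_eps_delta (t e : R) : a <= t -> t <= b -> 0 < e -> exists2 dl : R, 0 < dl &
  forall s, a <= s -> s <= b -> `|s - t| < dl -> mdist (c t) (c s) < e.
Proof.
move=> at_ tb e0; have tab : `[a, b]%classic t by rewrite /= in_itv/= at_ tb.
have /subspace_continuousP /(_ t tab) h := cc.
have : \forall s \near within `[a, b] (nbhs t), mdist (c t) (c s) < e.
  by apply: (metricType_numDomainType.cvgrPdist_lt _ _).1 h _ e0; exact: within_nbhs_filter.
rewrite near_withinE => /nbhs_ballP[dl /= dl0 dlP].
exists dl => // s as_ sb st; apply: dlP => //=; last by rewrite in_itv/= as_ sb.
by rewrite /ball/= distrC.
Qed.

(** Take a partition of [[a, t]] whose polygon is almost as long as the curve.
By continuity almost nothing of this length lies on the curve beyond a point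
close to [t], so the length function does not jump at [t]. *)
Lemma ell_left (t e : R) : a < t -> t <= b -> 0 < e ->
  exists2 m : R, a <= m < t & forall s, m < s -> s <= t -> ell t - e < ell s.
Proof.
move=> at_ tb e0; have e20 : 0 < e / 2 by rewrite divr_gt0.
have fa : curve_length c a t \is a fin_num by apply: sub_length_fin => //; exact: ltW.
have : ((ell t - e / 2)%:E < curve_length c a t)%E.
  by rewrite -[in ltRHS](fineK fa) lte_fin gtrBl.
move=> /ereal_sup_gt[_ [s + <-]]; rewrite polygon_lengthE.
case/lastP: s => [|s z].
  by move=> /itv_partition_nil E; rewrite E ltxx in at_.
move=> ps; have zt : z = t by case: ps => _; rewrite last_rcons => /eqP.
rewrite {z}zt in ps *.
have [pas mt] : path <%R a s /\ last a s < t.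
  by case: ps => + _; rewrite rcons_path => /andP[].
set m := last a s in mt *.
have am : itv_partition a m s by split.
rewrite -cats1 polygon_length_cat -/m /= addr0 lte_fin => hl.
have am' := itv_partition_le am.
have [dl dl0 dlP] := curve_eps_delta (ltW at_) tb e20.
exists (Num.max m (t - dl)).
  by rewrite le_max am' gt_max mt /= ltrBlDr ltrDl dl0.
move=> x; rewrite gt_max => /andP[mx tdx] xt.
have ax : a <= x by rewrite (le_trans am')// ltW.
have xb := le_trans xt tb.
have dx : mdist (c x) (c t) < e / 2.
  by rewrite metric_sym dlP// distrC ger0_norm ?subr_ge0//; lra.
have pm : polygon_length c a s <= ell m.
  rewrite -lee_fin fineK ?curve_length_ub//; apply: sub_length_fin => //.
  by rewrite (le_trans (ltW mx)).
have := mdist_le_ell am' (ltW mx) xb.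
have := metric_triangle (c m) (c x) (c t).
by lra.
Qed.

(** As for [ell_left], using the first edge of an almost optimal partition of
[[t, b]] and the additivity of the length. *)
Lemma ell_right (t e : R) : a <= t -> t < b -> 0 < e ->
  exists2 m : R, t < m <= b & forall s, t <= s -> s < m -> ell s < ell t + e.
Proof.
move=> at_ tb e0; have e20 : 0 < e / 2 by rewrite divr_gt0.
have fa : curve_length c t b \is a fin_num by apply: sub_length_fin => //; exact: ltW.
have : ((fine (curve_length c t b) - e / 2)%:E < curve_length c t b)%E.
  by rewrite -[in ltRHS](fineK fa) lte_fin gtrBl.
move=> /ereal_sup_gt[_ [s + <-]]; rewrite polygon_lengthE.
case: s => [|z s].
  by move=> /itv_partition_nil E; rewrite E ltxx in tb.
move=> ps; have tz : t < z by case: ps => /= /andP[].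
have ps' := itv_partition_cons ps; have zb := itv_partition_le ps'.
rewrite /= lte_fin => hl.
have [dl dl0 dlP] := curve_eps_delta at_ (ltW tb) e20.
exists (Num.min z (t + dl)).
  by rewrite ge_min zb lt_min tz /= ltrDl dl0.
move=> x tx; rewrite lt_min => /andP[xz xdl].
have ax := le_trans at_ tx; have xb := le_trans (ltW xz) zb.
have dx : mdist (c t) (c x) < e / 2.
  by rewrite dlP// ger0_norm ?subr_ge0//; lra.
have az := le_trans ax (ltW xz).
have pm : polygon_length c z s <= fine (curve_length c z b).
  by rewrite -lee_fin fineK ?curve_length_ub//; exact: sub_length_fin.
have := mdist_le_ell ax (ltW xz) zb.
have := metric_triangle (c t) (c x) (c z).
have := ellD az zb (lexx _).
have := ellD at_ (ltW tb) (lexx _).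
by lra.
Qed.

Lemma ell_a : ell a = 0.
Proof.
rewrite /curve_length; set S := [set _ | _ in _].
suff -> : S = [set 0%E] by rewrite ereal_sup1.
apply/seteqP; split=> [_ [s /itv_partitionxx -> <-]|_ ->] /=.
  by rewrite big_nil.
by exists [::]; [split => /=|rewrite big_nil].
Qed.

(** Intermediate values of the monotone length function, which has no jumps by
[ell_left] and [ell_right]. *)
Lemma ell_onto y : 0 <= y -> y <= ell b ->
  exists s, [/\ a <= s, s <= b & ell s = y].
Proof.
move=> y0 yb.
pose S := [set s | [/\ a <= s, s <= b & ell s <= y]].
have Sa : S a by split => //; rewrite ell_a.
have hS : has_sup S by split; [exists a|exists b => s []].
have as_ : a <= sup S by apply: ub_le_sup => //; case: hS.
have sb : sup S <= b by apply: ge_sup; [exists a|move=> s []].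
have ly : ell (sup S) <= y.
  rewrite leNgt; apply/negP => yl.
  have aS : a < sup S.
    rewrite lt_neqAle as_ andbT; apply/eqP => E.
    by move: yl; rewrite -E ell_a ltNge y0.
  have e0 : 0 < ell (sup S) - y by rewrite subr_gt0.
  have [m /andP[am mS] mP] := ell_left aS sb e0.
  have [s [as' sb' sy] ms] := sup_gt (ex_intro _ a Sa) mS.
  have sS : s <= sup S by apply: ub_le_sup; [case: hS|split].
  by have := mP s ms sS; lra.
exists (sup S); split => //; apply/eqP; rewrite eq_le ly /= leNgt; apply/negP => ly'.
have bS : sup S < b.
  rewrite lt_neqAle sb andbT; apply/eqP => E.
  by move: ly'; rewrite E ltNge yb.
have e0 : 0 < y - ell (sup S) by rewrite subr_gt0.
have [m /andP[Sm mb] mP] := ell_right as_ bS e0.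
pose s := (sup S + m) / 2.
have : s <= sup S.
  apply: ub_le_sup; [by case: hS|split].
  - by rewrite (le_trans as_)// /s; lra.
  - by rewrite /s; lra.
  - suff : ell s < ell (sup S) + (y - ell (sup S)) by lra.
    by apply: mP; rewrite /s; lra.
by rewrite /s; lra.
Qed.

Local Notation gam := (arc_length_param c a b).

Lemma arc_length_paramP y : 0 <= y -> y <= ell b ->
  exists s, [/\ a <= s, s <= b, ell s = y & gam y = c s].
Proof.
move=> y0 yb; rewrite /arc_length_param.
set S := [set s | _].
have [s [as_ sb sy]] := ell_onto y0 yb.
have : S (xget a S).
  apply: (@xgetI _ a S s); split; first by rewrite in_itv/= as_ sb.
  by rewrite -sy fineK//; exact: sub_length_fin.
move=> [+ h]; rewrite in_itv/= => /andP[h1 h2].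
by exists (xget a S); split => //; rewrite h.
Qed.

Lemma arc_length_param_lip y z : 0 <= y -> y <= ell b -> 0 <= z -> z <= ell b ->
  mdist (gam y) (gam z) <= `|y - z|.
Proof.
wlog yz : y z / y <= z.
  move=> h y0 yb z0 zb; have [yz|/ltW zy] := leP y z; first exact: h.
  by rewrite metric_sym distrC; exact: h.
move=> y0 yb z0 zb; rewrite distrC ger0_norm ?subr_ge0//.
have [s [as_ sb sy ->]] := arc_length_paramP y0 yb.
have [t [at_ tb tz ->]] := arc_length_paramP z0 zb.
rewrite -sy -tz; have [st|/ltW ts] := leP s t; first exact: mdist_le_ell.
have := mdist_le_ell at_ ts sb; rewrite sy tz metric_sym; lra.
Qed.

Lemma arc_length_param0 : gam 0 = c a.
Proof.
have [s [as_ sb s0 ->]] := arc_length_paramP (lexx 0) (fine_ge0 (curve_length_ge0 c ab)).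
apply: mdist_positivity; apply/eqP; rewrite eq_le mdist_ge0 andbT metric_sym.
by rewrite (le_trans (mdist_le_ell (lexx a) as_ sb))// s0 ell_a subrr.
Qed.

Lemma arc_length_param1 : gam (ell b) = c b.
Proof.
have [s [as_ sb s0 ->]] := arc_length_paramP (fine_ge0 (curve_length_ge0 c ab)) (lexx _).
apply: mdist_positivity; apply/eqP; rewrite eq_le mdist_ge0 andbT.
by rewrite (le_trans (mdist_le_ell as_ sb (lexx b)))// s0 subrr.
Qed.

End arc_length.

(** * Dini derivatives and integrals on the real line *)
Section real_line.
Context {R : realType}.
Local Notation mu := (@lebesgue_measure R).
Implicit Types (f H phi : R -> R) (a b s t M m K e l dl : R).

(** Otherwise the supremum of the points at which [f] is at most [f a] would be a
point that the local condition allows to pass. *)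
Lemma right_nonincreasing f a b K : a <= b ->
  (forall s t, a <= s -> s <= t -> t <= b -> `|f t - f s| <= K * (t - s)) ->
  (forall t, a <= t -> t < b -> exists2 e : R, 0 < e &
     forall s, t < s -> s < t + e -> s <= b -> f s <= f t) ->
  f b <= f a.
Proof.
move=> ab lip loc.
pose S := [set t | [/\ a <= t, t <= b & f t <= f a]].
have Sa : S a by split.
have hS : has_sup S by split; [exists a|exists b => t []].
have as_ : a <= sup S by apply: ub_le_sup => //; case: hS.
have sb : sup S <= b by apply: ge_sup; [exists a|move=> s []].
have fS : f (sup S) <= f a.
  rewrite leNgt; apply/negP => lt_.
  pose e := (f (sup S) - f a) / (`|K| + 1).
  have K1 : 0 < `|K| + 1 by rewrite ltr_wpDl.
  have e0 : 0 < e by rewrite divr_gt0// subr_gt0.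
  have [t [at_ tb ft] et] := sup_adherent e0 hS.
  have tS : t <= sup S by apply: ub_le_sup; [case: hS|split].
  have := lip t (sup S) at_ tS sb; rewrite ler_norml => /andP[_ h].
  have : K * (sup S - t) <= (`|K| + 1) * (sup S - t).
    by rewrite ler_wpM2r ?subr_ge0// (le_trans (ler_norm K))// lerDl.
  have : (`|K| + 1) * (sup S - t) < (`|K| + 1) * e by rewrite ltr_pM2l//; lra.
  have -> : (`|K| + 1) * e = f (sup S) - f a.
    by rewrite /e mulrC mulrVK ?unitfE ?gt_eqF.
  by move: h; lra.
have [->//|Sb] := eqVneq b (sup S).
have {}Sb : sup S < b by rewrite lt_neqAle eq_sym Sb.
have [e e0 he] := loc _ as_ Sb.
pose s := Num.min (sup S + e / 2) b.
have s1 : sup S < s by rewrite lt_min Sb andbT ltrDl divr_gt0.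
have s2 : s < sup S + e by rewrite gt_min; apply/orP; left; lra.
have s3 : s <= b by rewrite ge_min lexx orbT.
have : s <= sup S.
  apply: ub_le_sup; [by case: hS|split => //].
    by rewrite (le_trans as_)// ltW.
  by rewrite (le_trans (he s s1 s2 s3)).
by rewrite leNgt s1.
Qed.

Section primitive.
Variables (f : R -> R) (M : R).
Hypothesis mf : measurable_fun [set: R] f.
Hypothesis f0 : forall t, 0 <= f t.
Hypothesis fM : forall t, f t <= M.

Definition primitive (x : R) : R := \int[mu]_(t in `[0, x]) f t.

Lemma bounded_integrable (D : set R) : measurable D -> (mu D < +oo)%E ->
  mu.-integrable D (EFin \o f).
Proof.
move=> mD muD; apply: measurable_bounded_integrable => //.
  exact: measurable_funS mf.
exists M; split; first by rewrite num_real.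
by move=> x Mx t _ /=; rewrite ger0_norm// (le_trans (fM t))// ltW.
Qed.

Lemma itv_lt_pinfty (i j : bool) (a b : R) :
  (mu [set` Interval (BSide i a) (BSide j b)] < +oo)%E.
Proof.
rewrite lebesgue_measure_itv/=.
by case: ifP => _; rewrite -?EFinD ltry.
Qed.

Lemma primitiveB m M' s t : 0 <= s -> s <= t ->
  (forall x, s < x -> x <= t -> m <= f x <= M') ->
  m * (t - s) <= primitive t - primitive s <= M' * (t - s).
Proof.
move=> s0 st h; rewrite /primitive Rintegral_itvB ?bnd_simp//; last first.
  by apply: bounded_integrable => //; exact: itv_lt_pinfty.
have mi : measurable (`]s, t] : set R) by [].
have cI (k : R) : mu.-integrable `]s, t] (EFin \o cst k).
  apply: measurable_bounded_integrable => //; first exact: itv_lt_pinfty.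
  by exists `|k|; split; [rewrite num_real|move=> x kx y _ /=; rewrite ltW].
have cE (k : R) : k * (t - s) = \int[mu]_(x in `]s, t]) (cst k x).
  rewrite Rintegral_cst//= lebesgue_measure_itv/= lte_fin.
  move: st; rewrite le_eqVlt => /predU1P[->|st]; first by rewrite ltxx subrr.
  by rewrite st -EFinD.
rewrite !cE; apply/andP; split; apply: le_Rintegral => //.
- by apply: bounded_integrable => //; exact: itv_lt_pinfty.
- by move=> x /=; rewrite in_itv/= => /andP[sx xt]; have /andP[] := h x sx xt.
- by apply: bounded_integrable => //; exact: itv_lt_pinfty.
- by move=> x /=; rewrite in_itv/= => /andP[sx xt]; have /andP[] := h x sx xt.
Qed.

(** One-sided form of the differentiability of indefinite integrals at almost
every point. *)
Lemma primitive_ae : {ae mu, forall t, 0 < t -> forall e, 0 < e ->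
  exists2 dl : R, 0 < dl & forall s, t < s -> s < t + dl ->
    `|primitive s - primitive t - f t * (s - t)| <= e * (s - t)}.
Proof.
have intf y : mu.-integrable [set` Interval (BLeft (0:R)) (BRight y)] (EFin \o f).
  by apply: bounded_integrable => //; exact: itv_lt_pinfty.
have locf : locally_integrable [set: R] f.
  split => //; first exact: openT.
  move=> K _ cK; have /integrableP[_] // : mu.-integrable K (EFin \o f).
  apply: bounded_integrable.
    by apply: closed_measurable; exact: compact_closed.
  exact: compact_finite_measure.
have := FTC1 intf locf; apply: filterS; first exact: (ae_filter_ringOfSetsType mu).
move=> t /= ht t0 e e0.
have [|dF F'] := ht; first by rewrite lte_fin.
have /cvgrPdist_le /(_ e e0) := dF.
rewrite -/(derive _ _ _) -derive1E F' near_withinE => /nbhs_ballP[dl /= dl0 dlP].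
exists dl => // s ts sdl.
have st0 : 0 < s - t by rewrite subr_gt0.
have := dlP (s - t); rewrite /ball/= sub0r normrN gtr0_norm//.
have -> : s - t < dl by lra.
move=> /(_ isT); rewrite gt_eqF// => /(_ isT).
rewrite scaler1 subrK /GRing.scale/=.
rewrite -(ler_pM2r st0) -[X in _ * X](gtr0_norm st0) -normrM mulrBl.
rewrite mulrAC mulVf ?gt_eqF// mul1r distrC.
by [].
Qed.

End primitive.

(** If [A] missed an interval of length [e (s - t)] ending at [s], the primitive of
the indicator function of the complement of [A] would grow by that amount
between [t] and [s]; its derivative vanishes at almost every point of [A]. *)
Lemma density_right (A : set R) : measurable A ->
  {ae mu, forall t, 0 < t -> A t -> forall e, 0 < e -> e <= 1 ->
  exists2 dl : R, 0 < dl & forall s, t < s -> s < t + dl ->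
    exists s', [/\ A s', t <= s', s' <= s & s - s' <= e * (s - t)]}.
Proof.
move=> mA; pose f : R -> R := \1_(~` A).
have mf : measurable_fun [set: R] f.
  by apply: measurable_indic; exact: measurableC.
have f0 t : 0 <= f t by [].
have f1 t : f t <= 1 by rewrite /f indicE; case: (_ \in _).
have := primitive_ae mf f0 f1.
apply: filterS; first exact: (ae_filter_ringOfSetsType mu).
move=> t /= ht t0 At e e0 e1.
have e20 : 0 < e / 2 by rewrite divr_gt0.
have [dl dl0 dlP] := ht t0 _ e20.
exists dl => // s ts sdl.
have := dlP s ts sdl; have -> : f t = 0.
  by rewrite /f indicE memNset//=; apply.
rewrite mul0r subr0 => hs; apply: contrapT => hn.
have st0 : 0 < s - t by rewrite subr_gt0.
pose z := s - e * (s - t).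
have tz : t <= z.
  have : e * (s - t) <= 1 * (s - t) by rewrite ler_wpM2r// ltW.
  by rewrite /z; lra.
have zs : z <= s by rewrite /z gerBl mulr_ge0// ltW.
have /andP[h1 _] : 1 * (s - z) <= primitive f s - primitive f z <= 1 * (s - z).
  apply: primitiveB => //; first by rewrite (le_trans (ltW t0)).
  move=> x zx xs; suff -> : f x = 1 by rewrite lexx.
  rewrite /f indicE mem_set//= => Ax; apply: hn; exists x; split => //.
    by rewrite (le_trans tz)// ltW.
  by rewrite lerBlDr -lerBlDl ltW.
have /andP[h2 _] : 0 * (z - t) <= primitive f z - primitive f t <= 1 * (z - t).
  by apply: primitiveB => //; [exact: ltW|move=> x _ _; rewrite f0 f1].
have := le_trans (ler_norm _) hs.
have : 0 < e * (s - t) by rewrite mulr_gt0.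
by move: h1 h2; rewrite /z; lra.
Qed.

Lemma primitiveB_ge0 f M s t : measurable_fun [set: R] f -> (forall t, 0 <= f t) ->
  (forall t, f t <= M) -> 0 <= s -> s <= t ->
  0 <= primitive f t - primitive f s <= M * (t - s).
Proof.
move=> mf f0 fM s0 st; rewrite -[X in X <= _ <= _](mul0r (t - s)).
by apply: (primitiveB mf f0 fM) => // x _ _; rewrite f0 fM.
Qed.

Lemma null_cover (N : set R) e : mu.-negligible N -> 0 < e ->
  exists O : set R, [/\ open O, N `<=` O & (mu O < e%:E)%E].
Proof.
move=> [B [mB B0 NB]] e0.
have [|U [oU BU Ue]] := lebesgue_regularity_outer mB _ e0.
  by rewrite [X in (X < _)%E]B0.
exists U; split => //; first exact: subset_trans BU.
have mU : measurable U by exact: open_measurable.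
apply: le_lt_trans Ue.
rewrite -{1}(setDUK BU); apply: le_trans; first by apply: measureU2 => //; exact: measurableD.
by rewrite -/mu [X in (X + _ <= _)%E]B0 add0e.
Qed.

(** The bound on the right Dini derivative fails on a null set only, which is
covered by an open set [O] of small measure. Subtracting from [phi] the
primitive of [H], a small multiple of the identity and [K] times the measure of
[O] in [[0, t]] gives a function that does not increase to the right of any
point: on [O] because [phi] is [K]-Lipschitz, elsewhere because of the
bound. *)
Lemma le_primitive_dini phi H K M l : 0 <= l -> 0 <= K ->
  (forall s t, 0 <= s -> s <= t -> t <= l -> `|phi t - phi s| <= K * (t - s)) ->
  measurable_fun [set: R] H -> (forall t, 0 <= H t) -> (forall t, H t <= M) ->
  {ae mu, forall t, 0 < t -> t < l -> forall e, 0 < e ->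
    exists2 dl : R, 0 < dl & forall s, t < s -> s < t + dl -> s <= l ->
      phi s - phi t <= (H t + e) * (s - t)} ->
  phi l - phi 0 <= primitive H l.
Proof.
move=> l0 K0 lip mH H0 HM dini; apply/ler_addgt0Pr => e e0.
have lK0 : 0 < l + K + 1 by rewrite ltr_wpDl// addr_ge0.
pose e' := e / (l + K + 1).
have e'0 : 0 < e' by rewrite divr_gt0.
have e'E : e' * (l + K + 1) = e by rewrite /e' mulrVK// unitfE gt_eqF.
have nN := negligibleU dini (primitive_ae mH H0 HM).
set N := (X in mu.-negligible X) in nN.
have n0 : mu.-negligible (N `|` [set 0]).
  apply: negligibleU => //; exists [set 0]; split => //.
  by rewrite [LHS]lebesgue_measure_set1.
have [ O [oO NO muO]] := null_cover n0 e'0.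
have mO : measurable O by exact: open_measurable.
pose f : R -> R := \1_O.
have mf : measurable_fun [set: R] f by exact: measurable_indic.
have f0 t : 0 <= f t by [].
have f1 t : f t <= 1 by rewrite /f indicE; case: (_ \in _).
(* [f] is the indicator function of [O], so that [K * primitive f] absorbs the
   Lipschitz growth of [phi] on [O]. *)
pose psi t := phi t - primitive H t - e' * t - K * primitive f t.
have pO : primitive f l <= e'.
  rewrite /primitive /Rintegral integral_indic//= -lee_fin fineK.
    apply/ltW/le_lt_trans/muO.
    by rewrite le_measure// ?inE//; exact: measurableI.
  rewrite ge0_fin_numE//; apply: (@le_lt_trans _ _ (mu O)).
    by rewrite le_measure// ?inE//; exact: measurableI.
  by apply: lt_trans muO _; exact: ltry.
have p0 g : primitive g 0 = 0 by rewrite /primitive set_itv1 Rintegral_set1.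
have : psi l <= psi 0.
  apply: (@right_nonincreasing _ _ _ (K + M + e' + K)) => //.
    move=> s t s0 st tl.
    have h1 := lip s t s0 st tl.
    have /andP[h2 h2'] := primitiveB_ge0 mH H0 HM s0 st.
    have /andP[h3 h3'] := primitiveB_ge0 mf f0 f1 s0 st.
    have h4 : 0 <= K * (primitive f t - primitive f s) by rewrite mulr_ge0.
    have h5 : K * (primitive f t - primitive f s) <= K * (t - s).
      by rewrite ler_wpM2l//; move: h3'; rewrite mul1r.
    have h6 : 0 <= e' * (t - s) by rewrite mulr_ge0 ?subr_ge0// ltW.
    move: h1; rewrite !ler_norml /psi => /andP[h1 h1'].
    by apply/andP; split; nra.
  move=> t t0 tl; have [Ot|Ot] := pselect (O t).
    have /nbhs_ballP[dl /= dl0 dlP] : nbhs t O by exact: open_nbhs_nbhs.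
    exists dl => // s ts sdl sl.
    have h1 := lip t s t0 (ltW ts) sl.
    have /andP[h2 _] := primitiveB_ge0 mH H0 HM t0 (ltW ts).
    have /andP[h3 _] : 1 * (s - t) <= primitive f s - primitive f t <= 1 * (s - t).
      apply: (primitiveB mf f0 f1) => //; first exact: ltW.
      move=> x tx xs; rewrite /f indicE mem_set ?lexx//.
      by apply: dlP; rewrite /ball/= ltr0_norm ?subr_lt0//; lra.
    have h5 : K * (s - t) <= K * (primitive f s - primitive f t).
      by rewrite ler_wpM2l//; move: h3; rewrite mul1r.
    have h6 : 0 <= e' * (s - t) by rewrite mulr_ge0 ?subr_ge0// ltW.
    move: h1; rewrite ler_norml /psi => /andP[h1 h1'].
    nra.
  have t0' : 0 < t.
    rewrite lt_neqAle t0 andbT; apply/eqP => E; apply: Ot.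
    by apply: NO; right; rewrite -E.
  have /not_orP[/contrapT d1 /contrapT d2] : ~ N t.
    by move=> Nt; apply: Ot; apply: NO; left.
  have e20 : 0 < e' / 2 by rewrite divr_gt0.
  have [dl1 dl10 D1] := d1 t0' tl _ e20.
  have [dl2 dl20 D2] := d2 t0' _ e20.
  exists (Num.min dl1 dl2); first by rewrite lt_min dl10.
  move=> s ts sdl sl.
  have s1 : s < t + dl1 by apply: lt_le_trans sdl _; rewrite lerD2l ge_min lexx.
  have s2 : s < t + dl2 by apply: lt_le_trans sdl _; rewrite lerD2l ge_min lexx orbT.
  have := D1 s ts s1 sl.
  have := D2 s ts s2; rewrite ler_norml => /andP[h2 _] h1.
  have /andP[h3 _] := primitiveB_ge0 mf f0 f1 t0 (ltW ts).
  have h4 : 0 <= K * (primitive f s - primitive f t) by rewrite mulr_ge0.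
  rewrite /psi; nra.
rewrite /psi !p0.
have : K * primitive f l <= K * e' by rewrite ler_wpM2l.
nra.
Qed.

End real_line.

(** * The upper pointwise Lipschitz constant *)
Section pointwise_lip_theory.
Context {d : measure_display} {R : realType} {X : metricMeasurableType d R}.
Implicit Types (u v : X -> R) (x y : X) (c e L : R).

Definition lipR u x : R := fine (pointwise_lip u x).

Lemma pointwise_lip_ge0 u x : (0 <= pointwise_lip u x)%E.
Proof.
rewrite /pointwise_lip limf_esupE; apply: le_ereal_inf_tmp => /= _ [A A0 <-].
have [r Ar r0] : exists2 r : R, A r & 0 < r.
  have := @nbhs_right_gt R 0; move=> gt0.
  by have := filter_ex (filterI A0 gt0); move=> /(_ (at_right_proper_filter _))[r []]; exists r.
apply: le_ereal_sup_tmp; eexists; first by exists r.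
apply: le_ereal_sup_tmp; eexists; first by exists x; [exact: ballxx|reflexivity].
by rewrite lee_fin subrr normr0 mul0r.
Qed.

(** The upper limit is at most the supremum over the radii below [e]. *)
Lemma pointwise_lip_le u x c e : 0 <= c -> 0 < e ->
  (forall y, mdist x y < e -> `|u y - u x| <= c * mdist x y) ->
  (pointwise_lip u x <= c%:E)%E.
Proof.
move=> c0 e0 h; rewrite /pointwise_lip limf_esupE; apply: ge_ereal_inf.
eexists.
  exists [set r | 0 < r < e]; last reflexivity.
  by near=> r; apply/andP; split.
apply: ge_ereal_sup => _ [r /= /andP[r0 re] <-].
apply: ge_ereal_sup => _ [y /ball_mdist xy <-].
rewrite lee_fin ler_pdivrMr// (le_trans (h _ (lt_trans xy re)))//.
by rewrite ler_wpM2l// ltW.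
Unshelve. all: by end_near. Qed.

Section lipschitz.
Variables (u : X -> R) (L : R).
Hypothesis L0 : 0 <= L.
Hypothesis uL : forall x y, `|u x - u y| <= L * mdist x y.

Lemma lipRE x : pointwise_lip u x = (lipR u x)%:E.
Proof.
rewrite /lipR fineK// ge0_fin_numE ?pointwise_lip_ge0//.
apply: (@le_lt_trans _ _ L%:E); last exact: ltry.
by apply: (pointwise_lip_le L0 ltr01) => y _; rewrite metric_sym.
Qed.

Lemma lipR_ge0 x : 0 <= lipR u x.
Proof. by rewrite -lee_fin -lipRE pointwise_lip_ge0. Qed.

Lemma lipR_le x : lipR u x <= L.
Proof.
rewrite -lee_fin -lipRE.
by apply: (pointwise_lip_le L0 ltr01) => y _; rewrite metric_sym.
Qed.

(** A point [y] near [x] is tested against radii decreasing to [mdist x y]. *)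
Lemma lipR_local x e : 0 < e -> exists2 dl : R, 0 < dl &
  forall y, mdist x y < dl -> `|u y - u x| <= (lipR u x + e) * mdist x y.
Proof.
move=> e0; have : (pointwise_lip u x < (lipR u x + e)%:E)%E.
  by rewrite lipRE lte_fin ltrDl.
rewrite /pointwise_lip limf_esupE => /ereal_inf_lt[_ [A + <-]].
move=> /nbhs_ballP[dl /= dl0 dlA] hA.
exists dl => // y xy.
apply/ler_addgt0Pr => k k0.
have le0 : 0 < lipR u x + e by rewrite ltr_wpDl// lipR_ge0.
(* A radius slightly larger than the distance, still below [dl]. *)
pose r := mdist x y + Num.min ((dl - mdist x y) / 2) (k / (lipR u x + e)).
have mr : 0 < Num.min ((dl - mdist x y) / 2) (k / (lipR u x + e)).
  by rewrite lt_min !divr_gt0// subr_gt0.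
have xr : mdist x y < r by rewrite ltrDl.
have r0 : 0 < r by rewrite (le_lt_trans (mdist_ge0 x y)).
have Ar : A r.
  apply: dlA => //; rewrite /ball/= sub0r normrN gtr0_norm//.
  have : r <= mdist x y + (dl - mdist x y) / 2 by rewrite lerD2l ge_min lexx.
  by lra.
have : ((`|u y - u x| / r)%:E < (lipR u x + e)%:E)%E.
  apply: le_lt_trans hA; apply: le_ereal_sup_tmp; eexists; first by exists r.
  by apply: ereal_sup_ubound; exists y => //; exact/ball_mdist.
rewrite lte_fin ltr_pdivrMr// => /ltW/le_trans; apply.
rewrite /r mulrDr lerD2l -ler_pdivlMl//.
by rewrite ge_min [_^-1 * k]mulrC lexx orbT.
Qed.

End lipschitz.

Local Notation Xb := (g_sigma_algebraType (@open X)).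

Lemma open_borel (U : set X) : open U -> measurable (U : set Xb).
Proof. by move=> oU; apply: sub_sigma_algebra. Qed.

(** Being less than [a] at [x] means satisfying, for some [m] and [n], the
condition [C m n], and each of these conditions defines a closed set. *)
Lemma lipR_borel u L : 0 <= L -> (forall x y, `|u x - u y| <= L * mdist x y) ->
  measurable_fun [set: Xb] (lipR u : Xb -> R).
Proof.
move=> L0 uL mT; apply: (measurability _ (RGenInftyO.measurableE R)) => //.
move=> _ [_ [a ->] <-]; rewrite setTI.
pose c m := Num.max 0 (a - m.+1%:R^-1).
pose C m n := [set x | forall y, mdist x y < n.+1%:R^-1 -> `|u y - u x| <= c m * mdist x y].
have [a0|a0] := leP a 0.
  rewrite (_ : _ @^-1` _ = set0)//; apply/seteqP; split => // x /=.
  by rewrite in_itv/= => /(lt_le_trans)/(_ a0); rewrite ltNge (lipR_ge0 L0).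
have -> : lipR u @^-1` `]-oo, a[%classic = \bigcup_m \bigcup_n C m n.
  apply/seteqP; split => [x|x [m _ [n _ h]]] /=; rewrite in_itv/=; last first.
    have ca : c m < a by rewrite gt_max a0/= gtrBl invr_gt0 ltr0n.
    apply: le_lt_trans ca; rewrite -lee_fin -(lipRE L0 uL).
    apply: (@pointwise_lip_le _ _ _ n.+1%:R^-1) h; first by rewrite le_max lexx.
    by rewrite invr_gt0 ltr0n.
  move=> xa.
  have xa2 : 0 < (a - lipR u x) / 2 by rewrite divr_gt0// subr_gt0.
  have inv_lt (e : R) : 0 < e -> exists m, m.+1%:R^-1 < e.
    move=> e0; exists (Num.truncn e^-1).
    by rewrite -[ltRHS]invrK ltf_pV2 ?posrE ?invr_gt0 ?ltr0n// truncnS_gt.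
  have [m hm] := inv_lt _ xa2.
  have [dl dl0 h] := lipR_local L0 uL x xa2.
  have [n hn] := inv_lt _ dl0.
  exists m => //; exists n => // y xy.
  apply: (le_trans (h y (lt_trans xy hn))).
  rewrite ler_wpM2r ?mdist_ge0// /c le_max; apply/orP; right.
  rewrite lerBrDr; apply: (@le_trans _ _ (lipR u x + ((a - lipR u x) / 2 + (a - lipR u x) / 2))); last lra.
  by rewrite -addrA lerD2l lerD2l ltW.
apply: bigcupT_measurable => m; apply: bigcupT_measurable => n.
rewrite -(setCK (C m n)); apply: measurableC; apply: open_borel.
have cm0 : 0 <= c m by rewrite le_max lexx.
rewrite openE => x /= /existsNP[y /not_implyP[xy /negP]].
rewrite -ltNge => h.
pose s1 := n.+1%:R^-1 - mdist x y.
pose s2 := (`|u y - u x| - c m * mdist x y) / (L + c m + 1).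
have k0 : 0 < L + c m + 1 by rewrite ltr_wpDl// addr_ge0.
have s20 : 0 < s2 by rewrite divr_gt0// subr_gt0.
have s2E : s2 * (L + c m + 1) = `|u y - u x| - c m * mdist x y.
  by rewrite /s2 mulrVK// unitfE gt_eqF.
have s10 : 0 < s1 by rewrite subr_gt0.
apply/nbhs_ballP; exists (Num.min s1 s2) => /=; first by rewrite lt_min s10.
move=> z /ball_mdist; rewrite lt_min => /andP[z1 z2]; apply/existsNP; exists y.
apply/not_implyP; split.
  by rewrite (le_lt_trans (metric_triangle z x y))// (metric_sym z x) -ltrBrDr.
apply/negP; rewrite -ltNge.
have h1 := uL x z.
have h2 : `|u y - u x| <= `|u y - u z| + `|u x - u z|.
  by rewrite (distrC (u x)) (le_trans _ (ler_normD _ _))// addrA subrK.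
have h3 : c m * mdist z y <= c m * (mdist z x + mdist x y) by rewrite ler_wpM2l// metric_triangle.
have h4 : (L + c m + 1) * mdist x z < (L + c m + 1) * s2 by rewrite ltr_pM2l.
have := mdist_ge0 x z.
by rewrite (metric_sym z x) in h3; move: s2E h1 h2 h3 h4; nra.
Qed.

End pointwise_lip_theory.

(** * Weak upper gradients glued from several pieces *)
Section upper_gradients.
Context {d : measure_display} {R : realType} {X : metricMeasurableType d R}.
Local Notation Xb := (g_sigma_algebraType (@open X)).
Local Notation leb := (@lebesgue_measure R).
Implicit Types (u v : X -> R) (F U : set X) (L M : R).

(** Upper gradient of a function that is [M]-Lipschitz, varies no more than [u]
on [F] and vanishes on [U]. *)
Definition glued_grad u F U M (x : X) : R :=
  if x \in U then 0 else if x \in F then lipR u x else M.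

Lemma borel_of_lipschitz_curve (f : Xb -> R) (gam : R -> X) :
  (forall s t, mdist (gam s) (gam t) <= `|s - t|) ->
  measurable_fun [set: Xb] f -> measurable_fun [set: R] (f \o gam).
Proof.
move=> gl mf.
have mg : measurable_fun [set: R] (gam : R -> Xb).
  apply: (@measurability _ _ _ _ _ (gam : R -> Xb) (@open X)) => //.
  move=> _ [U oU <-]; rewrite setTI; apply: open_measurable.
  rewrite openE => t /= Ut.
  have /nbhs_ballP[e /= e0 eU] : nbhs (gam t) U by exact: open_nbhs_nbhs.
  apply/nbhs_ballP; exists e => // s ts; apply: eU; apply/ball_mdist.
  by apply: le_lt_trans (gl _ _) _.
exact: (measurableT_comp mf mg).
Qed.

Lemma glued_grad_borel u L F U M : 0 <= L -> (forall x y, `|u x - u y| <= L * mdist x y) ->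
  measurable (F : set Xb) -> open U ->
  measurable_fun [set: Xb] (glued_grad u F U M : Xb -> R).
Proof.
move=> L0 uL mF oU.
have mU : measurable (U : set Xb) by exact: open_borel.
have bU (V : set X) : measurable (V : set Xb) ->
    measurable_fun [set: Xb] (fun x : Xb => x \in V).
  move=> mV; apply: (measurable_fun_bool true) => //.
  rewrite setTI (_ : _ @^-1` _ = V)//.
  by apply/seteqP; split => x /=; [exact: set_mem|exact: mem_set].
apply: measurable_fun_if => //; first exact: bU.
apply: measurable_funTS; apply: measurable_fun_ifT => //; first exact: bU.
exact: lipR_borel L0 uL.
Qed.

Section along_curve.
Variables (u v : X -> R) (L M : R) (F U : set X).
Hypothesis L0 : 0 <= L.
Hypothesis uL : forall x y, `|u x - u y| <= L * mdist x y.
Hypothesis M0 : 0 <= M.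
Hypothesis vM : forall x y, `|v x - v y| <= M * mdist x y.
Hypothesis mF : measurable (F : set Xb).
Hypothesis oU : open U.
Hypothesis vU : forall x, U x -> v x = 0.
Hypothesis vF : forall x y, F x -> F y -> `|v x - v y| <= `|u x - u y|.

Lemma glued_grad_ge0 x : 0 <= glued_grad u F U M x.
Proof. by rewrite /glued_grad; case: ifP => // _; case: ifP => // _; exact: lipR_ge0 L0 uL _. Qed.

Lemma glued_grad_le x : glued_grad u F U M x <= L + M.
Proof.
rewrite /glued_grad; case: ifP => _; first by rewrite addr_ge0.
case: ifP => _; last by rewrite lerDr.
by rewrite (le_trans (lipR_le L0 uL x))// lerDl.
Qed.

(** The right Dini derivative of [v] along the curve is bounded at almost every
[t]. It is zero when the curve is in the open set [U], and at most [M] always.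
At a density point of the preimage of [F] every later parameter [s] is close,
relative to [s - t], to a parameter whose image is in [F], where [v] varies no
more than [u]; this replaces [M] by the pointwise Lipschitz constant of [u]. *)
Lemma glued_along (gam : R -> X) l : 0 <= l ->
  (forall s t, mdist (gam s) (gam t) <= `|s - t|) ->
  v (gam l) - v (gam 0) <= primitive (glued_grad u F U M \o gam) l.
Proof.
move=> l0 gl.
have mH : measurable_fun [set: R] (glued_grad u F U M \o gam).
  by apply: borel_of_lipschitz_curve => //; exact: glued_grad_borel L0 uL mF oU.
have vg s t : `|v (gam t) - v (gam s)| <= M * `|t - s|.
  by rewrite (le_trans (vM _ _))// ler_wpM2l.
have mA : measurable (gam @^-1` F).
  rewrite -[X in measurable X]setTI.
  have mg : measurable_fun [set: R] (\1_F \o gam : R -> R).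
    by apply: borel_of_lipschitz_curve => //; exact: measurable_indic.
  rewrite (_ : gam @^-1` F = (\1_F \o gam : R -> R) @^-1` [set 1]); first exact: mg.
  apply/seteqP; split => t /=; rewrite indicE; first by move=> /mem_set ->.
  by case: (boolP (gam t \in F)) => [/set_mem//|_ /esym/eqP]; rewrite oner_eq0.
apply: (@le_primitive_dini _ (v \o gam) (glued_grad u F U M \o gam) M (L + M) l) => //=.
- by move=> s t _ st _; rewrite -[X in _ <= _ * X]ger0_norm ?subr_ge0.
- by move=> t; exact: glued_grad_ge0.
- by move=> t; exact: glued_grad_le.
have := density_right mA; apply: filterS; first exact: (ae_filter_ringOfSetsType leb).
move=> t /= ht t0 tl e e0; rewrite /glued_grad.
case: (boolP (gam t \in U)) => [/set_mem Ut|_].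
  have /nbhs_ballP[dl /= dl0 dlP] : nbhs (gam t) U by exact: open_nbhs_nbhs.
  exists dl => // s ts sdl _.
  have Us : U (gam s).
    apply: dlP; apply/ball_mdist; apply: le_lt_trans (gl _ _) _.
    by rewrite distrC gtr0_norm ?subr_gt0//; lra.
  by rewrite (vU Us) (vU Ut) subrr add0r mulr_ge0// ltW// subr_gt0.
case: (boolP (gam t \in F)) => [/set_mem Ft|_]; last first.
  exists 1 => // s ts _ _; apply: (le_trans (ler_norm _)).
  apply: (le_trans (vg _ _)); rewrite gtr0_norm ?subr_gt0//.
  by rewrite ler_wpM2r// ?subr_ge0 ?lerDl ltW.
pose K := L + M + 1.
have K0 : 0 < K by rewrite ltr_wpDl// addr_ge0.
(* The relative gap allowed at a density point; multiplied by M it costs at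
   most e / 2. *)
pose e1 := Num.min 1 (e / 2 / K).
have e10 : 0 < e1 by rewrite lt_min ltr01 !divr_gt0.
have e1K : e1 * K <= e / 2 by rewrite -ler_pdivlMr// ge_min lexx orbT.
have e11 : e1 <= 1 by rewrite ge_min lexx.
have [dl dl0 dlP] := ht t0 Ft e1 e10 e11.
have e20 : 0 < e / 2 by rewrite divr_gt0.
have [dl' dl'0 dlP'] := lipR_local L0 uL (gam t) e20.
exists (Num.min dl dl'); first by rewrite lt_min dl0.
move=> s ts sdl _.
have sdl1 : s < t + dl by apply: lt_le_trans sdl _; rewrite lerD2l ge_min lexx.
have sdl2 : s < t + dl' by apply: lt_le_trans sdl _; rewrite lerD2l ge_min lexx orbT.
have [s' [As ts' ss' hs']] := dlP s ts sdl1.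
have g1 : mdist (gam t) (gam s') <= s' - t.
  by rewrite (le_trans (gl _ _))// distrC ger0_norm ?subr_ge0.
have h1 : v (gam s') - v (gam t) <= (lipR u (gam t) + e / 2) * (s' - t).
  apply: (le_trans (ler_norm _)); apply: (le_trans (vF As Ft)).
  apply: (le_trans (dlP' _ _)); first by apply: le_lt_trans g1 _; lra.
  by rewrite ler_wpM2l// addr_ge0 ?(lipR_ge0 L0 uL)// ltW.
have h2 : v (gam s) - v (gam s') <= M * (s - s').
  by apply: (le_trans (ler_norm _)); rewrite (le_trans (vg _ _))// ger0_norm ?subr_ge0.
have h3 : M * (s - s') <= M * (e1 * (s - t)) by rewrite ler_wpM2l.
have h4 : (lipR u (gam t) + e / 2) * (s' - t) <= (lipR u (gam t) + e / 2) * (s - t).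
  rewrite ler_wpM2l//; last by lra.
  by rewrite addr_ge0 ?(lipR_ge0 L0 uL)// ltW.
have h5 : M * (e1 * (s - t)) <= e / 2 * (s - t).
  have st0 : 0 <= s - t by rewrite subr_ge0 ltW.
  rewrite mulrA ler_wpM2r//; apply: (le_trans _ e1K).
  by rewrite mulrC ler_wpM2l//; [exact: ltW|rewrite /K; move: L0; lra].
nra.
Qed.

End along_curve.

(** The arc-length parametrization is 1-Lipschitz on the parameter interval and
is extended to the line by clamping the parameter, so that [glued_along] applies
to [v] and to its opposite. *)
Lemma glued_ug u v L M F U : 0 <= L -> (forall x y, `|u x - u y| <= L * mdist x y) ->
  0 <= M -> (forall x y, `|v x - v y| <= M * mdist x y) ->
  measurable (F : set Xb) -> open U -> (forall x, U x -> v x = 0) ->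
  (forall x y, F x -> F y -> `|v x - v y| <= `|u x - u y|) ->
  forall c a b, is_curve c a b ->
    ug_inequality (EFin \o v) (EFin \o glued_grad u F U M) c a b.
Proof.
move=> L0 uL M0 vM mF oU vU vF c a b [cc rect [s [_ [sab _ _]]]].
have ab : a <= b by move: sab; rewrite in_itv/= => /andP[]; exact: le_trans.
split => // _ /=; set l := fine (curve_length c a b).
have l0 : 0 <= l by rewrite fine_ge0// curve_length_ge0.
(* Clamping to [0, l] gives a 1-Lipschitz curve defined on the whole line. *)
pose cl (t : R) := Num.max 0 (Num.min t l).
have cl0 t : 0 <= cl t by rewrite le_max lexx.
have cll t : cl t <= l by rewrite ge_max l0/= ge_min lexx orbT.
have clE t : 0 <= t -> t <= l -> cl t = t.
  by move=> t0 tl; rewrite /cl (min_idPl tl) (max_idPr t0).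
have clL s' t : `|cl s' - cl t| <= `|s' - t|.
  wlog st : s' t / s' <= t.
    move=> h; have [st|/ltW ts] := leP s' t; first exact: h.
    by rewrite distrC (distrC s'); exact: h.
  have m : cl s' <= cl t.
    rewrite /cl ge_max le_max lexx/= le_max le_min !ge_min lexx orbT andbT.
    by rewrite st orbT.
  rewrite distrC (distrC s') !ger0_norm ?subr_ge0// lerBlDr.
  rewrite {1}/cl ge_max addr_ge0 ?subr_ge0//= ge_min.
  have [sl|ls] := leP s' l.
    suff : s' <= cl s' by move=> h; apply/orP; left; lra.
    by rewrite /cl le_max le_min lexx sl orbT.
  suff : l <= cl s' by move=> h; apply/orP; right; lra.
  by rewrite /cl le_max le_min lexx (ltW ls) orbT.
pose gam t := arc_length_param c a b (cl t).
have gl s' t : mdist (gam s') (gam t) <= `|s' - t|.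
  by apply: le_trans (clL s' t); apply: (arc_length_param_lip ab cc rect).
have g0 : gam 0 = c a by rewrite /gam clE// arc_length_param0.
have g1 : gam l = c b by rewrite /gam clE// arc_length_param1.
have mH : measurable_fun [set: R] (glued_grad u F U M \o gam).
  by apply: borel_of_lipschitz_curve => //; exact: glued_grad_borel L0 uL mF oU.
have key w : (forall x y, `|w x - w y| <= M * mdist x y) -> (forall x, U x -> w x = 0) ->
    (forall x y, F x -> F y -> `|w x - w y| <= `|u x - u y|) ->
    w (c b) - w (c a) <= primitive (glued_grad u F U M \o gam) l.
  by move=> wM wU wF; rewrite -g0 -g1; apply: (@glued_along u w L M F U).
have h1 := key v vM vU vF.
have h2 : v (c a) - v (c b) <= primitive (glued_grad u F U M \o gam) l.
  rewrite -[X in X <= _]opprK opprB; rewrite (_ : - _ = (- v (c b)) - (- v (c a))); last by ring.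
  apply: (key (fun x => - v x)).
  - by move=> x y; rewrite -opprD normrN.
  - by move=> x Ux; rewrite vU// oppr0.
  - by move=> x y Fx Fy; rewrite -opprD normrN; exact: vF.
have -> : line_integral c a b (EFin \o glued_grad u F U M) =
    (primitive (glued_grad u F U M \o gam) l)%:E.
  rewrite /primitive /Rintegral fineK.
    apply: eq_integral => t; rewrite inE/= in_itv/= => /andP[t0 tl].
    by rewrite /gam clE.
  apply: integrable_fin_num => //.
  apply: (@bounded_integrable _ _ (L + M)) => //.
  - by move=> t /=; exact: (@glued_grad_ge0 u L M F U).
  - by move=> t /=; exact: (@glued_grad_le u L M F U).
  - exact: itv_lt_pinfty.
by rewrite lee_fin ler_norml; apply/andP; split; move: h1 h2; lra.
Qed.

Variable mu : {measure set X -> \bar R}.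
Hypothesis cbm : complete_borel_measure mu.

Lemma borel_measurable (A : set X) : measurable (A : set Xb) -> measurable A.
Proof.
case: cbm => mo _ _; apply: smallest_sub; first exact: sigma_algebra_measurable.
by move=> U; exact: mo.
Qed.

Lemma borel_measurable_fun d' (T : measurableType d') (f : X -> T) :
  measurable_fun [set: Xb] (f : Xb -> T) -> measurable_fun [set: X] f.
Proof. by move=> mf _ B mB; apply: borel_measurable; exact: (mf measurableT). Qed.

(** As the inequality holds along all curves, the exceptional function can be
taken to be zero. *)
Lemma glued_weak_upper_gradient p u v L M F U :
  0 < p -> 0 <= L -> (forall x y, `|u x - u y| <= L * mdist x y) ->
  0 <= M -> (forall x y, `|v x - v y| <= M * mdist x y) ->
  measurable (F : set Xb) -> open U -> (forall x, U x -> v x = 0) ->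
  (forall x y, F x -> F y -> `|v x - v y| <= `|u x - u y|) ->
  weak_upper_gradient mu p (EFin \o v) (EFin \o glued_grad u F U M).
Proof.
move=> p0 L0 uL M0 vM mF oU vU vF; split.
- apply/measurable_EFinP; apply: borel_measurable_fun.
  exact: glued_grad_borel L0 uL mF oU.
- by move=> x; rewrite lee_fin (@glued_grad_ge0 u L M F U).
- exists (cst 0%E); split => //.
  + by rewrite /borel_fun; exact: measurable_cst.
  + rewrite (eq_integral (cst 0%E)) ?integral0 ?ltry// => x _.
    by rewrite poweR0r// gt_eqF.
  + by move=> c a b cab []; exact: (@glued_ug u v L M F U).
Qed.

Lemma lip_weak_upper_gradient p u L : 0 < p -> 0 <= L ->
  (forall x y, `|u x - u y| <= L * mdist x y) ->
  weak_upper_gradient mu p (EFin \o u) (pointwise_lip u).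
Proof.
move=> p0 L0 uL.
have -> : pointwise_lip u = EFin \o glued_grad u setT set0 L.
  by apply/funext => x /=; rewrite /glued_grad in_set0 in_setT (lipRE L0 uL).
by apply: (@glued_weak_upper_gradient p u u L L); rewrite // ?open0//; exact: open0.
Qed.

End upper_gradients.

(** * Distance functions, truncated sets and Lipschitz extension *)
Section distance.
Context {d : measure_display} {R : realType} {X : metricMeasurableType d R}.
Local Notation Xb := (g_sigma_algebraType (@open X)).
Implicit Types (x y z w : X) (A E S : set X) (r e K L : R) (u : X -> R).

Lemma dist_to_has_inf A x : A !=set0 -> has_inf [set mdist x y | y in A].
Proof.
move=> [a Aa]; split; first by exists (mdist x a), a.
by exists 0 => _ [y _ <-]; exact: mdist_ge0.
Qed.

Lemma dist_to_le A x a : A a -> dist_to A x <= mdist x a.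
Proof.
move=> Aa; apply: ge_inf; last by exists a.
by have [] := @dist_to_has_inf A x; [exists a|].
Qed.

Lemma le_dist_to A x (y : R) : A !=set0 ->
  (forall a, A a -> y <= mdist x a) -> y <= dist_to A x.
Proof.
by move=> [a Aa] h; apply: lb_le_inf; [exists (mdist x a), a|move=> _ [b Ab <-]; exact: h].
Qed.

Lemma dist_to_ge0 A x : A !=set0 -> 0 <= dist_to A x.
Proof. by move=> A0; apply: le_dist_to => // a _; exact: mdist_ge0. Qed.

Lemma dist_to_lip A x y : A !=set0 -> `|dist_to A x - dist_to A y| <= mdist x y.
Proof.
move=> A0; have h (z t : X) : dist_to A z <= dist_to A t + mdist z t.
  rewrite -lerBlDr; apply: le_dist_to => // a Aa; rewrite lerBlDr.
  by rewrite (le_trans (dist_to_le z Aa))// addrC metric_triangle.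
rewrite ler_norml; apply/andP; split.
  by have := h y x; rewrite (metric_sym y x); lra.
by have := h x y; lra.
Qed.

Lemma dist_to_in A x : A x -> dist_to A x = 0.
Proof.
move=> Ax; apply/eqP; rewrite eq_le dist_to_ge0 ?andbT; last by exists x.
by rewrite -(mdistxx x) dist_to_le.
Qed.

Lemma dist_to_gt0 A x : A !=set0 -> closed A -> ~ A x -> 0 < dist_to A x.
Proof.
move=> A0 cA nAx.
have : nbhs x (~` A) by apply: open_nbhs_nbhs; split => //; exact: closed_openC.
move=> /nbhs_ballP[e /= e0 eA]; apply: (lt_le_trans e0).
apply: le_dist_to => // a Aa; rewrite leNgt; apply/negP => xa.
by apply: (eA a) => //; exact/ball_mdist.
Qed.

Lemma dist_to_adherent A x e : A !=set0 -> 0 < e ->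
  exists2 a, A a & mdist x a < dist_to A x + e.
Proof.
move=> A0 e0; have [_ [a Aa <-] h] := inf_adherent e0 (dist_to_has_inf x A0).
by exists a.
Qed.

Lemma open_ball x r : open (ball x r).
Proof.
rewrite openE => y /ball_mdist xy; apply/nbhs_ballP; exists (r - mdist x y) => /=.
  by rewrite subr_gt0.
move=> z /ball_mdist yz; apply/ball_mdist.
by rewrite (le_lt_trans (metric_triangle x y z))// -ltrBrDl.
Qed.

Lemma closure_ball_le x y r : closure (ball x r) y -> mdist x y <= r.
Proof.
move=> h; apply/ler_addgt0Pr => e e0.
have [|z [/ball_mdist xz /ball_mdist yz]] := h (ball y e).
  by apply: open_nbhs_nbhs; split; [exact: open_ball|exact: ballxx].
by apply/ltW; rewrite (le_lt_trans (metric_triangle x z y))// ltrD// metric_sym.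
Qed.

Lemma lipschitz_borel u L : (forall x y, `|u x - u y| <= L * mdist x y) ->
  measurable_fun [set: Xb] (u : Xb -> R).
Proof.
move=> uL mT; apply: (measurability _ (RGenOInfty.measurableE R)) => //.
move=> _ [_ [a ->] <-]; rewrite setTI; apply: open_borel.
rewrite openE => x /=; rewrite in_itv/= andbT => ax.
have L0 : 0 < `|L| + 1 by rewrite ltr_wpDl.
apply/nbhs_ballP; exists ((u x - a) / (`|L| + 1)) => /=.
  by rewrite divr_gt0// subr_gt0.
move=> y /ball_mdist; rewrite ltr_pdivlMr// => xy; rewrite /= in_itv/= andbT.
have h1 := uL x y; have h2 : L * mdist x y <= mdist x y * (`|L| + 1).
  by rewrite mulrC ler_wpM2l ?mdist_ge0// (le_trans (ler_norm L))// lerDl.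
have := ler_norm (u x - u y); lra.
Qed.

Section trunc_facts.
Variables (E : set X) (w : X) (r : R).
Hypotheses (cE : closed E) (Ew : E w) (r0 : 0 < r).
Local Notation EB := (trunc E w r).

Lemma trunc_step_sub j : trunc_step E w r j `<=` E.
Proof. by case: j => [|j] x /=; [case|move=> [y _ []]]. Qed.

Lemma trunc_sub : EB `<=` E.
Proof.
move=> x xE; rewrite ((closure_id E).1 cE); move: x xE.
by apply: closure_subset => x [j _]; exact: trunc_step_sub.
Qed.

Lemma trunc_center : EB w.
Proof.
apply: subset_closure; exists 0%N => //=; split => //.
by apply: subset_closure; apply: ballxx; rewrite divr_gt0.
Qed.

Lemma trunc_closed : closed EB. Proof. exact: closed_closure. Qed.

(** The radii of the successive steps add up to [r/2 + r/4 + ...]. *)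
Lemma trunc_step_radius j x : trunc_step E w r j x -> mdist w x <= r * (1 - 2 ^- j.+1).
Proof.
elim: j x => [|j ih] x /=.
  by move=> [_ /closure_ball_le]; rewrite expr1; lra.
move=> [y yj [_ /closure_ball_le h]].
rewrite (le_trans (metric_triangle w y x))// (le_trans (lerD (ih _ yj) h))//.
have -> : 2 ^- j.+1 = 2 * 2 ^- j.+2 :> R.
  by rewrite [in RHS]exprS invfM mulrA divff ?mul1r.
by move: (2 ^- j.+2) => k; lra.
Qed.

Lemma trunc_radius x : EB x -> mdist w x <= r.
Proof.
move=> h; apply: closure_ball_le.
have sub : \bigcup_j trunc_step E w r j `<=` ball w r.
  move=> y [j _ /trunc_step_radius yj]; apply/ball_mdist; apply: (le_lt_trans yj).
  by rewrite mulrBr mulr1 gtrBl mulr_gt0// invr_gt0 exprn_gt0.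
exact: (closure_subset sub).
Qed.

End trunc_facts.

(** The extension is the largest [K]-Lipschitz function that is at most [u] on [S],
namely the infimum of the cones [u y + K mdist x y] over [y] in [S]. *)
Lemma mcshane S u K : S !=set0 -> 0 <= K ->
  (forall x y, S x -> S y -> `|u x - u y| <= K * mdist x y) ->
  exists v : X -> R, (forall x y, `|v x - v y| <= K * mdist x y) /\
    forall x, S x -> v x = u x.
Proof.
move=> [s0 Ss0] K0 h; pose T x := [set u y + K * mdist x y | y in S].
have lb x y : S y -> u s0 - K * mdist x s0 <= u y + K * mdist x y.
  move=> Sy; have h1 := h _ _ Sy Ss0.
  have h2 : K * mdist y s0 <= K * (mdist x y + mdist x s0).
    by rewrite ler_wpM2l// (metric_sym x y) metric_triangle.
  by move: h1; rewrite ler_norml => /andP[]; lra.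
have hT x : has_inf (T x).
  split; first by exists (u s0 + K * mdist x s0), s0.
  by exists (u s0 - K * mdist x s0) => _ [y Sy <-]; exact: lb.
exists (fun x => inf (T x)); split => [x y|x Sx].
  have half z t : inf (T z) <= inf (T t) + K * mdist z t.
    rewrite -lerBlDr; apply: lb_le_inf; first by case: (hT t).
    move=> _ [y' Sy <-]; rewrite lerBlDr.
    apply: (@le_trans _ _ (u y' + K * mdist z y')).
      by apply: ge_inf; [case: (hT z)|exists y'].
    by rewrite -addrA lerD2l -mulrDr ler_wpM2l// addrC metric_triangle.
  rewrite ler_norml; apply/andP; split.
    by have := half y x; rewrite (metric_sym y x); lra.
  by have := half x y; lra.
apply/eqP; rewrite eq_le; apply/andP; split.
  apply: ge_inf; first by case: (hT x).
  by exists x => //; rewrite mdistxx mulr0 addr0.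
apply: lb_le_inf; first by case: (hT x).
move=> _ [y Sy <-]; have := h _ _ Sx Sy.
by rewrite ler_norml => /andP[]; lra.
Qed.

End distance.

(** * Integrals of bounded measurable functions *)
Lemma exists_pow2_ge (R : realType) (r s : R) : 0 < r -> 0 < s -> exists k, r <= 2 ^+ k * s.
Proof.
move=> r0 s0; exists (Num.truncn (r / s)).+1.
rewrite -ler_pdivrMr//; apply: (@le_trans _ _ (Num.truncn (r / s)).+1%:R).
  by apply/ltW; exact: truncnS_gt.
by rewrite -natrX ler_nat ltnW// ltn_expl.
Qed.

Lemma powRV (R : realType) (a p : R) : 0 <= a -> (a^-1) `^ p = (a `^ p)^-1.
Proof. by move=> a0; rewrite -powR_inv1// -powRrM mulN1r powRN. Qed.

Section bounded_measurable.
Context {d : measure_display} {T : measurableType d} {R : realType}.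
Implicit Types (f g : T -> R) (A D : set T) (k p : R).

(** All integrands below are bounded, since [u] is Lipschitz, and are integrated
over sets of finite measure. Their integrals are thus real numbers and form a
positive linear functional, which reduces most integral inequalities to
pointwise ones. *)
Definition bounded_mfun f := measurable_fun [set: T] f /\ exists B : R, forall x, `|f x| <= B.

Lemma bmf_cst k : bounded_mfun (fun _ => k).
Proof. by split; [exact: measurable_cst|exists `|k|]. Qed.

Lemma bmf_indic A : measurable A -> bounded_mfun (\1_A).
Proof.
move=> mA; split; first exact: measurable_indic.
by exists 1 => x; rewrite ger0_norm// indicE; case: (_ \in _).
Qed.

Lemma bmfD f g : bounded_mfun f -> bounded_mfun g -> bounded_mfun (fun x => f x + g x).
Proof.
move=> [mf [B fB]] [mg [C gC]]; split; first exact: measurable_funD.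
by exists (B + C) => x; rewrite (le_trans (ler_normD _ _))// lerD.
Qed.

Lemma bmfM f g : bounded_mfun f -> bounded_mfun g -> bounded_mfun (fun x => f x * g x).
Proof.
move=> [mf [B fB]] [mg [C gC]]; split; first exact: measurable_funM.
by exists (B * C) => x; rewrite normrM ler_pM.
Qed.

Lemma bmfB f g : bounded_mfun f -> bounded_mfun g -> bounded_mfun (fun x => f x - g x).
Proof.
move=> [mf [B fB]] [mg [C gC]]; split; first exact: measurable_funB.
by exists (B + C) => x; rewrite (le_trans (ler_normB _ _))// lerD.
Qed.

Lemma bmfZ k f : bounded_mfun f -> bounded_mfun (fun x => k * f x).
Proof. exact/bmfM/bmf_cst. Qed.

Lemma bmf_norm f : bounded_mfun f -> bounded_mfun (fun x => `|f x|).
Proof.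
move=> [mf [B fB]]; split; first exact: measurableT_comp.
by exists B => x; rewrite normr_id.
Qed.

Lemma bmf_powR f p : 0 <= p -> (forall x, 0 <= f x) -> bounded_mfun f -> bounded_mfun (fun x => f x `^ p).
Proof.
move=> p0 f0 [mf [B fB]]; split.
  exact: (measurableT_comp (measurable_powR p) mf).
exists (B `^ p) => x; have fB' : f x <= B by apply: le_trans (fB x); exact: ler_norm.
rewrite ger0_norm ?powR_ge0// ge0_ler_powR// nnegrE//.
exact: le_trans (f0 x) fB'.
Qed.

Lemma bmf_sum (I : Type) (s : seq I) (F : I -> T -> R) : (forall i, bounded_mfun (F i)) ->
  bounded_mfun (fun x => \sum_(i <- s) F i x).
Proof.
move=> h; elim: s => [|i s ih].
  by rewrite (_ : (fun x => _) = fun _ => 0); [exact: bmf_cst|apply/funext => x; rewrite big_nil].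
rewrite (_ : (fun x => _) = fun x => F i x + \sum_(j <- s) F j x); first exact: bmfD.
by apply/funext => x; rewrite big_cons.
Qed.

Variables (mu : {measure set T -> \bar R}) (V : set T).
Hypotheses (mV : measurable V) (muV : (mu V < +oo)%E).

Definition Rint_on f : R := \int[mu]_(x in V) f x.

Lemma bmf_integrable f D : measurable D -> D `<=` V -> bounded_mfun f -> mu.-integrable D (EFin \o f).
Proof.
move=> mD DV [mf [B fB]]; apply: measurable_bounded_integrable => //.
- by apply: le_lt_trans muV; rewrite le_measure ?inE.
- exact: measurable_funS mf.
exists B; split; first by rewrite num_real.
by move=> x Bx y _ /=; rewrite (le_trans (fB y))// ltW.
Qed.

Lemma Rint_on_le f g : bounded_mfun f -> bounded_mfun g -> (forall x, V x -> f x <= g x) -> Rint_on f <= Rint_on g.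
Proof. by move=> bf bg fg; apply: le_Rintegral => //; exact: bmf_integrable. Qed.

Lemma Rint_onD f g : bounded_mfun f -> bounded_mfun g -> Rint_on (fun x => f x + g x) = Rint_on f + Rint_on g.
Proof. by move=> bf bg; apply: RintegralD => //; exact: bmf_integrable. Qed.

Lemma Rint_onZ k f : bounded_mfun f -> Rint_on (fun x => k * f x) = k * Rint_on f.
Proof. by move=> bf; apply: RintegralZl => //; exact: bmf_integrable. Qed.

Lemma Rint_on0 : Rint_on (fun _ => 0) = 0.
Proof.
rewrite -[RHS](mul0r (Rint_on (fun _ => 0))) -(Rint_onZ _ (bmf_cst 0)); congr Rint_on.
by apply/funext => x; rewrite mul0r.
Qed.

Lemma Rint_on_sum (I : Type) (s : seq I) (F : I -> T -> R) : (forall i, bounded_mfun (F i)) ->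
  Rint_on (fun x => \sum_(i <- s) F i x) = \sum_(i <- s) Rint_on (F i).
Proof.
move=> h; elim: s => [|i s ih].
  rewrite big_nil (_ : (fun x => _) = fun _ => 0) ?Rint_on0//.
  by apply/funext => x; rewrite big_nil.
rewrite big_cons -ih -Rint_onD//; last exact: bmf_sum.
by congr Rint_on; apply/funext => x; rewrite big_cons.
Qed.

Lemma Rint_on_ge0 f : (forall x, V x -> 0 <= f x) -> 0 <= Rint_on f.
Proof. exact: Rintegral_ge0. Qed.

Lemma Rint_on_EFin f D : measurable D -> D `<=` V -> bounded_mfun f ->
  (\int[mu]_(x in D) (f x)%:E = (Rint_on (fun x => \1_D x * f x))%:E)%E.
Proof.
move=> mD DV bf; rewrite /Rint_on /Rintegral.
have -> : (\int[mu]_(x in V) (\1_D x * f x)%:E = \int[mu]_(x in D) (f x)%:E)%E.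
  rewrite [RHS](_ : _ = \int[mu]_(x in V `&` D) (f x)%:E)%E; last by rewrite setIidr.
  rewrite integral_mkcondr; apply: eq_integral => x _.
  rewrite patchE indicE; case: (x \in D); by rewrite ?mul1r// mul0r.
by rewrite fineK//; apply: integrable_fin_num => //; exact: bmf_integrable.
Qed.

Lemma Rint_on_indic D : measurable D -> D `<=` V -> mu D = (Rint_on (\1_D))%:E.
Proof.
move=> mD DV; have := Rint_on_EFin mD DV (bmf_cst 1).
rewrite integral_cst// mul1e => ->; congr (Rint_on _)%:E.
by apply/funext => x; rewrite mulr1.
Qed.

End bounded_measurable.

(** * The Hardy inequality on one level set *)
Section distance_quotients.
Context {d : measure_display} {R : realType} {X : metricMeasurableType d R}.
Local Notation Xb := (g_sigma_algebraType (@open X)).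

Lemma powR_continuous_gt0 (p x : R) : 0 < x -> {for x, continuous (fun a : R => a `^ p)}.
Proof.
move=> x0; apply: differentiable_continuous; apply/derivable1_diffP.
by apply: derivable_powR; rewrite in_itv/= x0.
Qed.

Variable mu : {measure set X -> \bar R}.
Hypothesis cbm : complete_borel_measure mu.

Lemma closed_borel (A : set X) : closed A -> measurable (A : set Xb).
Proof.
by move=> cA; rewrite -(setCK A); apply: measurableC; apply: open_borel; exact: closed_openC.
Qed.

Lemma open_set_measurable (U : set X) : open U -> measurable U.
Proof. by move=> oU; apply: (borel_measurable cbm); exact: open_borel. Qed.

Variables (EB : set X) (u : X -> R) (L : R).
Hypotheses (EB0 : EB !=set0) (cEB : closed EB).

(** Points of [EB] at distance almost [dist_to EB x] from [x] are zeros of [v]. *)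
Lemma quotient_bounds (v : X -> R) K : 0 <= K -> (forall x y, `|v x - v y| <= K * mdist x y) ->
  (forall x, EB x -> v x = 0) ->
  (forall x, `|v x| <= K * dist_to EB x) /\ (forall x, `|v x| / dist_to EB x <= K).
Proof.
move=> K0 vK v0.
have h x : `|v x| <= K * dist_to EB x.
  apply/ler_addgt0Pr => e e0.
  have K1 : 0 < K + 1 by rewrite ltr_wpDl.
  have eK : 0 < e / (K + 1) by rewrite divr_gt0.
  have [a EBa xa] := dist_to_adherent x EB0 eK.
  have := vK x a; rewrite (v0 a EBa) subr0 => hv; apply: (le_trans hv).
  apply: (@le_trans _ _ (K * (dist_to EB x + e / (K + 1)))).
    by rewrite ler_wpM2l// ltW.
  rewrite mulrDr lerD2l mulrA ler_pdivrMr//.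
  by rewrite mulrC ler_wpM2l ?lerDl// ltW.
split => // x; have [EBx|EBx] := pselect (EB x).
  by rewrite (v0 x EBx) normr0 mul0r.
by rewrite ler_pdivrMr// dist_to_gt0.
Qed.

(** The reciprocal of the distance is its power with exponent [-1], also where
the distance vanishes. *)
Lemma quotient_measurable (v : X -> R) K : (forall x y, `|v x - v y| <= K * mdist x y) ->
  measurable_fun [set: Xb] ((fun x => `|v x| / dist_to EB x) : Xb -> R).
Proof.
move=> vK; apply: measurable_funM.
  by apply: measurableT_comp => //; exact: lipschitz_borel vK.
rewrite (_ : (fun x => _) = (fun x => dist_to EB x `^ (-1))); last first.
  by apply/funext => x; rewrite powR_inv1// dist_to_ge0.
apply: (measurableT_comp (measurable_powR (-1))).
by apply: (@lipschitz_borel _ _ _ _ 1) => x y; rewrite mul1r dist_to_lip.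
Qed.

Lemma quotient_bmf (v : X -> R) K : 0 <= K -> (forall x y, `|v x - v y| <= K * mdist x y) ->
  (forall x, EB x -> v x = 0) -> bounded_mfun (fun x => `|v x| / dist_to EB x).
Proof.
move=> K0 vK v0; split; first by apply: (borel_measurable_fun cbm); exact: quotient_measurable vK.
exists K => x; have [_ h] := quotient_bounds K0 vK v0.
by rewrite ger0_norm// divr_ge0// dist_to_ge0.
Qed.

Lemma lipR_bmf : 0 <= L -> (forall x y, `|u x - u y| <= L * mdist x y) -> bounded_mfun (lipR u).
Proof.
move=> L0 uL; split.
  by apply: (borel_measurable_fun cbm); exact: lipR_borel L0 uL.
by exists L => x; rewrite ger0_norm ?(lipR_ge0 L0 uL)// (lipR_le L0 uL).
Qed.

End distance_quotients.

Lemma powR_div (R : realType) (a b p : R) : 0 <= a -> 0 <= b ->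
  (a / b) `^ p = a `^ p / b `^ p.
Proof. by move=> a0 b0; rewrite powRM ?invr_ge0// powRV. Qed.

Section hardy_at_level.
Context {d : measure_display} {R : realType} {X : metricMeasurableType d R}.
Local Notation Xb := (g_sigma_algebraType (@open X)).
Variable mu : {measure set X -> \bar R}.
Hypothesis cbm : complete_borel_measure mu.
Variables (p tau CH : R) (E : set X).
Hypotheses (p1 : 1 < p) (tau1 : 1 <= tau) (cE : closed E).
Hypothesis hardy : local_hardy mu p tau E CH.
Variables (w : X) (r : R).
Hypotheses (Ew : E w) (r0 : 0 < r) (rd : (r%:E < (8^-1)%:E * diam [set: X])%E).
Local Notation EB := (trunc E w r).
Local Notation dE := (dist_to EB).
Variables (V : set X).
Hypotheses (mV : measurable V) (muV : (mu V < +oo)%E).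
Let D8 : set X := ball w (8 * tau * r).
Let W : set X := ball w (8 * tau ^+ 2 * r).
Hypothesis WV : W `<=` V.
Variables (u : X -> R) (L : R).
Hypotheses (L0 : 0 <= L) (uL : forall x y, `|u x - u y| <= L * mdist x y).
Hypothesis uE : forall x, E x -> u x = 0.

Local Notation I := (Rint_on mu V).

Lemma D8W : D8 `<=` W.
Proof.
move=> x /ball_mdist h; apply/ball_mdist; apply: lt_le_trans h _.
by rewrite ler_pM2r// ler_pM2l// expr2 ler_peMl// (le_trans ler01).
Qed.

Let EB0 : EB !=set0. Proof. by exists w; exact: trunc_center. Qed.

(** The function [u] is [K]-Lipschitz on the union of [EB] and [F], hence extends
from there to a [K]-Lipschitz function [v]. Its truncations [(|v| - del)_+]
vanish in a neighbourhood of [EB], so the Hardy inequality applies to them with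
the gradient glued from [lipR u] on [F], zero near [EB] and [K] elsewhere.
Monotone convergence lets [del] tend to zero. *)
Lemma hardy_level (F : set X) (K : R) : measurable (F : set Xb) -> F `<=` W -> 0 < K ->
  (forall x, F x -> `|u x| <= K * dE x) ->
  (forall x y, F x -> F y -> `|u x - u y| <= K * mdist x y) ->
  I (fun x => \1_(D8 `&` F) x * (`|u x| / dE x) `^ p) <=
  Num.max CH 0 * I (fun x => \1_F x * lipR u x `^ p + K `^ p * \1_(W `\` F) x).
Proof.
move=> mF FW K0 Fd Fu.
have p0 : 0 < p by apply: lt_trans p1.
have uEB x : EB x -> u x = 0 by move=> /(trunc_sub cE); exact: uE.
have EBF : (EB `|` F) !=set0 by exists w; left; exact: trunc_center.
have [|v [vK vu]] := @mcshane _ _ _ (EB `|` F) u K EBF (ltW K0).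
  have h x y : EB x -> F y -> `|u x - u y| <= K * mdist x y.
    move=> Ex Fy; rewrite (uEB x Ex) sub0r normrN (le_trans (Fd y Fy))// ler_wpM2l ?(ltW K0)//.
    by rewrite metric_sym dist_to_le.
  move=> x y [Ex|Fx] [Ey|Fy].
  - by rewrite !uEB// subrr normr0 mulr_ge0 ?(ltW K0) ?mdist_ge0.
  - exact: h.
  - by rewrite distrC metric_sym; exact: h.
  - exact: Fu.
have vEB x : EB x -> v x = 0 by move=> Ex; rewrite vu ?uEB//; left.
have [vd vdK] := quotient_bounds EB0 (@trunc_closed _ _ _ E w r) (ltW K0) vK vEB.
pose del (n : nat) : R := n.+1%:R^-1.
have del0 n : 0 < del n by rewrite invr_gt0.
(* The truncations, and open neighbourhoods of the truncated set on which they
   vanish. *)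
pose vn n x : R := Num.max (`|v x| - del n) 0.
have vn0 n x : 0 <= vn n x by rewrite le_max lexx orbT.
have vnv n x y : `|vn n x - vn n y| <= `|v x - v y|.
  have h a b : vn n a <= vn n b + `|v a - v b|.
    have h1 : `|v b| - del n <= vn n b by rewrite le_max lexx.
    rewrite {1}/vn ge_max addr_ge0// andbT.
    have := lerB_dist (v a) (v b); move: (vn n b) h1 => k h1.
    by move: (del n) h1 => k'; lra.
  rewrite ler_norml; apply/andP; split.
    by have := h y x; rewrite (distrC (v y)); lra.
  by have := h x y; lra.
have vnK n x y : `|vn n x - vn n y| <= K * mdist x y by exact: le_trans (vnv n x y) (vK x y).
have vnEB n x : EB x -> vn n x = 0.
  by move=> /vEB vx; rewrite /vn vx normr0 sub0r; apply/max_idPr; rewrite oppr_le0 ltW.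
pose U n := [set x | dE x < del n / K].
have oU n : open (U n).
  rewrite openE => x /= xU; apply/nbhs_ballP; exists (del n / K - dE x) => /=.
    by rewrite subr_gt0.
  move=> y /ball_mdist xy; rewrite /U /=.
  by have := dist_to_lip x y EB0; rewrite ler_norml => /andP[]; lra.
have vnU n x : U n x -> vn n x = 0.
  rewrite /U /= ltr_pdivlMr// => h; rewrite /vn; apply/max_idPr.
  by rewrite subr_le0 (le_trans (vd x))// mulrC ltW.
have dU n : (0 < set_dist EB (~` U n))%E.
  apply: (@lt_le_trans _ _ (del n / K)%:E); first by rewrite lte_fin divr_gt0.
  apply: le_ereal_inf_tmp => _ [[a b] /= [Ea /negP Ub] <-].
  by rewrite lee_fin metric_sym (le_trans _ (dist_to_le b Ea))// leNgt.
pose G (n : nat) : X -> R := glued_grad u F (U n) K.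
have G0 (n : nat) (x : X) : 0 <= G n x by exact: (@glued_grad_ge0 _ _ _ u L K F (U n) L0 uL (ltW K0)).
have Gb (n : nat) : bounded_mfun (G n).
  split.
    apply: (borel_measurable_fun cbm).
    exact: (@glued_grad_borel _ _ _ u L F (U n) K L0 uL mF (oU n)).
  exists (L + K) => x; rewrite ger0_norm//.
  exact: (@glued_grad_le _ _ _ u L K F (U n) L0 uL (ltW K0)).
have wug (n : nat) : weak_upper_gradient mu p (EFin \o vn n) (EFin \o G n).
  apply: (glued_weak_upper_gradient cbm (L := L)) => //.
  - exact: ltW.
  - exact: vnU.
  - move=> x y Fx Fy; rewrite (le_trans (vnv n x y))// !vu//; by right.
have mEB : measurable EB.
  by apply: (borel_measurable cbm); apply: closed_borel; exact: trunc_closed.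
have mD8 : measurable D8 by apply: (open_set_measurable cbm); exact: open_ball.
have mW : measurable W by apply: (open_set_measurable cbm); exact: open_ball.
have mFX : measurable F by exact: (borel_measurable cbm).
have mDE : measurable (D8 `\` EB) by exact: measurableD.
have DEV : D8 `\` EB `<=` V by move=> x [/D8W/WV].
have bq (n : nat) : bounded_mfun (fun x => `|vn n x| / dE x).
  exact: (quotient_bmf cbm EB0 (@trunc_closed _ _ _ E w r) (ltW K0) (vnK n) (@vnEB n)).
have bqv : bounded_mfun (fun x => `|v x| / dE x).
  exact: (quotient_bmf cbm EB0 (@trunc_closed _ _ _ E w r) (ltW K0) vK vEB).
have q0 (z : X -> R) x : 0 <= `|z x| / dE x by rewrite divr_ge0 ?dist_to_ge0.
have step (n : nat) : I (fun x => \1_(D8 `\` EB) x * (`|vn n x| / dE x) `^ p) <=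
    Num.max CH 0 * I (fun x => \1_F x * lipR u x `^ p + K `^ p * \1_(W `\` F) x).
  have blip := lipR_bmf cbm L0 uL.
  have bg : bounded_mfun (fun x => \1_F x * lipR u x `^ p + K `^ p * \1_(W `\` F) x).
    apply: bmfD.
      apply: bmfM; first exact: bmf_indic.
      by apply: bmf_powR => //; [exact: ltW|move=> x; exact: lipR_ge0 L0 uL x].
    by apply: bmfZ; apply: bmf_indic; exact: measurableD.
  have bG : bounded_mfun (fun x => G n x `^ p) by apply: bmf_powR => //; exact: ltW.
  have := hardy Ew r0 rd (v := vn n) (g := EFin \o G n) (U := U n).
  move=> /(_ (ex_intro _ K (vnK n)) (wug n) (oU n) (or_introl (dU n))).
  have -> : (forall x, U n x -> vn n x = 0 /\ (EFin \o G n) x = 0%E) = True.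
    apply/propext; split => // _ x Ux; split; first exact: vnU.
    by rewrite /= /G /glued_grad mem_set.
  move=> /(_ Logic.I).
  rewrite (eq_integral (fun x => ((`|vn n x| / dE x) `^ p)%:E)); last first.
    by move=> x _; rewrite powR_div// dist_to_ge0.
  rewrite [X in (_ <= _ * X)%E](eq_integral (fun x => (G n x `^ p)%:E))//.
  rewrite (Rint_on_EFin mV muV mDE DEV); last by apply: bmf_powR => //; [exact: ltW].
  rewrite (Rint_on_EFin mV muV mW WV)// -EFinM lee_fin => /le_trans; apply.
  apply: (@le_trans _ _ (Num.max CH 0 * I (fun x => \1_W x * G n x `^ p))).
    rewrite ler_wpM2r ?le_max ?lexx//; apply: Rint_on_ge0 => x _.
    by rewrite mulr_ge0 ?powR_ge0.
  rewrite ler_wpM2l ?le_max ?lexx ?orbT//; apply: Rint_on_le => //.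
    by apply: bmfM => //; exact: bmf_indic.
  move=> x _; rewrite !indicE in_setD.
  have [xW|xW] := boolP (x \in W); last first.
    by rewrite mul0r addr_ge0// ?mulr_ge0 ?powR_ge0.
  rewrite mul1r /G /glued_grad.
  have Kp := powR_ge0 K p; have lp := powR_ge0 (lipR u x) p.
  case: ifP => _; first by rewrite powR0 ?gt_eqF// addr_ge0// mulr_ge0.
  by case: ifP => _ /=; rewrite ?mulr1 ?mul1r ?mulr0 ?mul0r ?addr0 ?add0r.
have lim : ((I (fun x => \1_(D8 `\` EB) x * (`|vn n x| / dE x) `^ p))%:E @[n --> \oo] -->
   (I (fun x => \1_(D8 `\` EB) x * (`|v x| / dE x) `^ p))%:E)%E.
  rewrite -(Rint_on_EFin mV muV mDE DEV (bmf_powR (ltW p0) (q0 v) bqv)).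
  under eq_fun => n do
    rewrite -(Rint_on_EFin mV muV mDE DEV (bmf_powR (ltW p0) (q0 (vn n)) (bq n))).
  pose g n x := ((`|vn n x| / dE x) `^ p)%:E.
  have mg n : measurable_fun (D8 `\` EB) (g n).
    apply/measurable_EFinP; apply: measurable_funTS.
    by have [] := bmf_powR (ltW p0) (q0 (vn n)) (bq n).
  have g0 n x : (D8 `\` EB) x -> (0 <= g n x)%E by rewrite lee_fin powR_ge0.
  have ndg x : (D8 `\` EB) x -> {homo g^~ x : n m / (n <= m)%N >-> (n <= m)%E}.
    move=> _ n m nm; rewrite lee_fin ge0_ler_powR ?nnegrE ?q0 ?(ltW p0)//.
    rewrite ler_wpM2r ?invr_ge0 ?dist_to_ge0// !ger0_norm// /vn.
    rewrite ge_max !le_max lexx orbT andbT; apply/orP; left.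
    by rewrite lerB// lef_pV2 ?posrE// ler_nat.
  have := cvg_monotone_convergence mDE mg g0 ndg.
  have <- : (\int[mu]_(x in D8 `\` EB) limn (g^~ x) =
     \int[mu]_(x in D8 `\` EB) ((`|v x| / dE x) `^ p)%:E)%E.
    apply: eq_integral => x _; apply/cvg_lim => //; apply/cvg_EFin.
      by apply: nearW.
    rewrite [X in X @ _ --> _](_ : _ = fun n => (vn n x / dE x) `^ p); last first.
      by apply/funext => n; rewrite /= /g/= ger0_norm.
    have [v0|v0] := eqVneq (v x) 0.
      rewrite [X in X @ _ --> _](_ : _ = fun n => (`|v x| / dE x) `^ p); first exact: cvg_cst.
      apply/funext => n; rewrite v0 normr0; congr (_ `^ _); congr (_ / _).
      by rewrite /vn v0 normr0 sub0r; apply/max_idPr; rewrite oppr_le0 ltW.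
    have dx : 0 < dE x.
      apply: dist_to_gt0 => //; first exact: trunc_closed.
      by move=> /vEB vx; rewrite vx eqxx in v0.
    have vx : 0 < `|v x| / dE x by rewrite divr_gt0// normr_gt0.
    apply: (@continuous_cvg _ _ _ _ _ _ (fun a : R => a `^ p)).
      exact: powR_continuous_gt0.
    apply: cvgMl; apply: (@squeeze_cvgr _ _ _ _ (fun n => `|v x| - del n) (fun=> `|v x|)).
    - apply: nearW => n; rewrite le_max lexx /= /vn ge_max normr_ge0 andbT.
      by rewrite gerBl ltW.
    - rewrite -[X in _ --> X]subr0; apply: cvgB; first exact: cvg_cst.
      exact: cvg_harmonic.
    - exact: cvg_cst.
  exact.
have : I (fun x => \1_(D8 `\` EB) x * (`|v x| / dE x) `^ p) <=
    Num.max CH 0 * I (fun x => \1_F x * lipR u x `^ p + K `^ p * \1_(W `\` F) x).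
  rewrite -lee_fin; apply: (cvge_le _ lim).
  by apply: nearW => n; rewrite lee_fin; exact: step.
apply: le_trans.
have bqu : bounded_mfun (fun x => `|u x| / dE x).
  exact: (quotient_bmf cbm EB0 (@trunc_closed _ _ _ E w r) L0 uL uEB).
apply: Rint_on_le => //.
- apply: bmfM; first by apply: bmf_indic; exact: measurableI.
  by apply: bmf_powR => //; exact: ltW.
- apply: bmfM; first exact: bmf_indic.
  by apply: bmf_powR => //; exact: ltW.
move=> x _; rewrite !indicE in_setI in_setD.
have [xD|xD] /= := boolP (x \in D8); last by rewrite !mul0r.
have [xEB|xEB] /= := boolP (x \in EB).
  by rewrite mul0r (uEB x (set_mem xEB)) normr0 mul0r powR0 ?gt_eqF// mulr0.
have [xF|xF] /= := boolP (x \in F); last by rewrite mul0r mul1r powR_ge0.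
by rewrite vu//; right; exact: set_mem.
Qed.

End hardy_at_level.

(** * Doubling measures: coverings and separability *)
Section doubling_facts.
Context {d : measure_display} {R : realType} {X : metricMeasurableType d R}.
Variable mu : {measure set X -> \bar R}.
Hypothesis cbm : complete_borel_measure mu.
Hypothesis pos : positive_finite_on_balls mu.
Variable CD : R.
Hypotheses (CD1 : 1 <= CD) (dbl : doubling mu CD).
Implicit Types (x y z w : X) (r s e : R).

Lemma metric_ball_measurable x s : measurable (ball x s).
Proof. by apply: (open_set_measurable cbm); exact: open_ball. Qed.

Lemma mu_ball_lty x s : 0 < s -> (mu (ball x s) < +oo)%E.
Proof. by move=> /(pos x)/andP[]. Qed.

Lemma subset_ball x y r s : mdist y x + s <= r -> ball x s `<=` ball y r.
Proof.
move=> h z /ball_mdist xz; apply/ball_mdist; apply: lt_le_trans h.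
by rewrite (le_lt_trans (metric_triangle y x z))// ltrD2l.
Qed.

Lemma doubling_iter x s k : 0 < s -> (mu (ball x (2 ^+ k * s)) <= (CD ^+ k)%:E * mu (ball x s))%E.
Proof.
move=> s0; elim: k => [|k ih]; first by rewrite !expr0 mul1r mul1e.
rewrite exprS -mulrA; apply: (le_trans (dbl _ _)); first by rewrite mulr_gt0// exprn_gt0.
rewrite exprS EFinM -muleA lee_pmul2l// lte_fin.
exact: lt_le_trans CD1.
Qed.

Section finite_vitali.
Variables (I : eqType) (ce : I -> X) (rad : I -> R).
Local Notation B j := (ball (ce j) (rad j) : set X).

(** Greedy choice: keep a ball of largest radius, discard those meeting it, and
repeat. Every discarded ball lies in the triple of the one it met. Disjointness
is recorded as a bound on the sum of the indicator functions, which is the form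
in which it gets integrated. *)
Lemma finite_vitali (s : seq I) : exists s' : seq I, [/\ {subset s' <= s},
  forall x, \sum_(j <- s') \1_(B j) x <= 1 :> R &
  forall x, (exists2 j, j \in s & B j x) ->
    exists2 j, j \in s' & ball (ce j) (3 * rad j) x].
Proof.
have [n] := ubnP (size s); elim: n s => // n ih [|j1 s1] sn.
  by exists [::]; split => // [x|x [j]]; rewrite ?big_nil// in_nil.
set s := j1 :: s1.
have [j0 js jmax] : exists2 j0, j0 \in s & forall j, j \in s -> rad j <= rad j0.
  rewrite /s; elim: s1 j1 {sn s} => [|j2 s2 ih2] j1.
    by exists j1; rewrite ?mem_head// => j; rewrite inE => /eqP ->.
  have [j3 j3s h3] := ih2 j2; have [h|/ltW h] := leP (rad j1) (rad j3).
    exists j3; first by rewrite inE j3s orbT.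
    by move=> j; rewrite inE => /predU1P[->//|]; exact: h3.
  exists j1; rewrite ?mem_head// => j; rewrite inE => /predU1P[->//|js].
  by apply: le_trans h; exact: h3.
pose P j := (j != j0) && `[< B j `&` B j0 = set0 >].
have : (size [seq j <- s | P j] < n)%N.
  apply: leq_trans (_ : size s <= n)%N; last by rewrite -ltnS.
  rewrite size_filter -(count_predC P s) -[X in (X < _)%N]addn0.
  by rewrite ltn_add2l -has_count; apply/hasP; exists j0; rewrite //= /P eqxx.
move=> /ih[t [ts t1 tc]].
exists (j0 :: t); split.
- move=> j; rewrite inE => /predU1P[->//|/ts]; by rewrite mem_filter => /andP[].
- move=> x; rewrite big_cons indicE; have [xj|xj] := boolP (x \in B j0); last by rewrite add0r.
  rewrite big1_seq ?addr0// => j /andP[_ /ts]; rewrite mem_filter => /andP[/andP[_ /asboolP Pj] _].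
  rewrite indicE memNset// => xB; have : (B j `&` B j0) x by split => //; exact: set_mem.
  by rewrite Pj.
- move=> x [j jx Bx]; have [Pj|] := boolP (P j).
    have [|j' j't h] := tc x; last by exists j' => //; rewrite inE j't orbT.
    by exists j => //; rewrite mem_filter jx andbT.
  have ne0 : B j `&` B j0 != set0 -> exists2 j, j \in j0 :: t & ball (ce j) (3 * rad j) x.
    exists j0; first exact: mem_head.
    have /set0P[z [/ball_mdist z1 /ball_mdist z2]] : B j `&` B j0 != set0 by [].
    move/ball_mdist : Bx => Bx; apply/ball_mdist.
    have := jmax j jx; have := metric_triangle (ce j0) z x; have := metric_triangle z (ce j) x.
    by rewrite (metric_sym z (ce j)); lra.
  rewrite negb_and negbK => /orP[/eqP E|/asboolP/eqP//]; apply: ne0.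
  by rewrite -E setIid; apply/set0P; exists x.
Qed.
End finite_vitali.

(** Without a finite net there are arbitrarily many points at mutual distance at
least [e]. The balls of radius [e / 2] around them are disjoint, lie in a fixed
ball, and by doubling have measure bounded from below. *)
Lemma finite_net w r e : 0 < r -> 0 < e -> exists l : seq X,
  (forall y, y \in l -> ball w r y) /\
  forall x, ball w r x -> exists2 y, y \in l & mdist y x < e.
Proof.
move=> r0 e0; apply: contrapT => no.
have sep n : exists l : seq X, [/\ size l = n, forall y, y \in l -> ball w r y &
    forall x, \sum_(y <- l) \1_(ball y (e / 2) : set X) x <= 1 :> R].
  elim: n => [|n [l [sl lw l1]]].
    by exists [::]; split => // x; rewrite big_nil.
  have [x [xw xl]] : exists x, ball w r x /\ forall y, y \in l -> e <= mdist y x.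
    apply: contrapT => h; apply: no; exists l; split => // x xw.
    apply: contrapT => h2; apply: h; exists x; split => // y yl.
    by rewrite leNgt; apply/negP => yx; apply: h2; exists y.
  exists (x :: l); split; first by rewrite /= sl.
    by move=> y; rewrite inE => /predU1P[->|/lw].
  move=> z; rewrite big_cons indicE.
  have [zx|zx] := boolP (z \in _); last by rewrite add0r.
  rewrite big1_seq ?addr0// => y /andP[_ yl]; rewrite indicE memNset// => /ball_mdist yz.
  have /ball_mdist xz := set_mem zx.
  have := xl y yl; have := metric_triangle y z x; rewrite (metric_sym z x); lra.
have e20 : 0 < e / 2 by rewrite divr_gt0.
have re0 : 0 < r + e by rewrite addr_gt0.
(* Doubling [k] times a ball of radius [e / 2] centred in the ball of radius [r]
   covers the latter. *)
have [k hk] := exists_pow2_ge (mulr_gt0 (@ltr0n R 2) r0) e20.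
pose V : set X := ball w (r + e).
have mV : measurable V by exact: metric_ball_measurable.
have muV : (mu V < +oo)%E by exact: mu_ball_lty.
have /andP[mw0 mw1] := pos w r0.
pose m := fine (mu (ball w r)).
have m0 : 0 < m by rewrite fine_gt0// mw0.
pose c := m / CD ^+ k.
have CDk : 0 < CD ^+ k by rewrite exprn_gt0// (lt_le_trans ltr01).
have c0 : 0 < c by rewrite divr_gt0.
have bV y : ball w r y -> ball y (e / 2) `<=` V.
  move=> /ball_mdist yw; apply: subset_ball; lra.
have bc y : ball w r y -> c <= Rint_on mu V (\1_(ball y (e / 2) : set X)).
  move=> yw; rewrite ler_pdivrMr// -lee_fin fineK ?ge0_fin_numE//.
  rewrite mulrC EFinM -Rint_on_indic//; [|exact: metric_ball_measurable|exact: bV].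
  apply: le_trans (doubling_iter y k e20).
  rewrite le_measure// ?inE; [exact: metric_ball_measurable|exact: metric_ball_measurable|].
  apply: subset_ball; move/ball_mdist : yw; rewrite metric_sym => yw.
  by apply: le_trans hk; lra.
have key n : n%:R * c <= Rint_on mu V (fun=> 1).
  have [l [<- lw l1]] := sep n.
  apply: (@le_trans _ _ (\sum_(y <- l) Rint_on mu V (\1_(ball y (e / 2) : set X)))).
    rewrite mulr_natl (_ : c *+ size l = \sum_(y <- l) c); last first.
      by rewrite big_const_seq count_predT iter_addr_0.
    by rewrite big_seq [leRHS]big_seq; apply: ler_sum => y /lw/bc.
  rewrite -Rint_on_sum//; last by move=> y; apply: bmf_indic; exact: metric_ball_measurable.
  apply: Rint_on_le => //; last exact: bmf_cst.
  by apply: bmf_sum => y; apply: bmf_indic; exact: metric_ball_measurable.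
have := key (Num.truncn (Rint_on mu V (fun=> 1) / c)).+1.
by rewrite -ler_pdivlMr// leNgt truncnS_gt.
Qed.

Lemma dense_sequence w r : 0 < r -> exists a : nat -> X, (forall k, ball w r (a k)) /\
  forall x e, ball w r x -> 0 < e -> exists k, mdist (a k) x < e.
Proof.
move=> r0.
have /choice[l hl] : forall n : nat, exists l : seq X, (forall y, y \in l -> ball w r y) /\
    forall x, ball w r x -> exists2 y, y \in l & mdist y x < n.+1%:R^-1.
  by move=> n; apply: finite_net => //; rewrite invr_gt0 ltr0n.
(* Enumeration of the union of the nets [l n]; the centre [w] is the default. *)
pose a k := if unpickle k is Some (n, j) then nth w (l n) j else w.
have wr : ball w r w by exact: ballxx.
exists a; split.
  move=> k; rewrite /a; case: unpickle => [[n j]|//].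
  have [jl|jl] := ltnP j (size (l n)); last by rewrite nth_default.
  by apply: (hl n).1; exact: mem_nth.
move=> x e xw e0; have [y yl yx] := (hl (Num.truncn e^-1)).2 x xw.
exists (pickle (Num.truncn e^-1, index y (l (Num.truncn e^-1)))).
rewrite /a pickleK nth_index//; apply: (lt_trans yx).
by rewrite -[ltRHS]invrK ltf_pV2 ?posrE ?invr_gt0 ?ltr0n// truncnS_gt.
Qed.

End doubling_facts.

(** * Poincare inequalities and chains of balls *)
Section poincare_facts.
Context {d : measure_display} {R : realType} {X : metricMeasurableType d R}.
Variable mu : {measure set X -> \bar R}.
Hypothesis cbm : complete_borel_measure mu.
Hypothesis pos : positive_finite_on_balls mu.
Variables (CD CP tau : R).
Hypotheses (CD1 : 1 <= CD) (dbl : doubling mu CD) (CP0 : 0 < CP) (tau1 : 1 <= tau).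
Variables (z : X) (rho : R).
Hypothesis rho0 : 0 < rho.
Variables (u : X -> R) (L : R).
Hypotheses (L0 : 0 <= L) (uL : forall x y, `|u x - u y| <= L * mdist x y).
Implicit Types (x y : X) (s c q lam kap D T : R) (A B Q : set X).

Let V : set X := ball z rho.
Local Notation I := (Rint_on mu V).
Local Notation m A := (Rint_on mu V (\1_A)).
(** Cutting [u] off outside [V] makes it bounded without changing its averages
over subsets of [V]. *)
Definition local_u x : R := \1_V x * u x.
Local Notation uV := local_u.
Definition avg A : R := I (fun x => \1_A x * uV x) / m A.

Lemma mV_x : measurable V. Proof. exact: (metric_ball_measurable cbm). Qed.
Lemma muV_ : (mu V < +oo)%E. Proof. exact: mu_ball_lty. Qed.
Let mV := mV_x.
Let muV := muV_.

Lemma local_uE x : V x -> uV x = u x.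
Proof. by move=> Vx; rewrite /uV indicE mem_set// mul1r. Qed.

Lemma local_u_bmf : bounded_mfun uV.
Proof.
split.
  apply: measurable_funM; first exact: measurable_indic.
  by apply: (borel_measurable_fun cbm); exact: lipschitz_borel uL.
exists (`|u z| + L * rho) => x; rewrite /uV indicE; have [xV|_] := boolP (x \in V).
  rewrite mul1r; move/set_mem/ball_mdist : xV => xV.
  have h1 : `|u x| <= `|u z| + `|u x - u z| by have := lerB_dist (u x) (u z); lra.
  apply: (le_trans h1); rewrite lerD2l (le_trans (uL _ _))// metric_sym ler_wpM2l//.
  exact: ltW.
by rewrite mul0r normr0 addr_ge0// mulr_ge0// ltW.
Qed.

Let buV := local_u_bmf.
Let blip : bounded_mfun (lipR u) := lipR_bmf cbm L0 uL.

Lemma lip_powR_bmf q : 0 <= q -> bounded_mfun (fun x => lipR u x `^ q).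
Proof. by move=> q0; apply: bmf_powR => // x; exact: lipR_ge0 L0 uL x. Qed.

Lemma osc_bmf q c : 0 <= q -> bounded_mfun (fun x => `|uV x - c| `^ q).
Proof.
move=> q0; apply: bmf_powR => //; apply: bmf_norm; apply: bmfB => //; exact: bmf_cst.
Qed.

Lemma indic_bmf A (f : X -> R) : measurable A -> bounded_mfun f -> bounded_mfun (fun x => \1_A x * f x).
Proof. by move=> mA bf; apply: bmfM => //; exact: bmf_indic. Qed.

Lemma mass_ball_gt0 x s : 0 < s -> ball x s `<=` V -> 0 < m (ball x s : set X).
Proof.
move=> s0 sV; rewrite -lte_fin -Rint_on_indic//; last exact: (metric_ball_measurable cbm).
by have /andP[] := pos x s0.
Qed.

Lemma mass_le A B : measurable A -> measurable B -> A `<=` B -> m A <= m B.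
Proof.
move=> mA mB AB; apply: Rint_on_le => //; [exact: bmf_indic|exact: bmf_indic|].
move=> x _; rewrite !indicE; have [xA|//] := boolP (x \in A).
by rewrite mem_set//; apply: AB; exact: set_mem.
Qed.

Lemma mass_doubling x y s (t : R) k : 0 < s -> 0 < t -> ball x s `<=` V -> ball y t `<=` V ->
  mdist x y + t <= 2 ^+ k * s -> m (ball y t : set X) <= CD ^+ k * m (ball x s : set X).
Proof.
move=> s0 t0 xV yV h; have mb x' s' := metric_ball_measurable cbm x' s'.
rewrite -lee_fin EFinM -!Rint_on_indic//.
apply: le_trans (doubling_iter CD1 dbl x k s0).
by rewrite le_measure ?inE//; exact: subset_ball.
Qed.

Lemma average_Rint_on (f : X -> R) (F : X -> \bar R) A : measurable A -> A `<=` V -> bounded_mfun f ->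
  (forall x, A x -> F x = (f x)%:E) -> 0 < m A ->
  average mu F A = (I (fun x => \1_A x * f x) / m A)%:E.
Proof.
move=> mA AV bf Ff mA0; rewrite /average.
rewrite (eq_integral (fun x => (f x)%:E)); last by move=> x /set_mem; exact: Ff.
rewrite (Rint_on_EFin mV muV mA AV bf) (Rint_on_indic mV muV mA AV).
by rewrite inver gt_eqF// -EFinM.
Qed.

Lemma diam_ball x s : 0 < s -> (diam (ball x s : set X) <= (2 * s)%:E)%E.
Proof.
move=> s0; apply: ge_ereal_sup => _ [[y y'] [/ball_mdist h /ball_mdist h'] <-] /=.
by rewrite lee_fin (le_trans (metric_triangle y x y'))// (metric_sym y); lra.
Qed.

Lemma diam_ge0 x s : 0 < s -> (0 <= diam (ball x s : set X))%E.
Proof.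
move=> s0; apply: ereal_sup_ubound; exists (x, x) => /=; last by rewrite mdistxx.
by split; exact: ballxx.
Qed.

(** The Poincare inequality with denominators cleared, for real numbers. *)
Lemma poincare_real q x s B Q : 0 < q -> poincare mu q CP tau -> 0 < s ->
  B = ball x s -> Q = ball x (tau * s) -> Q `<=` V ->
  I (fun y => \1_B y * `|uV y - avg B| `^ q) * m Q <=
  CP * (2 * s) `^ q * m B * I (fun y => \1_Q y * lipR u y `^ q).
Proof.
move=> q0 hP s0 BE QE QV.
have t0 : 0 < tau by apply: lt_le_trans tau1.
have mB : measurable B by rewrite BE; exact: (metric_ball_measurable cbm).
have mQ : measurable Q by rewrite QE; exact: (metric_ball_measurable cbm).
have BQ : B `<=` Q by rewrite BE QE; apply: subset_ball; rewrite mdistxx add0r ler_peMl// ltW.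
have BV : B `<=` V by exact: subset_trans BQ QV.
have mB0 : 0 < m B by rewrite BE; apply: mass_ball_gt0; rewrite -?BE.
have mQ0 : 0 < m Q by rewrite QE; apply: mass_ball_gt0; rewrite -?QE// mulr_gt0.
have mu_ : measurable_fun [set: X] (EFin \o u).
  by apply/measurable_EFinP; apply: (borel_measurable_fun cbm); exact: lipschitz_borel uL.
have [h _] := hP x s s0 (EFin \o u) (pointwise_lip u) mu_
  (lip_weak_upper_gradient cbm q0 L0 uL).
cbv zeta in h; rewrite -BE -QE in h.
have iu : mu.-integrable B (EFin \o u).
  apply: (eq_integrable mB (EFin \o uV)).
    by move=> y /set_mem By /=; rewrite local_uE//; exact: BV.
  exact: (bmf_integrable mV muV).
have := h iu.
rewrite (@average_Rint_on uV (EFin \o u) B)//; last by move=> y By /=; rewrite local_uE//; exact: BV.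
rewrite -/(avg B).
rewrite (@average_Rint_on (fun y => `|uV y - avg B| `^ q) _ B)//; last 2 first.
- by apply: osc_bmf; exact: ltW.
- by move=> y By /=; rewrite local_uE//; exact: BV.
rewrite (@average_Rint_on (fun y => lipR u y `^ q) _ Q)//; last 2 first.
- by apply: lip_powR_bmf; exact: ltW.
- by move=> y Qy; rewrite (lipRE L0 uL).
set J1 := I (fun y => \1_B y * _); set J2 := I (fun y => \1_Q y * _).
have J20 : 0 <= J2.
  by apply: Rint_on_ge0 => y _; rewrite mulr_ge0 ?powR_ge0.
move=> h1.
have : ((J1 / m B)%:E <= (CP * (2 * s) `^ q * (J2 / m Q))%:E)%E.
  apply: (le_trans h1); rewrite [leRHS]EFinM lee_wpmul2r//.
    by rewrite lee_fin divr_ge0// ltW.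
  rewrite [leRHS]EFinM lee_wpmul2l ?lee_fin ?(ltW CP0)// -poweR_EFin BE.
  apply: gt0_ler_poweR; [exact: ltW|..|exact: diam_ball].
    by rewrite in_itv/= leey andbT diam_ge0.
  by rewrite in_itv/= leey andbT lee_fin mulr_ge0// ltW.
rewrite lee_fin ler_pdivrMr// => h2.
have -> : CP * (2 * s) `^ q * m B * J2 = CP * (2 * s) `^ q * (J2 / m Q) * m B * m Q.
  by field; rewrite gt_eqF.
by rewrite ler_pM2r.
Qed.

Lemma Rint_on_sub_avg B c : measurable B -> m B != 0 ->
  I (fun y => \1_B y * (uV y - c)) = m B * (avg B - c).
Proof.
move=> mB mB0; rewrite (_ : (fun y => _) = (fun y => \1_B y * uV y + (- c) * \1_B y)).
  rewrite Rint_onD//; [|exact: indic_bmf|by apply: bmfZ; exact: bmf_indic].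
  by rewrite Rint_onZ//; [rewrite /avg; field|exact: bmf_indic].
by apply/funext => y; ring.
Qed.

Lemma avg_near B c D : measurable B -> B `<=` V -> 0 < m B ->
  (forall y, B y -> `|u y - c| <= D) -> `|avg B - c| <= D.
Proof.
move=> mB BV mB0 h.
have mB0' : m B != 0 by rewrite gt_eqF.
have b1 : bounded_mfun (fun y => \1_B y * (uV y - c)).
  by apply: indic_bmf => //; apply: bmfB => //; exact: bmf_cst.
have b2 (k : R) : bounded_mfun (fun y => k * \1_B y) by apply: bmfZ; exact: bmf_indic.
rewrite -(ler_pM2l mB0) -[X in X * `|_|](gtr0_norm mB0) -normrM -Rint_on_sub_avg//.
rewrite ler_norml; apply/andP; split.
  rewrite mulrC -mulNr -Rint_onZ//; last exact: bmf_indic.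
  apply: Rint_on_le => // y Vy; rewrite indicE; have [yB|_] /= := boolP (y \in B); last by rewrite mulr0 mul0r.
  have := h y (set_mem yB); rewrite local_uE// ler_norml => /andP[]; lra.
rewrite mulrC -Rint_onZ//; last exact: bmf_indic.
apply: Rint_on_le => // y Vy; rewrite indicE; have [yB|_] /= := boolP (y \in B); last by rewrite mulr0 mul0r.
have := h y (set_mem yB); rewrite local_uE// ler_norml => /andP[]; lra.
Qed.

(** Since [t <= T + T (t/T)^q] for all [t >= 0], a bound for the mean of the
[q]-th power of the oscillation gives one for the mean of the oscillation itself,
without appealing to the inequality of Holder. *)
Lemma avg_diff B B' c q kap (al : R) T : 1 <= q -> measurable B -> measurable B' -> B' `<=` B ->
  0 < m B' -> 0 <= kap -> m B <= kap * m B' -> 0 < T -> 0 <= al ->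
  I (fun y => \1_B y * `|uV y - c| `^ q) <= al * T `^ q * m B ->
  `|avg B' - c| <= kap * (1 + al) * T.
Proof.
move=> q1 mB mB' BB mB0 kap0 hk T0 al0 h.
have mB0' : m B' != 0 by rewrite gt_eqF.
have q0 : 0 <= q by apply: le_trans q1.
have Tq : 0 < T `^ q by exact: powR_gt0.
have b1 : bounded_mfun (fun y => \1_B' y * (uV y - c)).
  by apply: indic_bmf => //; apply: bmfB => //; exact: bmf_cst.
have b2 : bounded_mfun (fun y => \1_B y * `|uV y - c| `^ q) by apply: indic_bmf => //; exact: osc_bmf.
have b3 : bounded_mfun (fun y => T * \1_B y) by apply: bmfZ; exact: bmf_indic.
have b4 : bounded_mfun (fun y => T * \1_B y + T / T `^ q * (\1_B y * `|uV y - c| `^ q)).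
  by apply: bmfD => //; exact: bmfZ.
(* The integrand is T + T (t/T)^q with t the oscillation. *)
have key : I (fun y => T * \1_B y + T / T `^ q * (\1_B y * `|uV y - c| `^ q)) <= (1 + al) * T * m B.
  rewrite Rint_onD//; last exact: bmfZ.
  rewrite !Rint_onZ//; last exact: bmf_indic.
  have : T / T `^ q * I (fun y => \1_B y * `|uV y - c| `^ q) <= T / T `^ q * (al * T `^ q * m B).
    by rewrite ler_wpM2l// divr_ge0// ltW.
  have -> : T / T `^ q * (al * T `^ q * m B) = al * T * m B by field; rewrite gt_eqF.
  by lra.
have pt y : \1_B' y * `|uV y - c| <= T * \1_B y + T / T `^ q * (\1_B y * `|uV y - c| `^ q).
  rewrite !indicE; have [yB'|_] /= := boolP (y \in B'); last first.
    by rewrite mul0r addr_ge0// mulr_ge0 ?divr_ge0 ?mulr_ge0 ?powR_ge0 ?ler0n// ltW.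
  rewrite mem_set ?mulr1 ?mul1r /=; last by apply: BB; exact: set_mem.
  set t := `|_|; have t0 : 0 <= t by exact: normr_ge0.
  have -> : t = T * (t / T) by field; rewrite gt_eqF.
  rewrite powRM ?divr_ge0 ?(ltW T0)//.
  have -> : T / T `^ q * (T `^ q * (t / T) `^ q) = T * (t / T) `^ q by field; rewrite gt_eqF.
  have [h1|h1] := leP (t / T) 1.
    have : T * (t / T) <= T * 1 by rewrite ler_pM2l.
    have : 0 <= T * (t / T) `^ q by rewrite mulr_ge0 ?powR_ge0// ltW.
    by lra.
  have : T * (t / T) <= T * (t / T) `^ q by rewrite ler_pM2l// le1r_powR// ltW.
  by lra.
rewrite -(ler_pM2l mB0) -[X in X * `|_|](gtr0_norm mB0) -normrM -Rint_on_sub_avg//.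
apply: (@le_trans _ _ ((1 + al) * T * m B)); last first.
  have : (1 + al) * T * m B <= (1 + al) * T * (kap * m B').
    by rewrite ler_wpM2l// mulr_ge0 ?addr_ge0// ltW.
  by lra.
apply: le_trans key; rewrite ler_norml; apply/andP; split.
  rewrite lerNl -mulN1r -Rint_onZ//; apply: Rint_on_le => //; first exact: bmfZ.
  move=> y _; apply: le_trans (pt y); rewrite mulrA mulN1r mulNr -mulrN.
  by rewrite ler_wpM2l// -normrN ler_norm.
apply: Rint_on_le => // y _; apply: le_trans (pt y).
by rewrite ler_wpM2l// ler_norm.
Qed.

Section chain.
Variables (p0 : R) (a : nat -> X) (rw s0 : R).
Hypotheses (p01 : 1 < p0) (hP : poincare mu p0 CP tau).
Hypotheses (aW : forall k, ball z rw (a k))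
  (ad : forall x e, ball z rw x -> 0 < e -> exists k, mdist (a k) x < e).
Hypotheses (s00 : 0 < s0) (rwV : rw + tau * s0 <= rho).
Local Notation s i := (s0 / 2 ^+ i).
Local Notation Q i k := (ball (a k) (tau * s i) : set X).
Local Notation C' := (CD ^+ 2 * (1 + CP) * 2).

(** The smallness at [x] of the averages of [g^p0] over the balls of a countable
family: a restricted maximal function at [x] is at most [lam]. *)
Definition good lam x : Prop := forall i k, Q i k x ->
  I (fun y => \1_(Q i k) y * lipR u y `^ p0) <= lam `^ p0 * m (Q i k).

Lemma scale_gt0 i : 0 < s i.
Proof. by rewrite divr_gt0// exprn_gt0. Qed.

Lemma scale_le i : s i <= s0.
Proof. by rewrite ler_pdivrMr ?exprn_gt0// ler_peMr ?(ltW s00)// exprn_ege1// ler1n. Qed.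

Lemma scaleS i : s i = 2 * s i.+1.
Proof. by rewrite exprS; field; rewrite expf_neq0. Qed.

Lemma chain_Q_sub i k : Q i k `<=` V.
Proof.
apply: subset_ball; apply: le_trans rwV; apply: lerD.
  by have /ball_mdist/ltW := aW k.
by rewrite ler_pM2l ?scale_le// (lt_le_trans ltr01).
Qed.

Lemma chain_ball_sub i k : ball (a k) (s i) `<=` V.
Proof.
apply: subset_trans (@chain_Q_sub i k); apply: subset_ball.
by rewrite mdistxx add0r ler_peMl// ltW// scale_gt0.
Qed.

(** One step of the chain compares the averages over two consecutive balls by the
Poincare inequality and doubling. Instead of summing an infinite telescoping
series, the induction starts at an arbitrarily small ball, where the Lipschitz
condition on [u] bounds the error; the scale of that ball is [n] steps down. *)
Lemma chain_approx lam x n i k : 0 < lam -> ball z rw x -> good lam x -> mdist (a k) x < s i / 4 ->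
  `|u x - avg (ball (a k) (s i))| <= 2 * C' * s i * lam + 2 * L * s i / 2 ^+ n.
Proof.
move=> lam0 xW gx.
have C0 : 0 <= C' by rewrite !mulr_ge0 ?exprn_ge0 ?addr_ge0 ?(ltW CP0)// (le_trans ler01).
have mb x' s' := metric_ball_measurable cbm x' s'.
elim: n i k => [|n ih] i k akx; have si := scale_gt0 i.
  rewrite expr0 divr1 distrC; apply: (@le_trans _ _ (2 * L * s i)); last first.
    by rewrite lerDr mulr_ge0 ?(ltW lam0)// mulr_ge0 ?(ltW si)// mulr_ge0.
  apply: avg_near => //; [exact: chain_ball_sub|by apply: mass_ball_gt0 => //; exact: chain_ball_sub|].
  move=> y /ball_mdist aky; apply: (le_trans (uL _ _)).
  have : L * mdist y x <= L * (2 * s i); last by lra.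
  by rewrite ler_wpM2l// (le_trans (metric_triangle y (a k) x))// (metric_sym y); lra.
have si1 := scale_gt0 i.+1; have sS := scaleS i.
have [k' ak'x] : exists k', mdist (a k') x < s i.+1 / 4 by apply: ad => //; rewrite divr_gt0.
have := ih i.+1 k' ak'x.
(* The next ball, centred closer to [x], lies in the present one and is
   of comparable measure. *)
have dk : mdist (a k) (a k') < s i / 4 + s i.+1 / 4.
  by apply: (le_lt_trans (metric_triangle _ x _)); rewrite (metric_sym x) ltrD.
have inner : mdist (a k) (a k') + s i.+1 <= s i by lra.
have outer : mdist (a k') (a k) + s i <= 2 ^+ 2 * s i.+1.
  by rewrite (metric_sym (a k')) expr2; lra.
have Qx : Q i k x.
  apply/ball_mdist; apply: (lt_trans akx); apply: (@lt_le_trans _ _ (s i)); first lra.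
  by rewrite ler_peMl// ltW.
have t0 : 0 < tau by apply: lt_le_trans tau1.
have mQ0 : 0 < m (Q i k) by apply: mass_ball_gt0; [rewrite mulr_gt0|exact: chain_Q_sub].
have mB0 : 0 < m (ball (a k) (s i) : set X) by apply: mass_ball_gt0 => //; exact: chain_ball_sub.
have Q_V := @chain_Q_sub i k.
have h1 := poincare_real (lt_trans ltr01 p01) hP si (erefl _) (erefl _) Q_V.
have h2 : I (fun y => \1_(ball (a k) (s i) : set X) y * `|uV y - avg (ball (a k) (s i))| `^ p0) <=
    CP * (2 * s i * lam) `^ p0 * m (ball (a k) (s i) : set X).
  rewrite -(ler_pM2r mQ0); apply: (le_trans h1).
  rewrite [X in _ <= _ * X * _ * _]powRM ?(ltW lam0)//; last by rewrite mulr_ge0// ltW.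
  have -> : CP * ((2 * s i) `^ p0 * lam `^ p0) * m (ball (a k) (s i) : set X) * m (Q i k) =
    CP * (2 * s i) `^ p0 * m (ball (a k) (s i) : set X) * (lam `^ p0 * m (Q i k)) by ring.
  by rewrite ler_wpM2l ?(gx _ _ Qx)// !mulr_ge0 ?powR_ge0 ?ltW.
have h3 := avg_diff (B := ball (a k) (s i)) (B' := ball (a k') (s i.+1)) (kap := CD ^+ 2)
  (ltW p01) (mb _ _) (mb _ _) _ _ _ _ _ (ltW CP0) h2.
have {h3} : `|avg (ball (a k') (s i.+1)) - avg (ball (a k) (s i))| <=
    CD ^+ 2 * (1 + CP) * (2 * s i * lam).
  apply: h3.
  - exact: subset_ball.
  - by apply: mass_ball_gt0 => //; exact: chain_ball_sub.
  - by rewrite exprn_ge0// (le_trans ler01).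
  - by apply: (mass_doubling (k := 2)) => //; exact: chain_ball_sub.
  - by rewrite !mulr_gt0.
have : `|u x - avg (ball (a k) (s i))| <= `|u x - avg (ball (a k') (s i.+1))| +
   `|avg (ball (a k') (s i.+1)) - avg (ball (a k) (s i))|.
  by apply: le_trans (ler_normD _ _); rewrite addrA subrK.
have -> : 2 * L * s i / 2 ^+ n.+1 = 2 * L * s i.+1 / 2 ^+ n.
  by rewrite sS [2 ^+ n.+1]exprS; field; rewrite !expf_neq0.
clear h1 h2 gx Qx Q_V dk inner outer.
rewrite sS; lra.
Qed.

Lemma chain_avg lam x i k : 0 < lam -> ball z rw x -> good lam x -> mdist (a k) x < s i / 4 ->
  `|u x - avg (ball (a k) (s i))| <= 2 * C' * s i * lam.
Proof.
move=> lam0 xW gx akx; apply/ler_addgt0Pr => e e0.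
have si := scale_gt0 i.
have M0 : 0 < 2 * L * s i + 1 by rewrite ltr_wpDl// !mulr_ge0// ltW.
have [n hn] := exists_pow2_ge M0 e0.
apply: (le_trans (chain_approx n lam0 xW gx akx)).
rewrite lerD2l ler_pdivrMr ?exprn_gt0// [leRHS]mulrC; apply: le_trans hn.
by rewrite lerDl.
Qed.

(** Both points are compared with the average over a single ball, at a scale
comparable to their distance. *)
Lemma good_lipschitz_near lam x y : 0 < lam -> ball z rw x -> ball z rw y ->
  good lam x -> good lam y -> 8 * mdist x y <= s0 ->
  `|u x - u y| <= 64 * C' * lam * mdist x y.
Proof.
move=> lam0 xW yW gx gy hxy.
have [xy|xy] := eqVneq x y; first by rewrite xy subrr normr0 mdistxx mulr0.
have d0 : 0 < mdist x y by rewrite mdist_gt0.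
have C0 : 0 <= C' by rewrite !mulr_ge0 ?exprn_ge0 ?addr_ge0 ?(ltW CP0)// (le_trans ler01).
have [i [i1 i2]] : exists i, 8 * mdist x y <= s i /\ s i.+1 < 8 * mdist x y.
  (* The scale is the last one that is at least eight times the distance. *)
  have ex : exists j, s j < 8 * mdist x y.
    have d16 : 0 < 4 * mdist x y by rewrite mulr_gt0.
    have [j hj] := exists_pow2_ge s00 d16; exists j.
    by rewrite ltr_pdivrMr ?exprn_gt0// mulrC; apply: (le_lt_trans hj); rewrite ltr_pM2l ?exprn_gt0//; lra.
  have := ex_minnP ex; case: ex_minnP => j hj jmin _.
  case: j hj jmin => [|j] hj jmin; first by move: hj; rewrite expr0 divr1 ltNge hxy.
  exists j; split => //; rewrite leNgt; apply/negP => /jmin; by rewrite ltnn.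
have si := scale_gt0 i; have sS := scaleS i.
have [k akx] : exists k, mdist (a k) x < s i / 8 by apply: ad => //; rewrite divr_gt0.
have h1 : `|u x - avg (ball (a k) (s i))| <= 2 * C' * s i * lam.
  by apply: chain_avg => //; lra.
have h2 : `|u y - avg (ball (a k) (s i))| <= 2 * C' * s i * lam.
  by apply: chain_avg => //; have := metric_triangle (a k) x y; lra.
have h3 : `|u x - u y| <= `|u x - avg (ball (a k) (s i))| + `|u y - avg (ball (a k) (s i))|.
  by rewrite (distrC (u y)); apply: le_trans (ler_normD _ _); rewrite addrA subrK.
have h4 : 4 * C' * lam * s i <= 4 * C' * lam * (16 * mdist x y).
  apply: ler_wpM2l; last by rewrite sS; lra.
  by rewrite mulr_ge0 ?(ltW lam0)// mulr_ge0.
by lra.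
Qed.

End chain.

End poincare_facts.

(** * A weak-type estimate for the gradient *)
Section weak_type.
Context {d : measure_display} {R : realType} {X : metricMeasurableType d R}.
Local Notation Xb := (g_sigma_algebraType (@open X)).
Variable mu : {measure set X -> \bar R}.
Hypothesis cbm : complete_borel_measure mu.
Hypothesis pos : positive_finite_on_balls mu.
Variables (CD tau : R).
Hypotheses (CD1 : 1 <= CD) (dbl : doubling mu CD) (tau1 : 1 <= tau).
Variables (z : X) (rho : R).
Hypothesis rho0 : 0 < rho.
Variables (u : X -> R) (L : R).
Hypotheses (L0 : 0 <= L) (uL : forall x y, `|u x - u y| <= L * mdist x y).
Implicit Types (x y : X) (lam : R).
Variables (p0 : R) (a : nat -> X) (rw s0 : R).
Hypotheses (p01 : 1 < p0) (aW : forall k, ball z rw (a k)).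
Hypotheses (s00 : 0 < s0) (rwV : rw + tau * s0 <= rho).
Let V : set X := ball z rho.
Let mV : measurable V := mV_x cbm z rho.
Let muV : (mu V < +oo)%E := mu_ball_lty pos z rho0.
Local Notation I := (Rint_on mu V).
Local Notation m A := (Rint_on mu V (\1_A)).
Local Notation s i := (s0 / 2 ^+ i).
Local Notation Q i k := (ball (a k) (tau * s i) : set X).

Definition bad lam (i k : nat) : Prop :=
  lam `^ p0 * m (Q i k) < I (fun y => \1_(Q i k) y * lipR u y `^ p0).

Definition bad_set lam : set X := [set x | exists i k, bad lam i k /\ Q i k x].

Lemma good_bad_set lam x : ~ bad_set lam x -> good mu tau z rho u p0 a s0 lam x.
Proof.
move=> nb i k Qx; rewrite leNgt; apply/negP => b; apply: nb.
by exists i, k.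
Qed.

Let mQ i k : measurable (Q i k). Proof. exact: (metric_ball_measurable cbm). Qed.
Let QV i k : Q i k `<=` V. Proof. exact: chain_Q_sub. Qed.
Let bg : bounded_mfun (fun y => lipR u y `^ p0).
Proof. by apply: (lip_powR_bmf cbm L0 uL); rewrite ltW// (lt_trans ltr01). Qed.
Let bG lam : measurable [set y | lam / 2 < lipR u y].
Proof.
have [mg _] := lipR_bmf cbm L0 uL.
have := mg measurableT `]lam / 2, +oo[%classic (measurable_itv _).
by rewrite setTI preimage_itvoy.
Qed.

(** The part of [g] below [lam / 2] contributes at most half of the average, as
[p0 >= 1]. *)
Lemma bad_estimate lam i k : 0 < lam -> bad lam i k ->
  lam `^ p0 * m (Q i k) <=
  2 * I (fun y => \1_(Q i k) y * (\1_[set y | lam / 2 < lipR u y] y * lipR u y `^ p0)).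
Proof.
move=> lam0 b; set G := [set y | lam / 2 < lipR u y].
have p00 : 0 < p0 by apply: lt_trans p01.
have b1 : bounded_mfun (fun y => \1_(Q i k) y * (\1_G y * lipR u y `^ p0)).
  by apply: indic_bmf => //; apply: indic_bmf => //; exact: bG.
have b2 : bounded_mfun (fun y => (lam / 2) `^ p0 * \1_(Q i k) y) by apply: bmfZ; exact: bmf_indic.
have h : I (fun y => \1_(Q i k) y * lipR u y `^ p0) <=
    I (fun y => \1_(Q i k) y * (\1_G y * lipR u y `^ p0) + (lam / 2) `^ p0 * \1_(Q i k) y).
  apply: Rint_on_le => //; [exact: indic_bmf|exact: bmfD|].
  move=> y _; rewrite !indicE; case: (y \in Q i k) => /=; last by rewrite !mul0r mulr0 addr0.
  rewrite !mul1r mulr1; have [yG|yG] /= := boolP (y \in G).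
    by rewrite mul1r lerDl powR_ge0.
  rewrite mul0r add0r ge0_ler_powR ?nnegrE ?(lipR_ge0 L0 uL)//.
  - exact: ltW.
  - by rewrite divr_ge0// ltW.
  - by rewrite leNgt; apply/negP => yG'; move/negP: yG; apply; exact: mem_set.
rewrite (Rint_onD mV muV b1 b2) (Rint_onZ mV muV _ (bmf_indic (mQ i k))) in h.
have h2 : (lam / 2) `^ p0 <= lam `^ p0 / 2.
  rewrite powRM ?(ltW lam0) ?invr_ge0// ler_wpM2l ?powR_ge0//.
  by rewrite ge1r_powR ?(ltW p01)// invr_gt0 ltr0n/= invf_le1// ler1n.
have h3 : (lam / 2) `^ p0 * m (Q i k) <= lam `^ p0 / 2 * m (Q i k).
  by rewrite ler_wpM2r// Rint_on_ge0.
by move: b; rewrite /bad; lra.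
Qed.

Lemma triple_measure i k : m (ball (a k) (3 * (tau * s i)) `&` V) <= CD ^+ 2 * m (Q i k).
Proof.
have t0 : 0 < tau * s i by rewrite mulr_gt0 ?(lt_le_trans ltr01 tau1)// scale_gt0.
have mb x' s' := metric_ball_measurable cbm x' s'.
rewrite -lee_fin EFinM -!Rint_on_indic//; last exact: measurableI.
apply: le_trans (doubling_iter CD1 dbl (a k) 2 t0).
rewrite le_measure ?inE//; first exact: measurableI.
apply: (subset_trans (@subIsetl _ _ _)); apply: subset_ball.
by rewrite mdistxx add0r expr2; lra.
Qed.

(** By [finite_vitali] the measure of the union is bounded by the sum of the
measures of the triples of disjoint bad balls, and [bad_estimate] bounds each of
these by an integral over the ball itself. *)
Lemma weak_type_finite lam (l : seq (nat * nat)) : 0 < lam ->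
  (forall j, j \in l -> bad lam j.1 j.2) ->
  lam `^ p0 * m [set x | exists2 j, j \in l & Q j.1 j.2 x] <=
  2 * CD ^+ 2 * I (fun y => \1_[set y | lam / 2 < lipR u y] y * lipR u y `^ p0).
Proof.
move=> lam0 lbad; set G := [set y | lam / 2 < lipR u y].
have lp : 0 <= lam `^ p0 by exact: powR_ge0.
have [l' [l'l disj cov]] := finite_vitali (fun j : nat * nat => a j.2) (fun j => tau * s j.1) l.
have mU : measurable [set x | exists2 j, j \in l & Q j.1 j.2 x].
  rewrite (_ : [set x | _] = \bigcup_(j in [set` l]) Q j.1 j.2).
    by rewrite bigcup_seq; apply: bigsetU_measurable.
  by apply/seteqP; split => x [j jl jx]; exists j.
have mT j : measurable (ball (a j.2) (3 * (tau * s j.1)) `&` V).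
  by apply: measurableI => //; exact: (metric_ball_measurable cbm).
have b1 : bounded_mfun (fun y => \1_G y * lipR u y `^ p0) by apply: indic_bmf => //; exact: bG.
have h1 : m [set x | exists2 j, j \in l & Q j.1 j.2 x] <=
    \sum_(j <- l') m (ball (a j.2) (3 * (tau * s j.1)) `&` V).
  rewrite -Rint_on_sum//; last by move=> j; exact: bmf_indic.
  apply: Rint_on_le => //; first exact: bmf_indic.
    by apply: bmf_sum => j; exact: bmf_indic.
  move=> x Vx; rewrite indicE; have [/set_mem xU|_] := boolP (x \in _); last first.
    by rewrite sumr_ge0.
  have [j jl' jx] := cov x xU.
  rewrite (big_rem j)//= indicE mem_set//.
  by rewrite lerDl sumr_ge0.
have h2 : \sum_(j <- l') m (ball (a j.2) (3 * (tau * s j.1)) `&` V) <=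
    \sum_(j <- l') CD ^+ 2 * m (Q j.1 j.2).
  by apply: ler_sum => j _; exact: triple_measure.
have h3 : lam `^ p0 * \sum_(j <- l') CD ^+ 2 * m (Q j.1 j.2) <=
    \sum_(j <- l') CD ^+ 2 * (2 * I (fun y => \1_(Q j.1 j.2) y * (\1_G y * lipR u y `^ p0))).
  rewrite mulr_sumr big_seq [leRHS]big_seq; apply: ler_sum => j jl'.
  rewrite mulrCA; apply: ler_wpM2l; first by rewrite exprn_ge0// (le_trans ler01).
  by apply: bad_estimate => //; exact/lbad/l'l.
have h4 : \sum_(j <- l') I (fun y => \1_(Q j.1 j.2) y * (\1_G y * lipR u y `^ p0)) <=
    I (fun y => \1_G y * lipR u y `^ p0).
  rewrite -Rint_on_sum//; last by move=> j; exact: indic_bmf.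
  apply: Rint_on_le => //; first by apply: bmf_sum => j; exact: indic_bmf.
  move=> y _; rewrite -mulr_suml ler_piMl// mulr_ge0 ?powR_ge0//.
rewrite -!mulr_sumr in h3; rewrite -!mulr_sumr in h2.
have h5 : lam `^ p0 * m [set x | exists2 j, j \in l & Q j.1 j.2 x] <=
    lam `^ p0 * (CD ^+ 2 * \sum_(j <- l') m (Q j.1 j.2)).
  by rewrite ler_wpM2l// (le_trans h1).
apply: (le_trans h5); apply: (le_trans h3).
rewrite mulrA [CD ^+ 2 * 2]mulrC ler_wpM2l// mulr_ge0// exprn_ge0// (le_trans ler01)//.
Qed.

Lemma bad_set_open lam : open (bad_set lam).
Proof.
rewrite (_ : bad_set lam = \bigcup_(j in [set j : nat * nat | bad lam j.1 j.2]) Q j.1 j.2).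
  by apply: bigcup_open => j _; exact: open_ball.
apply/seteqP; split => [x [i [k [b Qx]]]|x [[i k] /= b Qx]]; first by exists (i, k).
by exists i, k.
Qed.

Lemma bad_set_sub lam : bad_set lam `<=` V.
Proof. by move=> x [i [k [_ Qx]]]; exact: QV Qx. Qed.

Lemma weak_type lam : 0 < lam -> lam `^ p0 * m (bad_set lam) <=
  2 * CD ^+ 2 * I (fun y => \1_[set y | lam / 2 < lipR u y] y * lipR u y `^ p0).
Proof.
move=> lam0; set c := leRHS.
have lp : 0 < lam `^ p0 by exact: powR_gt0.
(* Exhaustion of the bad indices by finite lists. *)
pose l (N : nat) := [seq j <- [seq (i, k) | i <- iota 0 N, k <- iota 0 N] | `[< bad lam j.1 j.2 >]].
pose F N : set X := [set x | exists2 j, j \in l N & Q j.1 j.2 x].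
have lE N j : (j \in l N) = [&& (j.1 < N)%N, (j.2 < N)%N & `[< bad lam j.1 j.2 >]].
  rewrite mem_filter andbC; case: j => i k /=; rewrite andbA; congr (_ && _).
  apply/allpairsP/andP => [[[i' k'] /= [h1 h2 [-> ->]]]|[h1 h2]].
    by move: h1 h2; rewrite !mem_iota /= !add0n.
  by exists (i, k); rewrite !mem_iota.
have mF N : measurable (F N).
  rewrite (_ : F N = \bigcup_(j in [set` l N]) Q j.1 j.2).
    by rewrite bigcup_seq; apply: bigsetU_measurable.
  by apply/seteqP; split => x [j jl jx]; exists j.
have mO : measurable (bad_set lam) by apply: (open_set_measurable cbm); exact: bad_set_open.
have OF : bad_set lam = \bigcup_N F N.
  apply/seteqP; split => [x [i [k [b Qx]]]|x [N _ [j]]].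
    exists (maxn i k).+1 => //; exists (i, k) => //=.
    by rewrite lE /= !ltnS leq_maxl leq_maxr; apply/asboolP.
  by rewrite lE => /and3P[_ _ /asboolP b] Qx; exists j.1, j.2.
have FV N : F N `<=` V by move=> x [j _ Qx]; exact: QV Qx.
have hF N : (mu (F N) <= (c / lam `^ p0)%:E)%E.
  rewrite (Rint_on_indic mV muV (mF N) (FV N)) lee_fin ler_pdivlMr// mulrC.
  by apply: weak_type_finite => // j; rewrite lE => /and3P[_ _ /asboolP].
have : (mu (bad_set lam) <= (c / lam `^ p0)%:E)%E.
  have ndF : nondecreasing_seq F.
    move=> N M NM; apply/subsetPset => x [j]; rewrite lE => /and3P[h1 h2 h3] Qx.
    by exists j => //; rewrite lE h3 (leq_trans h1)// (leq_trans h2).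
  rewrite OF; apply: (cvge_le _ (nondecreasing_cvg_mu mF _ ndF)).
    by apply: nearW.
  by rewrite -OF.
rewrite (Rint_on_indic mV muV mO (@bad_set_sub lam)) lee_fin ler_pdivlMr// mulrC.
exact.
Qed.

End weak_type.

(** * Sums over dyadic levels *)
(** The terms form a geometric progression whose largest selected term is at
most [y]. *)
Lemma geometric_level_sum (R : realType) (al : nat -> R) (c : nat -> bool) (th y : R) N :
  0 < th < 1 -> 0 <= y -> (forall n, 0 <= al n) -> (forall n, al n.+1 = th * al n) ->
  (forall n, c n -> al n <= y) -> (forall n, c n -> c n.+1) ->
  \sum_(n < N) (c n)%:R * al n <= y / (1 - th).
Proof.
move=> /andP[th0 th1] y0 al0 alS cy cS.
have t1 : 0 < 1 - th by rewrite subr_gt0.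
case: N => [|N]; first by rewrite big_ord0 divr_ge0// ltW.
apply: (@le_trans _ _ (if c N then (y - th * al N) / (1 - th) else 0)); last first.
  case: ifP => _; last by rewrite divr_ge0// ltW.
  by rewrite ler_pM2r ?invr_gt0// gerBl mulr_ge0// ltW.
elim: N => [|N ih].
  rewrite big_ord_recr big_ord0 /= add0r; case: ifP => [cn|]; last by rewrite mul0r.
  by rewrite mul1r ler_pdivlMr//; have := cy _ cn; lra.
rewrite big_ord_recr/=; have [cN1|ncN1] := boolP (c N.+1); last first.
  rewrite mul0r addr0; apply: (le_trans ih).
  by case: ifP => // /cS; rewrite (negbTE ncN1).
rewrite mul1r; have h1 := cy _ cN1; have h2 := alS N.
move: ih; case: ifP => [cN|_] ih.
  apply: (@le_trans _ _ ((y - th * al N) / (1 - th) + al N.+1)); first by rewrite lerD2r.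
  rewrite -h2 le_eqVlt; apply/orP; left; apply/eqP.
  by field; rewrite gt_eqF.
apply: (@le_trans _ _ (al N.+1)); first by rewrite -[leRHS]add0r lerD2r.
by rewrite ler_pdivlMr//; lra.
Qed.

Section dyadic_levels.
Context {R : realType}.
Variables (L p eps : R).
Hypotheses (L0 : 0 < L) (e0 : 0 < eps) (e1 : eps <= 1) (q1 : 1 <= p - eps).
Local Notation q := (p - eps).

Definition level (n : nat) : R := L / 2 ^+ n.
(** Increments of [lam^-eps] along the levels, so that sums of weights telescope
([sum_weight]). *)
Definition weight (n : nat) : R :=
  if n is n'.+1 then level n `^ (- eps) - level n' `^ (- eps) else level 0 `^ (- eps).

Lemma level_gt0 n : 0 < level n.
Proof. by rewrite divr_gt0// exprn_gt0. Qed.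

Lemma levelS n : level n = 2 * level n.+1.
Proof. by rewrite /level exprS; field; rewrite expf_neq0. Qed.

Lemma level_powS (b : R) n : level n.+1 `^ b = 2^-1 `^ b * level n `^ b.
Proof.
by rewrite -powRM ?invr_ge0 ?(ltW (level_gt0 n))// (levelS n) mulrA mulVf ?mul1r.
Qed.

Lemma level_anti n k : (n <= k)%N -> level k <= level n.
Proof.
move=> nk; rewrite /level ler_pM2l// lef_pV2 ?posrE ?exprn_gt0//.
by rewrite ler_eXn2l// ltr1n.
Qed.

Lemma sum_weight N : \sum_(n < N.+1) weight n = level N `^ (- eps).
Proof.
elim: N => [|N ih]; first by rewrite big_ord_recr big_ord0 /= add0r.
by rewrite big_ord_recr/= ih addrC subrK.
Qed.

Lemma two_eps : 1 - eps <= 2^-1 `^ eps.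
Proof.
have ln2 : ln (2 : R) <= 1.
  rewrite -ler_expR lnK ?posrE//.
  by apply: le_trans (expR_ge1Dx 1); rewrite -[1 + 1]/(2%:R).
rewrite /powR gt_eqF ?invr_gt0// lnV ?posrE//.
apply: le_trans (expR_ge1Dx _).
by rewrite lerD2l mulrN lerN2 ler_piMr// ltW.
Qed.

Lemma half_eps_ge : 2^-1 <= 2^-1 `^ eps :> R.
Proof. by rewrite ger1_powR// invr_gt0 ltr0n/= invf_le1// ler1n. Qed.

Lemma weight_ge0 n : 0 <= weight n.
Proof.
case: n => [|n] /=; first exact: powR_ge0.
rewrite subr_ge0 !powRN lef_pV2 ?posrE ?powR_gt0 ?level_gt0//.
rewrite ge0_ler_powR ?nnegrE ?(ltW e0) ?(ltW (level_gt0 _))//.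
exact: level_anti.
Qed.

Lemma level_pow_split n (b c : R) : level n `^ b * level n `^ c = level n `^ (b + c).
Proof. by rewrite -powRD// (gt_eqF (level_gt0 n)) implybT. Qed.

(** The increment of [lam^-eps] over one dyadic step is [1 - 2^-eps] times its
final value, and [1 - 2^-eps <= eps]. *)
Lemma weight_level n : weight n.+1 * level n.+1 `^ p <= eps * level n.+1 `^ q.
Proof.
rewrite /= mulrBl.
have h : level n `^ (- eps) = 2^-1 `^ eps * level n.+1 `^ (- eps).
  rewrite level_powS mulrA -powRD ?subrr ?powRr0 ?mul1r//.
  by rewrite invr_eq0 pnatr_eq0 implybT.
rewrite h -mulrA level_pow_split [- eps + p]addrC -[X in X - _]mul1r -mulrBl ler_wpM2r ?powR_ge0//.
by have := two_eps; lra.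
Qed.

Section pointwise.
Variables (f g : R) (N : nat) (F O : nat -> bool) (W : bool).
Hypotheses (f0 : 0 <= f) (g0 : 0 <= g) (fL : f <= L) (gL : g <= L).
Hypothesis O0 : O 0%N = false.
Hypothesis Omono : forall n, O n -> O n.+1.
Hypothesis FE : forall n, F n = [&& W, f <= level n, g <= level n & ~~ O n].

Let p0 : 0 < p. Proof. by move: e0 q1; lra. Qed.
Let q0 : 0 < q. Proof. by move: q1; lra. Qed.

Let F_anti n : F n.+1 -> F n.
Proof.
rewrite !FE => /and4P[-> h1 h2 h3] /=; rewrite (le_trans h1) ?level_anti//.
by rewrite (le_trans h2) ?level_anti//=; apply: contra h3; exact: Omono.
Qed.

Let Fle n k : (n <= k)%N -> F k -> F n.
Proof.
elim: k => [|k ih]; first by rewrite leqn0 => /eqP ->.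
by rewrite leq_eqVlt => /predU1P[->//|nk /F_anti]; exact: ih.
Qed.

(** The weights of the levels that contain the point sum up to [lam^-eps] for
the last such level, which bounds [g] from above. *)
Lemma sum_weight_grad : \sum_(n < N.+1) weight n * (F n)%:R * g `^ p <= W%:R * g `^ q.
Proof.
have [g0'|g0'] := eqVneq g 0.
  rewrite big1 ?mulr_ge0 ?powR_ge0// => n _.
  by rewrite g0' powR0 ?mulr0// gt_eqF.
have gpos : 0 < g by rewrite lt_neqAle eq_sym g0'.
elim: N => [|M ih]; last first.
  have [FM|FM] := boolP (F M.+1); last by rewrite big_ord_recr/= (negbTE FM) mulr0 mul0r addr0.
  have -> : \sum_(n < M.+2) weight n * (F n)%:R * g `^ p = (\sum_(n < M.+2) weight n) * g `^ p.
    rewrite mulr_suml; apply: eq_bigr => n _; rewrite (@Fle n M.+1) ?mulr1//.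
    by rewrite -ltnS.
  rewrite sum_weight; move: FM; rewrite FE => /and4P[-> _ gM _]; rewrite mul1r.
  have -> : g `^ q = g `^ (- eps) * g `^ p.
    by rewrite -powRD ?(addrC (- eps))// (gt_eqF gpos) implybT.
  rewrite ler_wpM2r ?powR_ge0// !powRN lef_pV2 ?posrE ?powR_gt0 ?level_gt0//.
  by rewrite ge0_ler_powR ?nnegrE ?(ltW e0) ?(ltW (level_gt0 _)).
rewrite big_ord_recr big_ord0/= add0r FE O0 /= andbT.
case: W => /=; last by rewrite mulr0 !mul0r.
case: (boolP (_ && _)) => [/andP[_ gM]|]; last by rewrite mulr0 mul0r mul1r powR_ge0.
rewrite mulr1 mul1r.
have -> : g `^ q = g `^ (- eps) * g `^ p.
  by rewrite -powRD ?(addrC (- eps))// (gt_eqF gpos) implybT.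
rewrite ler_wpM2r ?powR_ge0// !powRN lef_pV2 ?posrE ?powR_gt0 ?level_gt0//.
by rewrite ge0_ler_powR ?nnegrE ?(ltW e0) ?(ltW (level_gt0 _)).
Qed.

Lemma level_sum_pow (h : R) : 0 <= h ->
  \sum_(n < N.+1) (level n < h)%R%:R * level n `^ q <= 2 * h `^ q.
Proof.
move=> h0; have hq : 2^-1 `^ q <= 2^-1 :> R.
  by rewrite ge1r_powR// invr_gt0 ltr0n/= invf_le1// ler1n.
apply: (@le_trans _ _ (h `^ q / (1 - 2^-1 `^ q))).
  apply: (@geometric_level_sum _ (fun n => level n `^ q) (fun n => level n < h)).
  - by rewrite powR_gt0 ?invr_gt0//=; lra.
  - exact: powR_ge0.
  - by move=> n; exact: powR_ge0.
  - by move=> n; rewrite level_powS.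
  - move=> n /ltW hn; rewrite ge0_ler_powR ?nnegrE//; [exact: ltW|].
    exact: ltW (level_gt0 n).
  - by move=> n; apply: le_lt_trans; exact: level_anti.
rewrite mulrC ler_wpM2r ?powR_ge0// -[leRHS]invrK lef_pV2 ?posrE ?invr_gt0//; lra.
Qed.

(** A point is outside [F n] because [f], [g] or the bad set is responsible. The
first level contributes nothing, and at the later ones [weight_level] produces
the factor [eps]. *)
Lemma sum_weight_bad :
  \sum_(n < N.+1) weight n * level n `^ p * (W && ~~ F n)%:R <=
  eps * (W%:R * (2 * f `^ q + 2 * g `^ q) + \sum_(n < N.+1) (O n)%:R * level n `^ q).
Proof.
case: W FE => FE'; last first.
  rewrite big1 ?mul0r ?add0r; last by move=> n _; rewrite mulr0.
  by rewrite mulr_ge0 ?(ltW e0)// sumr_ge0// => n _; rewrite mulr_ge0 ?powR_ge0.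
apply: (@le_trans _ _ (\sum_(n < N.+1) eps * ((level n < f)%R%:R * level n `^ q +
   (level n < g)%R%:R * level n `^ q + (O n)%:R * level n `^ q))).
  apply: ler_sum => -[[|n] nN] _ /=.
    have l0 : level 0 = L by rewrite /level expr0 divr1.
    rewrite FE' l0 fL gL O0 /= mulr0 mulr_ge0 ?(ltW e0)//.
    by rewrite !addr_ge0// mulr_ge0 ?powR_ge0.
  rewrite FE' /= !ltNge -!mulrDl.
  have := weight_level n; set A := weight _ * _; move=> hA.
  have B0 : 0 <= level n.+1 `^ q by exact: powR_ge0.
  have eB0 : 0 <= eps * level n.+1 `^ q by rewrite mulr_ge0// ltW.
  rewrite [leRHS]mulrCA.
  rewrite /A /= in hA *.
  by case: (f <= level n.+1); case: (g <= level n.+1); case: (O n.+1) => /=; lra.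
rewrite -mulr_sumr ler_wpM2l ?(ltW e0)// mul1r !big_split/= lerD2r.
by rewrite lerD// level_sum_pow.
Qed.

(** Consider the last level containing the point. Either it is level [N], which
bounds [f], or the point leaves at the next level for one of three reasons:
because of [f], and then [f] is comparable to that level; because of [g], and
then [f] is at most twice [g]; or because of the bad set of that level. *)
Lemma level_dichotomy : W ->
  f `^ q <= 2 * (\sum_(n < N.+1) weight n * (F n)%:R * f `^ p) + 2 `^ q * g `^ q +
    2 `^ q * (\sum_(n < N.+1) (O n)%:R * level n `^ q) + level N `^ q.
Proof.
move=> WT.
have S10 : 0 <= \sum_(n < N.+1) weight n * (F n)%:R * f `^ p.
  by apply: sumr_ge0 => n _; rewrite !mulr_ge0 ?powR_ge0 ?weight_ge0.
have S20 : 0 <= \sum_(n < N.+1) (O n)%:R * level n `^ q.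
  by apply: sumr_ge0 => n _; rewrite mulr_ge0 ?powR_ge0.
have t20 : 0 <= 2 `^ q * (\sum_(n < N.+1) (O n)%:R * level n `^ q) by rewrite mulr_ge0 ?powR_ge0.
have t30 : 0 <= 2 `^ q * g `^ q by rewrite mulr_ge0 ?powR_ge0.
have t40 : 0 <= level N `^ q by exact: powR_ge0.
have [FN|FN] := boolP (F N).
  have : f `^ q <= level N `^ q.
    rewrite ge0_ler_powR ?nnegrE ?(ltW q0) ?(ltW (level_gt0 _))//.
    by move: FN; rewrite FE => /and4P[].
  by lra.
have F0 : F 0%N.
  by rewrite FE WT O0 /level expr0 divr1 fL gL.
have [n [nN Fn nF]] : exists n, [/\ (n < N)%N, F n & ~~ F n.+1].
  have ex : exists n, ~~ F n by exists N.
  have := ex_minnP ex; case: ex_minnP => -[|n] nF nmin _; first by rewrite F0 in nF.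
  exists n; split => //; first exact: nmin.
  by apply/negPn/negP => /nmin; rewrite ltnn.
have hw : level n `^ (- eps) * f `^ p <= \sum_(k < N.+1) weight k * (F k)%:R * f `^ p.
  rewrite -sum_weight mulr_suml.
  have nN1 : (n.+1 <= N.+1)%N by rewrite ltnS ltnW.
  rewrite (big_ord_widen _ (fun k => weight k * f `^ p) nN1) big_mkcond /=.
  apply: ler_sum => k _; case: ifP => [kn|_].
    by rewrite (@Fle k n) ?mulr1.
  by rewrite !mulr_ge0 ?powR_ge0 ?weight_ge0.
have fn : f <= level n by move: Fn; rewrite FE => /and4P[].
have ln := levelS n.
have lvq : level n `^ q = 2 `^ q * level n.+1 `^ q.
  by rewrite ln powRM ?(ltW (level_gt0 _)).
move: nF; rewrite FE WT /= !negb_and negbK -!ltNge => /or3P[h|h|h].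
- have fpos : 0 < f by apply: lt_trans h; exact: level_gt0.
  have E : f `^ q = f `^ (- eps) * f `^ p.
    by rewrite -powRD ?(addrC (- eps))// (gt_eqF fpos) implybT.
  have h1 : f `^ (- eps) <= 2 * level n `^ (- eps).
    rewrite ln !powRN powRM ?(ltW (level_gt0 _))// invfM.
    apply: (@le_trans _ _ (level n.+1 `^ eps)^-1).
      rewrite lef_pV2 ?posrE ?powR_gt0 ?level_gt0//.
      by rewrite ge0_ler_powR ?nnegrE ?(ltW e0) ?(ltW (level_gt0 _))// ltW.
    rewrite mulrA ler_peMl ?invr_ge0 ?powR_ge0// -powRV//.
    by have := half_eps_ge; lra.
  have : f `^ (- eps) * f `^ p <= 2 * level n `^ (- eps) * f `^ p by rewrite ler_wpM2r ?powR_ge0.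
  rewrite E; lra.
- have : f `^ q <= 2 `^ q * g `^ q.
    rewrite -powRM// ge0_ler_powR ?nnegrE ?(ltW q0) ?mulr_ge0//.
    by rewrite (le_trans fn)// ln ler_pM2l// ltW.
  by lra.
- have : f `^ q <= level n `^ q.
    by rewrite ge0_ler_powR ?nnegrE ?(ltW q0) ?(ltW (level_gt0 _)).
  have : 2 `^ q * level n.+1 `^ q <= 2 `^ q * (\sum_(k < N.+1) (O k)%:R * level k `^ q).
    rewrite ler_wpM2l ?powR_ge0//.
    have nN' : (n.+1 < N.+1)%N by rewrite ltnS.
    rewrite (bigD1 (Ordinal nN'))//= h mul1r lerDl.
    by apply: sumr_ge0 => k _; rewrite mulr_ge0 ?powR_ge0.
  by rewrite lvq; lra.
Qed.

End pointwise.
End dyadic_levels.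

(** * Summation of the Hardy inequalities over all levels *)
Lemma weighted_step (R : realType) (w a c i k l b : R) : 0 <= w ->
  a <= c * (i + k * l * b) -> w * a <= c * (w * i + k * (w * l * b)).
Proof. by move=> w0 h; have := ler_wpM2l w0 h; lra. Qed.

Lemma level_combine (R : realType) (a l s o t e z y c : R) :
  a <= 2 * l + c * s + c * o + e -> l <= z -> z <= y -> c * o <= c * t ->
  a <= 2 * y + c * s + c * t + e.
Proof. lra. Qed.

Section summation.
Context {d : measure_display} {T : measurableType d} {R : realType}.
Variables (mu : {measure set T -> \bar R}) (V : set T).
Hypotheses (mV : measurable V) (muV : (mu V < +oo)%E).
Local Notation I := (Rint_on mu V).
Local Notation m A := (Rint_on mu V (\1_A)).
Variables (L p eps : R).
Hypotheses (L0 : 0 < L) (e0 : 0 < eps) (e1 : eps <= 1) (q1 : 1 <= p - eps).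
Local Notation q := (p - eps).
Local Notation level := (level L).
Variables (f g : T -> R).
Hypotheses (bf : bounded_mfun f) (bg : bounded_mfun g) (f0 : forall x, 0 <= f x) (g0 : forall x, 0 <= g x)
  (fL : forall x, f x <= L) (gL : forall x, g x <= L).
Variables (D W : set T) (O F : nat -> set T).
Hypotheses (mD : measurable D) (mW : measurable W) (DW : D `<=` W)
  (mO : forall n, measurable (O n)) (mF : forall n, measurable (F n)).
Hypothesis O0 : O 0%N = set0.
Hypothesis Omono : forall n, O n `<=` O n.+1.
Hypothesis FE : forall n x, F n x <-> [/\ W x, f x <= level n, g x <= level n & ~ O n x].
Variables (CH kap Tt : R).
Hypotheses (CH0 : 0 <= CH) (kap0 : 0 <= kap).
Hypothesis hardyn : forall n, I (fun x => \1_(D `&` F n) x * f x `^ p) <=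
  CH * I (fun x => \1_(F n) x * g x `^ p + (kap * level n) `^ p * \1_(W `\` F n) x).
Hypothesis sumO : forall N, \sum_(n < N.+1) level n `^ q * m (O n) <= Tt.

Let p0 : 0 <= p. Proof. by move: e0 q1; lra. Qed.
Let q0 : 0 <= q. Proof. by move: q1; lra. Qed.
Let bfp : bounded_mfun (fun x => f x `^ p). Proof. exact: bmf_powR. Qed.
Let bgp : bounded_mfun (fun x => g x `^ p). Proof. exact: bmf_powR. Qed.
Let bfq : bounded_mfun (fun x => f x `^ q). Proof. exact: bmf_powR. Qed.
Let bgq : bounded_mfun (fun x => g x `^ q). Proof. exact: bmf_powR. Qed.
Let bI A (h : T -> R) : measurable A -> bounded_mfun h -> bounded_mfun (fun x => \1_A x * h x).
Proof. by move=> mA bh; apply: bmfM => //; exact: bmf_indic. Qed.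
Local Notation wt := (weight L eps).

Let FEb x n : (x \in F n) = [&& x \in W, f x <= level n, g x <= level n & ~~ (x \in O n)].
Proof.
apply/idP/and4P => [/set_mem/FE[h1 h2 h3 h4]|[/set_mem h1 h2 h3 h4]].
  by split => //; [exact: mem_set|apply/negP => /set_mem].
by apply/mem_set/FE; split => //; move=> /mem_set; apply/negP.
Qed.

Let O0b x : (x \in O 0%N) = false. Proof. by rewrite O0 in_set0. Qed.
Let Omonob x n : x \in O n -> x \in O n.+1.
Proof. by move=> /set_mem h; apply/mem_set; exact: Omono. Qed.

(** The hypotheses [hardyn] for the levels up to [N], multiplied by the weights
and added, are combined with the pointwise bounds [sum_weight_grad],
[sum_weight_bad] and [level_dichotomy]. *)
Lemma hardy_summation_level N :
  I (fun x => \1_D x * f x `^ q) <=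
  2 * (CH * (I (fun x => \1_W x * g x `^ q) +
     kap `^ p * (eps * (2 * I (fun x => \1_W x * f x `^ q) +
       2 * I (fun x => \1_W x * g x `^ q) + Tt)))) +
  2 `^ q * I (fun x => \1_W x * g x `^ q) + 2 `^ q * Tt + level N `^ q * m V.
Proof.
set S := I (fun x => \1_W x * g x `^ q); set A' := I (fun x => \1_W x * f x `^ q).
have mDF n : measurable (D `&` F n) by exact: measurableI.
have mWF n : measurable (W `\` F n) by exact: measurableD.
pose lhs x := \sum_(n < N.+1) wt n * (\1_(D `&` F n) x * f x `^ p).
pose gr x := \sum_(n < N.+1) wt n * (\1_(F n) x * g x `^ p).
pose bd x := \sum_(n < N.+1) wt n * level n `^ p * \1_(W `\` F n) x.
pose os x := \sum_(n < N.+1) level n `^ q * \1_(O n) x.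
have blhs : bounded_mfun lhs by apply: bmf_sum => n; apply: bmfZ; exact: bI.
have bgr : bounded_mfun gr by apply: bmf_sum => n; apply: bmfZ; exact: bI.
have bbd : bounded_mfun bd by apply: bmf_sum => n; apply: bmfZ; exact: bmf_indic.
have bos : bounded_mfun os by apply: bmf_sum => n; apply: bmfZ; exact: bmf_indic.
have osT : I os <= Tt.
  rewrite /os Rint_on_sum//; last by move=> n; apply: bmfZ; exact: bmf_indic.
  rewrite (eq_bigr (fun n : 'I_N.+1 => level n `^ q * m (O n))) => [|n _]; first exact: sumO.
  by rewrite Rint_onZ//; exact: bmf_indic.
have h1 : I lhs <= CH * (I gr + kap `^ p * I bd).
  rewrite /lhs Rint_on_sum//; last by move=> n; apply: bmfZ; exact: bI.
  rewrite /gr /bd Rint_on_sum//; last by move=> n; apply: bmfZ; exact: bI.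
  rewrite Rint_on_sum//; last by move=> n; apply: bmfZ; exact: bmf_indic.
  rewrite mulr_sumr -big_split/= mulr_sumr; apply: ler_sum => n _.
  rewrite !Rint_onZ//; [|exact: bmf_indic|exact: bI|exact: bI].
  have := hardyn n; rewrite Rint_onD//; [|exact: bI|by apply: bmfZ; exact: bmf_indic].
  rewrite Rint_onZ//; last exact: bmf_indic.
  rewrite powRM ?(ltW (level_gt0 L0 n))// => h.
  exact: weighted_step (weight_ge0 L0 e0 n) h.
have h2 : I gr <= S.
  apply: Rint_on_le => //; first exact: bI.
  move=> x _; have := @sum_weight_grad _ L p eps L0 e0 q1 (f x) (g x) N
    (fun n => x \in F n) (fun n => x \in O n) (x \in W).
  rewrite indicE => h; apply: le_trans (h (g0 x) (O0b x) (fun n => @Omonob x n) (FEb x)).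
  by apply: ler_sum => n _; rewrite indicE mulrA.
have h3 : I bd <= eps * (2 * A' + 2 * S + Tt).
  have bR : bounded_mfun (fun x => eps * ((2 * (\1_W x * f x `^ q) + 2 * (\1_W x * g x `^ q)) + os x)).
    apply: bmfZ; apply: bmfD => //; apply: bmfD; apply: bmfZ; exact: bI.
  apply: (@le_trans _ _ (I (fun x => eps * ((2 * (\1_W x * f x `^ q) + 2 * (\1_W x * g x `^ q)) + os x)))).
    apply: (Rint_on_le mV muV bbd bR) => x _.
    have := @sum_weight_bad _ L p eps L0 e0 q1 (f x) (g x) N
      (fun n => x \in F n) (fun n => x \in O n) (x \in W).
    move=> /(_ (f0 x) (g0 x) (fL x) (gL x) (O0b x) (FEb x)) h.
    apply: le_trans (le_trans h _).
      by apply: ler_sum => n _; rewrite indicE in_setD.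
    rewrite ler_wpM2l ?(ltW e0)// lerD//; first by rewrite indicE mulrDr !(mulrCA _ 2).
    by apply: ler_sum => n _; rewrite indicE mulrC.
  rewrite Rint_onZ//; last by apply: bmfD => //; apply: bmfD; apply: bmfZ; exact: bI.
  rewrite Rint_onD//; last by apply: bmfD; apply: bmfZ; exact: bI.
  rewrite Rint_onD//; [|by apply: bmfZ; exact: bI|by apply: bmfZ; exact: bI].
  rewrite !Rint_onZ//; [|exact: bI|exact: bI].
  by rewrite ler_wpM2l ?(ltW e0)// lerD2l.
have h4 : I (fun x => \1_D x * f x `^ q) <=
    2 * I lhs + 2 `^ q * S + 2 `^ q * I os + level N `^ q * m V.
  have bR : bounded_mfun (fun x => 2 * lhs x + 2 `^ q * (\1_W x * g x `^ q) + 2 `^ q * os x + level N `^ q * \1_V x).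
    by do 3!(apply: bmfD; last by (apply: bmfZ; do ?[exact: bI|exact: bmf_indic|exact: bos])); exact: bmfZ.
  have -> : 2 * I lhs + 2 `^ q * S + 2 `^ q * I os + level N `^ q * m V =
    I (fun x => 2 * lhs x + 2 `^ q * (\1_W x * g x `^ q) + 2 `^ q * os x + level N `^ q * \1_V x).
    have b2 : bounded_mfun (fun x => 2 * lhs x) by exact: bmfZ.
    have b3 : bounded_mfun (fun x => 2 `^ q * (\1_W x * g x `^ q)) by apply: bmfZ; exact: bI.
    have b4 : bounded_mfun (fun x => 2 `^ q * os x) by exact: bmfZ.
    have b5 : bounded_mfun (fun x => level N `^ q * \1_V x) by apply: bmfZ; exact: bmf_indic.
    have b6 := bmfD b2 b3; have b7 := bmfD b6 b4.
    by rewrite (Rint_onD mV muV b7 b5) (Rint_onD mV muV b6 b4) (Rint_onD mV muV b2 b3) !Rint_onZ//; [exact: bmf_indic|exact: bI].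
  apply: Rint_on_le => //; first exact: bI.
  move=> x Vx; rewrite !indicE (mem_set Vx) mulr1.
  have os0 : 0 <= os x by apply: sumr_ge0 => n _; rewrite mulr_ge0 ?powR_ge0.
  have lhs0 : 0 <= lhs x by apply: sumr_ge0 => n _; rewrite !mulr_ge0 ?powR_ge0 ?weight_ge0.
  have [xD|xD] := boolP (x \in D); last first.
    have t1 : 0 <= 2 * lhs x by exact: mulr_ge0.
    have t2 : 0 <= 2 `^ q * ((x \in W)%:R * g x `^ q) by rewrite !mulr_ge0 ?powR_ge0.
    have t3 : 0 <= 2 `^ q * os x by rewrite mulr_ge0 ?powR_ge0.
    have t4 : 0 <= level N `^ q by exact: powR_ge0.
    by rewrite mul0r; do 3!(apply: addr_ge0 => //).
  have xW : x \in W by apply/mem_set/DW; exact: set_mem.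
  have := @level_dichotomy _ L p eps L0 e0 e1 q1 (f x) (g x) N
    (fun n => x \in F n) (fun n => x \in O n) (x \in W).
  move=> /(_ (f0 x) (g0 x) (fL x) (gL x) (O0b x) (fun n => @Omonob x n) (FEb x) xW) h.
  rewrite mul1r xW mul1r; apply: (le_trans h).
  have -> : \sum_(n < N.+1) wt n * (x \in F n)%:R * f x `^ p = lhs x.
    by apply: eq_bigr => n _; rewrite indicE in_setI xD /= mulrA.
  have -> : \sum_(n < N.+1) (x \in O n)%:R * level n `^ q = os x.
    by apply: eq_bigr => n _; rewrite indicE mulrC.
  by [].
have h5 : CH * (I gr + kap `^ p * I bd) <= CH * (S + kap `^ p * (eps * (2 * A' + 2 * S + Tt))).
  by rewrite ler_wpM2l// lerD// ler_wpM2l// powR_ge0.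
have h6 : 2 `^ q * I os <= 2 `^ q * Tt by rewrite ler_wpM2l// powR_ge0.
exact: (level_combine h4 h1 h5 h6).
Qed.

(** The level [N] tends to zero in [hardy_summation_level]. *)
Lemma hardy_summation :
  I (fun x => \1_D x * f x `^ q) <=
  2 * (CH * (I (fun x => \1_W x * g x `^ q) +
     kap `^ p * (eps * (2 * I (fun x => \1_W x * f x `^ q) +
       2 * I (fun x => \1_W x * g x `^ q) + Tt)))) +
  2 `^ q * I (fun x => \1_W x * g x `^ q) + 2 `^ q * Tt.
Proof.
apply/ler_addgt0Pr => e ee0.
have mV0 : 0 <= m V by apply: Rint_on_ge0.
have M0 : 0 < L * (m V + 1 + e) by rewrite mulr_gt0// addr_gt0// ltr_wpDl.
have e10 : 0 < Num.min 1 e by rewrite lt_min ltr01.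
have [N hN] := exists_pow2_ge M0 e10.
apply: (le_trans (hardy_summation_level N)); rewrite lerD2l.
have l0 := level_gt0 L0 N.
have hl : level N * (m V + 1 + e) <= Num.min 1 e.
  by rewrite /level mulrAC ler_pdivrMr ?exprn_gt0// mulrC [leRHS]mulrC (mulrC _ L).
have m1 : Num.min 1 e <= 1 by rewrite ge_min lexx.
have me : Num.min 1 e <= e by rewrite ge_min lexx orbT.
have l1 : level N <= 1.
  have : level N * 1 <= level N * (m V + 1 + e) by rewrite ler_pM2l//; lra.
  lra.
have : level N `^ q <= level N by rewrite ge1r_powR// l0 l1.
move=> hq; apply: (@le_trans _ _ (level N * m V)); first by rewrite ler_wpM2r.
have : level N * m V <= level N * (m V + 1 + e) by rewrite ler_pM2l//; lra.
lra.
Qed.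

End summation.

(** * Estimates for the quotient of u by the distance *)
Lemma powR_add_le (R : realType) (a b q : R) : 0 <= a -> 0 <= b -> 0 <= q ->
  (a + b) `^ q <= 2 `^ q * (a `^ q + b `^ q).
Proof.
move=> a0 b0 q0; wlog ab : a b a0 b0 / a <= b.
  move=> h; have [ab|/ltW ba] := leP a b; first exact: h.
  by rewrite addrC [_ `^ q + _]addrC; exact: h.
apply: (@le_trans _ _ ((2 * b) `^ q)).
  by rewrite ge0_ler_powR ?nnegrE ?addr_ge0 ?mulr_ge0//; lra.
by rewrite powRM// ler_wpM2l ?powR_ge0// lerDr powR_ge0.
Qed.

Lemma separation_bound (R : realType) (r a wx wy xy : R) : 0 < r -> r <= a ->
  8 * a <= wx -> wy <= r -> wx <= wy + xy -> r <= xy.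
Proof. lra. Qed.

Lemma outer_combine (R : realType) (F J P A S a b e f k cp : R) :
  f * F <= f * A + J -> J <= a * (P + k * (a * (P + b * f * A))) ->
  (a + a * a * k) * P <= (a + a * a * k) * (cp * e * f * S) ->
  f * F <= f * ((1 + a * a * k * b) * A + (a + a * a * k) * cp * e * S).
Proof. lra. Qed.

Section hardy_improvement.
Context {d : measure_display} {R : realType} {X : metricMeasurableType d R}.
Local Notation Xb := (g_sigma_algebraType (@open X)).
Variable mu : {measure set X -> \bar R}.
Hypothesis cbm : complete_borel_measure mu.
Hypothesis pos : positive_finite_on_balls mu.
Variables (CD CP tau CH p p0 : R).
Hypotheses (CD1 : 1 <= CD) (dbl : doubling mu CD) (CP0 : 0 < CP) (tau1 : 1 <= tau).
Hypotheses (p01 : 1 < p0) (p0p : p0 < p).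
Hypothesis hP : forall q, p0 <= q <= p -> poincare mu q CP tau.
Variables (E : set X) (w : X) (r : R).
Hypotheses (cE : closed E) (hardy : local_hardy mu p tau E CH).
Hypotheses (Ew : E w) (r0 : 0 < r) (rd : (r%:E < (8^-1)%:E * diam [set: X])%E).
Local Notation EB := (trunc E w r).
Local Notation dE := (dist_to EB).
Let rho := 12 * tau ^+ 3 * r.
Let V : set X := ball w rho.
Let W : set X := ball w (8 * tau ^+ 2 * r).
Let D8 : set X := ball w (8 * tau * r).
Let B12 : set X := ball w (12 * tau ^+ 2 * r).
Let t0 : 0 < tau. Proof. exact: lt_le_trans tau1. Qed.
Let rho0 : 0 < rho. Proof. by rewrite /rho !mulr_gt0// exprn_gt0. Qed.
Let mV : measurable V := mV_x cbm w rho.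
Let muV : (mu V < +oo)%E := mu_ball_lty pos w rho0.
Local Notation I := (Rint_on mu V).
Local Notation m A := (Rint_on mu V (\1_A)).
Variables (u : X -> R) (L : R).
Hypotheses (L0 : 0 < L) (uL : forall x y, `|u x - u y| <= L * mdist x y).
Hypothesis uE : forall x, E x -> u x = 0.
Let L0' : 0 <= L. Proof. exact: ltW. Qed.
Let EB0 : EB !=set0. Proof. by exists w; exact: trunc_center. Qed.
Let cEB : closed EB. Proof. exact: trunc_closed. Qed.
Let uEB x : EB x -> u x = 0. Proof. by move=> /(trunc_sub cE); exact: uE. Qed.

Definition dist_quotient x : R := `|u x| / dE x.

Lemma dist_quotient_ge0 x : 0 <= dist_quotient x. Proof. by rewrite divr_ge0// dist_to_ge0. Qed.
Lemma dist_quotient_le x : dist_quotient x <= L.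
Proof. by have [_] := quotient_bounds EB0 cEB L0' uL uEB; exact. Qed.
Lemma dist_quotient_bmf : bounded_mfun dist_quotient. Proof. exact: (quotient_bmf cbm EB0 cEB L0' uL uEB). Qed.
Lemma dist_quotient_mul x : dist_quotient x * dE x = `|u x|.
Proof.
have [EBx|EBx] := pselect (EB x).
  by rewrite dist_to_in// mulr0 uEB// normr0.
by rewrite /dist_quotient divfK// gt_eqF// dist_to_gt0.
Qed.

Let blip : bounded_mfun (lipR u) := lipR_bmf cbm L0' uL.
Let lip0 x : 0 <= lipR u x := lipR_ge0 L0' uL x.
Let lipL x : lipR u x <= L := lipR_le L0' uL x.
Let mb x s : measurable (ball x s : set X) := metric_ball_measurable cbm x s.
Let mB12 : measurable B12. Proof. exact: mb. Qed.
Let mD8 : measurable D8. Proof. exact: mb. Qed.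
Let mW : measurable W. Proof. exact: mb. Qed.
Let bI A (h : X -> R) : measurable A -> bounded_mfun h -> bounded_mfun (fun x => \1_A x * h x).
Proof. by move=> mA bh; apply: bmfM => //; exact: bmf_indic. Qed.

Let tau_exp : 1 <= tau ^+ 2 /\ tau ^+ 2 <= tau ^+ 3 /\ tau <= tau ^+ 2 /\ tau <= tau ^+ 3.
Proof.
have h2 : 1 <= tau ^+ 2 by exact: exprn_ege1.
have h3 : tau ^+ 2 <= tau ^+ 3 by rewrite ler_weXn2l.
have h4 : tau <= tau ^+ 2 by rewrite -[leLHS]expr1 ler_weXn2l.
by do !split => //; exact: le_trans h3.
Qed.

Lemma radius_le s t : s <= t -> ball w (s * r) `<=` ball w (t * r).
Proof. by move=> st; apply: subset_ball; rewrite mdistxx add0r ler_pM2r. Qed.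

Lemma WV : W `<=` V. Proof. by apply: radius_le; have [? [? ?]] := tau_exp; lra. Qed.
Lemma D8_W : D8 `<=` W. Proof. by apply: radius_le; have [? [? [? ?]]] := tau_exp; lra. Qed.
Lemma W_B12 : W `<=` B12. Proof. by apply: radius_le; have [? [? [? ?]]] := tau_exp; lra. Qed.
Lemma B12_V : B12 `<=` V. Proof. by apply: radius_le; have [? [? [? ?]]] := tau_exp; lra. Qed.
Lemma D8_V : D8 `<=` V. Proof. exact: subset_trans D8_W WV. Qed.

Section outer.
Variables (q Kd : R).
Hypotheses (p0q : p0 <= q) (qp : q <= p) (Kd0 : 0 <= Kd) (hKd : m B12 <= Kd * m D8).
Let q0 : 0 < q. Proof. by apply: lt_le_trans p0q; apply: lt_trans p01. Qed.

(** Outside [D8] the distance to the truncated set is at least [r], so there the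
quotient is bounded by [|u| / r]. The mean of [|u|^q] over [B12] is controlled by
the oscillation of [u] around its average and by that average, which in turn is
controlled by the oscillation and by the mean over [D8], where [|u|] is at most
[8 tau r] times the quotient. *)
Lemma outer_estimate :
  I (fun x => \1_B12 x * dist_quotient x `^ q) <=
  (1 + 4 `^ q * Kd * (8 * tau) `^ q) * I (fun x => \1_D8 x * dist_quotient x `^ q) +
  (2 `^ q + 4 `^ q * Kd) * CP * (24 * tau ^+ 2) `^ q * I (fun x => lipR u x `^ q).
Proof.
set A := I (fun x => \1_D8 x * _); set S := I (fun x => lipR u x `^ q).
pose uV := local_u w rho u.
have buV : bounded_mfun uV := local_u_bmf cbm w rho0 L0' uL.
pose c := avg mu w rho u B12.
pose P := I (fun x => \1_B12 x * `|uV x - c| `^ q).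
pose J := I (fun x => \1_B12 x * `|uV x| `^ q).
have bn : bounded_mfun (fun x => `|uV x| `^ q) by apply: bmf_powR; [exact: ltW|by []|exact: bmf_norm].
have bo : bounded_mfun (fun x => `|uV x - c| `^ q).
  by apply: bmf_powR; [exact: ltW|by []|apply: bmf_norm; apply: bmfB => //; exact: bmf_cst].
have brq : bounded_mfun (fun x => dist_quotient x `^ q) by apply: bmf_powR; [exact: ltW|exact: dist_quotient_ge0|exact: dist_quotient_bmf].
have bgq : bounded_mfun (fun x => lipR u x `^ q) by apply: bmf_powR => //; exact: ltW.
have s0 : 0 < 12 * tau ^+ 2 * r by rewrite !mulr_gt0// exprn_gt0.
have VE : V = ball w (tau * (12 * tau ^+ 2 * r)).
  by rewrite /V /rho; congr ball; rewrite (exprS tau 2); ring.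
have mV0 : 0 < m V by exact: (mass_ball_gt0 cbm pos rho0 rho0 (@subset_refl _ V)).
have mD80 : 0 < m D8 by apply: (mass_ball_gt0 cbm pos rho0); [rewrite !mulr_gt0|exact: D8_V].
have S0 : 0 <= S by apply: Rint_on_ge0 => x _; exact: powR_ge0.
have rq0 : 0 < r `^ q by exact: powR_gt0.
have hPq : P <= CP * (24 * tau ^+ 2) `^ q * r `^ q * S.
  have := poincare_real cbm pos CP0 tau1 rho0 L0' uL q0 (hP _) s0 (erefl _) VE (@subset_refl _ V).
  rewrite p0q qp => /(_ isT); rewrite -/B12 -/uV -/c -/P.
  have -> : I (fun y => \1_V y * lipR u y `^ q) = S.
    apply/eqP; rewrite eq_le; apply/andP; split; apply: Rint_on_le => //; try exact: bI;
    by move=> x Vx; rewrite indicE mem_set// mul1r.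
  have -> : 2 * (12 * tau ^+ 2 * r) = 24 * tau ^+ 2 * r by ring.
  rewrite powRM ?(ltW r0) ?mulr_ge0 ?exprn_ge0 ?(ltW t0)// => h.
  rewrite -(ler_pM2r mV0); apply: (le_trans h).
  have -> : CP * ((24 * tau ^+ 2) `^ q * r `^ q) * m B12 * S =
    CP * (24 * tau ^+ 2) `^ q * r `^ q * S * m B12 by ring.
  rewrite ler_wpM2l ?mulr_ge0 ?powR_ge0 ?(ltW CP0)//.
  exact: (mass_le cbm pos w rho0 (mb _ _) mV B12_V).
have nc0 : 0 <= `|c| `^ q by exact: powR_ge0.
have h1 : J <= 2 `^ q * (P + `|c| `^ q * m B12).
  rewrite /P -Rint_onZ//; last exact: bmf_indic.
  rewrite -Rint_onD//; [|exact: bI|by apply: bmfZ; exact: bmf_indic].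
  rewrite -Rint_onZ//; last by apply: bmfD; [exact: bI|by apply: bmfZ; exact: bmf_indic].
  apply: Rint_on_le => //; [exact: bI|by apply: bmfZ; apply: bmfD; [exact: bI|by apply: bmfZ; exact: bmf_indic]|].
  move=> x _; rewrite indicE; case: (x \in B12) => /=; last by rewrite !mul0r mulr0 addr0 mulr0.
  rewrite !mul1r mulr1 (le_trans _ (powR_add_le _ _ (ltW q0)))// ge0_ler_powR ?nnegrE ?addr_ge0 ?(ltW q0)//.
  by rewrite -{1}(subrK c (uV x)) ler_normD.
have JD : I (fun x => \1_D8 x * `|uV x| `^ q) <= (8 * tau) `^ q * r `^ q * A.
  rewrite -powRM ?(ltW r0) ?mulr_ge0 ?(ltW t0)// -Rint_onZ//; last exact: bI.
  apply: Rint_on_le => //; [exact: bI|by apply: bmfZ; exact: bI|].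
  move=> x Vx; rewrite indicE; have [xD|_] /= := boolP (x \in D8); last by rewrite !mul0r mulr0.
  rewrite !mul1r -powRM ?dist_quotient_ge0//; last by rewrite !mulr_ge0 ?(ltW t0)// ltW.
  have t8 : 0 <= 8 * tau * r by rewrite !mulr_ge0 ?(ltW t0)// ltW.
  have rx := dist_quotient_ge0 x.
  rewrite ge0_ler_powR ?nnegrE ?(ltW q0)//; first exact: (mulr_ge0 t8 rx).
  rewrite /uV local_uE// -dist_quotient_mul mulrC ler_wpM2r ?dist_quotient_ge0//.
  have /ball_mdist/ltW := set_mem xD; apply: le_trans.
  by rewrite metric_sym dist_to_le//; exact: trunc_center.
have h2 : `|c| `^ q * m D8 <= 2 `^ q * (P + (8 * tau) `^ q * r `^ q * A).
  apply: (@le_trans _ _ (2 `^ q * (P + I (fun x => \1_D8 x * `|uV x| `^ q)))); last first.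
    by rewrite ler_wpM2l ?powR_ge0// lerD2l.
  rewrite /P -Rint_onD//; [|exact: bI|exact: bI].
  rewrite -Rint_onZ//; last exact: bmf_indic.
  rewrite -Rint_onZ//; last by apply: bmfD; exact: bI.
  apply: Rint_on_le => //; [by apply: bmfZ; exact: bmf_indic|by apply: bmfZ; apply: bmfD; exact: bI|].
  move=> x _; rewrite !indicE; have [xD|_] /= := boolP (x \in D8); last first.
    by rewrite mulr0 mulr_ge0 ?addr_ge0 ?mulr_ge0 ?powR_ge0.
  rewrite (mem_set (W_B12 (D8_W (set_mem xD)))) !mul1r mulr1.
  rewrite (le_trans _ (powR_add_le _ _ (ltW q0)))// ge0_ler_powR ?nnegrE ?addr_ge0 ?(ltW q0)//.
  have := ler_normB (uV x) (uV x - c).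
  have -> : uV x - (uV x - c) = c by ring.
  by rewrite addrC.
have h3 : r `^ q * I (fun x => \1_B12 x * dist_quotient x `^ q) <= r `^ q * A + J.
  have bA : bounded_mfun (fun x => r `^ q * (\1_D8 x * dist_quotient x `^ q)) by apply: bmfZ; exact: bI.
  rewrite /A /J -(Rint_onZ mV muV _ (bI mD8 brq)) -(Rint_onZ mV muV _ (bI mB12 brq)).
  rewrite -(Rint_onD mV muV bA (bI mB12 bn)).
  apply: Rint_on_le => //; [by apply: bmfZ; exact: bI|by apply: bmfD; [apply: bmfZ|]; exact: bI|].
  move=> x Vx; rewrite !indicE; have [xD|xD] /= := boolP (x \in D8).
    by rewrite (mem_set (W_B12 (D8_W (set_mem xD)))) !mul1r lerDl powR_ge0.
  case: (x \in B12) => /=; last by rewrite !mul0r mulr0 addr0.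
  rewrite mul0r mulr0 add0r !mul1r -powRM ?dist_quotient_ge0 ?(ltW r0)//.
  have rx := dist_quotient_ge0 x.
  rewrite ge0_ler_powR ?nnegrE ?(ltW q0)//; first exact: (mulr_ge0 (ltW r0) rx).
  rewrite /uV local_uE// -dist_quotient_mul mulrC ler_wpM2l ?dist_quotient_ge0//.
  apply: le_dist_to => // y /trunc_radius wy.
  have wx : 8 * (tau * r) <= mdist w x.
    rewrite mulrA leNgt; apply/negP => h; move/negP: xD; apply.
    exact/mem_set/ball_mdist.
  have tr : r <= tau * r by rewrite ler_peMl// ltW.
  have := metric_triangle w y x; rewrite (metric_sym y x).
  exact: (separation_bound r0 tr wx (wy r0)).
have h4 : `|c| `^ q * m B12 <= Kd * (`|c| `^ q * m D8).
  by rewrite mulrCA ler_wpM2l.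
have E4 : 4 `^ q = 2 `^ q * 2 `^ q :> R by rewrite -powRM//; congr (_ `^ _); ring.
have h5 : Kd * (`|c| `^ q * m D8) <= Kd * (2 `^ q * (P + (8 * tau) `^ q * r `^ q * A)).
  by rewrite ler_wpM2l.
have h6 : J <= 2 `^ q * (P + Kd * (2 `^ q * (P + (8 * tau) `^ q * r `^ q * A))).
  by apply: (le_trans h1); rewrite ler_wpM2l ?powR_ge0// lerD2l (le_trans h4).
have K1 : 0 <= 2 `^ q + 4 `^ q * Kd by rewrite addr_ge0 ?mulr_ge0 ?powR_ge0.
have h7 := ler_wpM2l K1 hPq.
rewrite -(ler_pM2l rq0); rewrite E4 in h7 *.
exact: outer_combine h3 h6 h7.
Qed.

End outer.

Section improvement.
Variable eps : R.
Hypotheses (e0 : 0 < eps) (e1 : eps <= 1) (p0q : p0 < p - eps).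
Local Notation q := (p - eps).
Local Notation C' := (CD ^+ 2 * (1 + CP) * 2).
(** The first summand serves for distant points and the second one, coming from
[good_lipschitz_near], for nearby ones. *)
Definition lip_const : R := 128 * tau ^+ 2 + 64 * C'.
(** The factor [2 CD^2] of [weak_type] times the bound of the geometric series of
ratio [2^(p0 - q)]. *)
Definition weak_const : R :=
  2 * CD ^+ 2 * (2 `^ (q - p0) / (1 - 2^-1 `^ (q - p0))).

Let p1 : 1 < p. Proof. exact: lt_trans p01 p0p. Qed.
Let q1 : 1 <= q. Proof. by apply/ltW; exact: lt_trans p01 p0q. Qed.
Let q0 : 0 < q. Proof. exact: lt_le_trans q1. Qed.
Let b0 : 0 < q - p0. Proof. by rewrite subr_gt0. Qed.
Let C'0 : 0 <= C'.
Proof. by rewrite !mulr_ge0 ?exprn_ge0 ?addr_ge0 ?(ltW CP0)// (le_trans ler01). Qed.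
Let kap0 : 0 < lip_const.
Proof. by rewrite ltr_pwDl ?mulr_gt0 ?exprn_gt0// mulr_ge0. Qed.
Let hPp0 : poincare mu p0 CP tau. Proof. by apply: hP; rewrite lexx ltW. Qed.

Let rw0 : 0 < 8 * tau ^+ 2 * r. Proof. by rewrite !mulr_gt0// exprn_gt0. Qed.

(** Application of [hardy_summation] to the level sets described at the top: the
Hardy inequality for each of them is [hardy_level], whose Lipschitz hypothesis
follows from [good_lipschitz_near] for nearby points and from [|u| <= lam d] for
distant ones. The sum over the bad sets is bounded by [weak_type] and
[geometric_level_sum]. *)
Lemma hardy_estimate :
  I (fun x => \1_D8 x * dist_quotient x `^ q) <=
  2 * (Num.max CH 0 * (I (fun x => \1_W x * lipR u x `^ q) +
     lip_const `^ p * (eps * (2 * I (fun x => \1_W x * dist_quotient x `^ q) +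
       2 * I (fun x => \1_W x * lipR u x `^ q) +
       weak_const * I (fun x => lipR u x `^ q))))) +
  2 `^ q * I (fun x => \1_W x * lipR u x `^ q) +
  2 `^ q * (weak_const * I (fun x => lipR u x `^ q)).
Proof.
have [a [aW ad]] := dense_sequence cbm pos CD1 dbl w rw0.
have rwV : 8 * tau ^+ 2 * r + tau * r <= rho.
  rewrite -mulrDl ler_pM2r//; have [? [? [? ?]]] := tau_exp; lra.
pose O n := bad_set mu tau w rho u p0 a r (level L n).
have oO n : open (O n) by exact: bad_set_open.
pose F n := W `&` [set x | dist_quotient x <= level L n] `&` [set x | lipR u x <= level L n] `\` O n.
have brq : bounded_mfun (fun x => dist_quotient x `^ q) by apply: bmf_powR; [exact: ltW|exact: dist_quotient_ge0|exact: dist_quotient_bmf].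
have bgq : bounded_mfun (fun x => lipR u x `^ q) by apply: bmf_powR => //; exact: ltW.
have bgp : bounded_mfun (fun x => lipR u x `^ p0) by apply: bmf_powR => //; exact/ltW/(lt_trans _ p01).
have S0 : 0 <= I (fun x => lipR u x `^ q) by apply: Rint_on_ge0 => x _; exact: powR_ge0.
have ll0 := level_gt0 L0.
have sublevel (h : X -> R) (c : R) : measurable_fun [set: Xb] (h : Xb -> R) ->
    measurable ([set x | h x <= c] : set Xb).
  move=> mh; have := mh measurableT `]-oo, c]%classic (measurable_itv _).
  by rewrite setTI preimage_itvNyc.
have mF n : measurable (F n : set Xb).
  apply: measurableD; last exact: open_borel.
  apply: measurableI; last by apply: sublevel; exact: lipR_borel L0' uL.
  apply: measurableI; last by apply: (sublevel dist_quotient); exact: (@quotient_measurable _ _ _ EB EB0 u L uL).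
  by apply: open_borel; exact: open_ball.
have FE n x : F n x <-> [/\ W x, dist_quotient x <= level L n, lipR u x <= level L n & ~ O n x].
  by split=> [[[[]]]|[]] //.
apply: (@hardy_summation _ _ _ mu V mV muV L p eps L0 e0 e1 q1 dist_quotient (lipR u)
  dist_quotient_bmf blip dist_quotient_ge0 lip0 dist_quotient_le lipL D8 W O F mD8 mW D8_W) => //.
- by move=> n; apply: (open_set_measurable cbm).
- by move=> n; apply: (borel_measurable cbm).
- apply/seteqP; split => // x [i [k [b Qx]]].
  move: b; rewrite /bad ltNge => /negP; apply.
  have mQ : measurable (ball (a k) (tau * (r / 2 ^+ i)) : set X) by exact: mb.
  rewrite -Rint_onZ//; last exact: bmf_indic.
  apply: Rint_on_le => //; [exact: bI|by apply: bmfZ; exact: bmf_indic|].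
  move=> y _; rewrite mulrC ler_wpM2r// /level expr0 divr1.
  by rewrite ge0_ler_powR ?nnegrE ?(ltW (lt_trans ltr01 p01)).
- move=> n x [i [k [b Qx]]]; exists i, k; split => //.
  apply: le_lt_trans b; rewrite ler_wpM2r//; first by apply: Rint_on_ge0.
  rewrite ge0_ler_powR ?nnegrE ?(ltW (lt_trans ltr01 p01)) ?(ltW (ll0 _))//.
  exact: level_anti.
- by rewrite le_max lexx orbT.
- exact: ltW.
- move=> n; have [? [? [? ?]]] := tau_exp.
  have kl0 : 0 < lip_const * level L n by rewrite mulr_gt0.
  have := @hardy_level _ _ _ mu cbm p tau CH E p1 tau1 cE hardy w r Ew r0 rd V mV muV WV u L
    L0' uL uE (F n) _ (mF n) _ kl0.
  have FW : F n `<=` W by move=> x [[[]]].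
  move=> /(_ FW) h.
  have bnd x : F n x -> `|u x| <= level L n * dE x.
    by move=> /FE[_ h1 _ _]; rewrite -dist_quotient_mul ler_wpM2r ?dist_to_ge0.
  have C1 : level L n <= lip_const * level L n.
    rewrite ler_peMl ?(ltW (ll0 n))// /lip_const.
    have : 0 <= 64 * C' by rewrite mulr_ge0.
    lra.
  apply: le_trans (h _ _) _.
  + by move=> x Fx; rewrite (le_trans (bnd x Fx))// ler_wpM2r ?dist_to_ge0.
  + move=> x y Fx Fy; have /FE[Wx _ _ nOx] := Fx; have /FE[Wy _ _ nOy] := Fy.
    have [near|far] := leP (8 * mdist x y) r.
      have := good_lipschitz_near cbm pos CD1 dbl CP0 tau1 rho0 L0' uL p01 hPp0 aW ad r0 rwV (ll0 n)
        Wx Wy (good_bad_set nOx) (good_bad_set nOy) near.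
      move=> /le_trans; apply; rewrite ler_wpM2r ?mdist_ge0// ler_wpM2r ?(ltW (ll0 n))//.
      by rewrite /lip_const lerDr mulr_ge0 ?exprn_ge0// ltW.
    have dW z : W z -> dE z <= 8 * tau ^+ 2 * r.
      by move=> /ball_mdist/ltW h'; apply: le_trans h'; rewrite metric_sym dist_to_le//; exact: trunc_center.
    have uW z : F n z -> W z -> `|u z| <= level L n * (8 * tau ^+ 2 * r).
      by move=> Fz Wz; rewrite (le_trans (bnd z Fz))// ler_wpM2l ?dW// ltW.
    apply: (le_trans (ler_normB _ _)); apply: (le_trans (lerD (uW x Fx Wx) (uW y Fy Wy))).
    have h1 : level L n * tau ^+ 2 * r <= level L n * tau ^+ 2 * (8 * mdist x y).
      by rewrite ler_wpM2l ?mulr_ge0 ?exprn_ge0 ?(ltW t0) ?(ltW (ll0 n))// ltW.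
    have h2 : 0 <= 64 * C' * level L n * mdist x y.
      by rewrite mulr_ge0 ?mdist_ge0// mulr_ge0 ?(ltW (ll0 n))// mulr_ge0.
    by rewrite /lip_const; move: (C') h1 h2; move: (level L n) (mdist x y) => l dd c'; lra.
  + by [].
- move=> N.
  pose G n := [set y | level L n / 2 < lipR u y].
  have mG n : measurable (G n).
    have [mg _] := blip.
    have := mg measurableT `]level L n / 2, +oo[%classic (measurable_itv _).
    by rewrite setTI preimage_itvoy.
  have bGb n : bounded_mfun (fun y => level L n `^ (q - p0) * (\1_(G n) y * lipR u y `^ p0)).
    by apply: bmfZ; exact: bI.
  have st n : level L n `^ q * m (O n) <= 2 * CD ^+ 2 *
      I (fun y => level L n `^ (q - p0) * (\1_(G n) y * lipR u y `^ p0)).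
    have := weak_type cbm pos CD1 dbl tau1 rho0 L0' uL p01 aW r0 rwV (ll0 n).
    rewrite Rint_onZ//; last exact: bI.
    have lvE : level L n `^ q = level L n `^ (q - p0) * level L n `^ p0.
      by rewrite level_pow_split// subrK.
    rewrite -/(G n) -/(O n) lvE => hw.
    rewrite -mulrA [leRHS]mulrCA ler_wpM2l ?powR_ge0//.
  apply: (@le_trans _ _ (\sum_(n < N.+1) 2 * CD ^+ 2 *
      I (fun y => level L n `^ (q - p0) * (\1_(G n) y * lipR u y `^ p0)))).
    by apply: ler_sum => n _; exact: st.
  rewrite -mulr_sumr /weak_const -[leRHS]mulrA.
  have CD20 : 0 <= 2 * CD ^+ 2 by rewrite mulr_ge0// exprn_ge0// (le_trans ler01).
  rewrite ler_wpM2l// -(Rint_on_sum mV muV); last exact: bGb.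
  rewrite -Rint_onZ//; apply: Rint_on_le => //; [exact: bmf_sum|exact: bmfZ|].
  move=> y _.
  have th1 : 2^-1 `^ (q - p0) < 1 :> R.
    apply: (@lt_le_trans _ _ (1 `^ (q - p0))); last by rewrite powR1.
    by rewrite gt0_ltr_powR ?nnegrE// invf_lt1// ltr1n.
  have := @geometric_level_sum _ (fun n => level L n `^ (q - p0))
    (fun n => level L n / 2 < lipR u y) (2^-1 `^ (q - p0)) ((2 * lipR u y) `^ (q - p0)) N.+1.
  move=> h.
  have {}h : \sum_(n < N.+1) (level L n / 2 < lipR u y)%R%:R * level L n `^ (q - p0) <=
      (2 * lipR u y) `^ (q - p0) / (1 - 2^-1 `^ (q - p0)).
    apply: h.
    - by rewrite th1 powR_gt0// invr_gt0.
    - exact: powR_ge0.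
    - by move=> n; exact: powR_ge0.
    - by move=> n; rewrite level_powS.
    - move=> n hn; rewrite ge0_ler_powR ?nnegrE ?(ltW b0) ?(ltW (ll0 n)) ?mulr_ge0//.
      by move: hn; rewrite ltr_pdivrMr// mulrC => /ltW.
    - move=> n; apply: le_lt_trans; rewrite ler_pM2r ?invr_gt0//; exact: level_anti.
  have -> : \sum_(n < N.+1) level L n `^ (q - p0) * (\1_(G n) y * lipR u y `^ p0) =
     (\sum_(n < N.+1) (level L n / 2 < lipR u y)%R%:R * level L n `^ (q - p0)) * lipR u y `^ p0.
    rewrite mulr_suml; apply: eq_bigr => n _; rewrite indicE mulrCA mulrA.
    suff -> : (y \in G n) = (level L n / 2 < lipR u y)%R by [].
    by apply/idP/idP => [/set_mem|hh] //; apply/mem_set.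
  apply: (le_trans (ler_wpM2r (powR_ge0 _ _) h)).
  rewrite powRM// le_eqVlt; apply/orP; left; apply/eqP.
  have [->|gy] := eqVneq (lipR u y) 0.
    by rewrite !powR0 ?mulr0 ?gt_eqF// (lt_trans ltr01).
  have -> : lipR u y `^ q = lipR u y `^ (q - p0) * lipR u y `^ p0.
    by rewrite -powRD ?subrK// (negbTE gy) implybT.
  by ring.
Qed.

End improvement.

End hardy_improvement.

(** * The self-improved local Hardy inequality *)
(** [A] is the integral over [8 tau B] and [A1] the one over [12 tau^2 B]; the
smallness condition makes the coefficient of [A] on the right at most one
half. *)
Lemma absorb_small_term (R : realType) (A A2 A1 S SW Hc K e c2 Ct C1 C2 : R) :
  0 <= A -> 0 <= S -> SW <= S -> 0 <= Hc -> 0 <= K -> 0 <= e -> 0 <= c2 -> 0 <= C1 ->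
  8 * (Hc * K * C1) * e <= 1 ->
  A <= 2 * (Hc * (SW + K * (e * (2 * A2 + 2 * SW + Ct * S)))) + c2 * SW + c2 * (Ct * S) ->
  A2 <= A1 -> A1 <= C1 * A + C2 * S ->
  A1 <= (C1 * (4 * (Hc + Hc * K * e * (2 * C2 + 2 + Ct)) + 2 * (c2 + c2 * Ct)) + C2) * S.
Proof.
move=> A0 S0 SWS Hc0 K0 e0 c20 C10 small hA h21 h1.
pose T := Hc * K * e.
have T0 : 0 <= T by rewrite !mulr_ge0.
have g1 : T * A2 <= T * (C1 * A + C2 * S) by rewrite ler_wpM2l// (le_trans h21).
have g2 : 8 * (Hc * K * C1) * e * A <= 1 * A by rewrite ler_wpM2r.
have g3 : T * SW <= T * S by rewrite ler_wpM2l.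
have g4 : Hc * SW <= Hc * S by rewrite ler_wpM2l.
have g5 : c2 * SW <= c2 * S by rewrite ler_wpM2l.
have g6 : A <= (4 * (Hc + T * (2 * C2 + 2 + Ct)) + 2 * (c2 + c2 * Ct)) * S.
  by move: g1 g2 g3 g4 g5 hA; rewrite /T; lra.
have := ler_wpM2l C10 g6; rewrite /T; lra.
Qed.

Theorem proposition5p7 (R : realType) (p p0 CD CP tau CH : R)
    (hp : 1 < p) (hp0 : 1 < p0 < p) (hCD : 1 <= CD) (hCP : 0 < CP)
    (htau : 1 <= tau) :
  exists eps : R, 0 < eps < p - p0 /\
  forall (d : measure_display) (X : metricMeasurableType d R)
    (mu : {measure set X -> \bar R}),
    complete_borel_measure mu ->
    positive_finite_on_balls mu ->
    doubling mu CD ->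
    (forall q : R, p0 <= q <= p -> poincare mu q CP tau) ->
  forall E : set X,
    closed E ->
    uniformly_fat mu p E ->
    local_hardy mu p tau E CH ->
  forall (w : X) (r : R),
    E w -> 0 < r -> (r%:E < (8^-1)%:E * diam [set: X])%E ->
  let EB := trunc E w r in
  exists C : R, 0 < C /\
  forall u : X -> R, Lip0 (~` E) u ->
    (\int[mu]_(x in ball w (12 * tau ^+ 2 * r) `\` EB)
        (`|u x| `^ (p - eps) / dist_to EB x `^ (p - eps))%R%:E <=
     C%:E * \int[mu]_(x in ball w (12 * tau ^+ 3 * r))
              (pointwise_lip u x `^ (p - eps)))%E.
Proof.
have /andP[p01 p0p] := hp0.
have t0 : 0 < tau by apply: lt_le_trans htau.
have r12 : 0 < 12 * tau ^+ 2 by rewrite mulr_gt0// exprn_gt0.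
have r8 : 0 < 8 * tau by rewrite mulr_gt0.
have t81 : 1 <= 8 * tau by lra.
have [k hk] := exists_pow2_ge r12 r8.
pose Kd := CD ^+ k.
have Kd0 : 0 <= Kd by rewrite exprn_ge0// (le_trans ler01).
pose Hc := Num.max CH 0.
have Hc0 : 0 <= Hc by rewrite le_max lexx orbT.
(* The constant of [outer_estimate] with q replaced by p, so that it does not
   depend on eps. *)
pose C1 := 1 + 4 `^ p * Kd * (8 * tau) `^ p.
have C10 : 0 <= C1 by rewrite addr_ge0 ?mulr_ge0 ?powR_ge0.
pose K := lip_const CD CP tau `^ p.
have K0 : 0 <= K by exact: powR_ge0.
pose den := 8 * (Hc * K * C1) + 1.
have den0 : 0 < den by rewrite ltr_wpDl// !mulr_ge0.
(* The third bound is the smallness needed in [absorb_small_term]; the second one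
   keeps q above p0. *)
pose eps := Num.min 1 (Num.min ((p - p0) / 2) den^-1).
have e0 : 0 < eps by rewrite !lt_min ltr01 divr_gt0 ?subr_gt0// invr_gt0.
have e1 : eps <= 1 by rewrite ge_min lexx.
have epp : eps <= (p - p0) / 2 by rewrite !ge_min lexx !orbT.
have eden : eps <= den^-1 by rewrite !ge_min lexx !orbT.
have p0q : p0 < p - eps by lra.
exists eps; split; first by rewrite e0/=; lra.
move=> d X mu cbm pos dbl hP E cE _ hardy w r Ew r0 rd EB.
set q := p - eps in p0q *.
have qp : q <= p by rewrite gerBl ltW.
have q0 : 0 < q by apply: lt_trans p0q; apply: lt_trans p01.
pose C2 := (2 `^ q + 4 `^ q * Kd) * CP * (24 * tau ^+ 2) `^ q.
pose Ct := weak_const CD p p0 eps.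
pose M := C1 * (4 * (Hc + Hc * K * eps * (2 * C2 + 2 + Ct)) + 2 * (2 `^ q + 2 `^ q * Ct)) + C2.
exists (`|M| + 1); split; first by rewrite ltr_wpDl.
move=> u [[L' uL'] u0].
pose L := `|L'| + 1.
have L0 : 0 < L by rewrite ltr_wpDl.
have uL x y : `|u x - u y| <= L * mdist x y.
  by rewrite (le_trans (uL' x y))// ler_wpM2r ?mdist_ge0// (le_trans (ler_norm L'))// lerDl.
have uE x : E x -> u x = 0 by move=> Ex; apply: u0.
pose rho := 12 * tau ^+ 3 * r.
have rho0 : 0 < rho by rewrite !mulr_gt0// exprn_gt0.
pose V : set X := ball w rho.
have mV : measurable V by exact: (metric_ball_measurable cbm).
have muV : (mu V < +oo)%E by exact: mu_ball_lty.
pose D8 : set X := ball w (8 * tau * r).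
pose W : set X := ball w (8 * tau ^+ 2 * r).
pose B12 : set X := ball w (12 * tau ^+ 2 * r).
have mB12 : measurable B12 by exact: (metric_ball_measurable cbm).
have mW : measurable W by exact: (metric_ball_measurable cbm).
have B12V : B12 `<=` V by exact: B12_V.
have D8V : D8 `<=` V by exact: D8_V.
have WB12 : W `<=` B12 by exact: W_B12.
have mEB : measurable EB.
  by apply: (borel_measurable cbm); apply: closed_borel; exact: trunc_closed.
have rq : bounded_mfun (fun x => dist_quotient E w r u x `^ q).
  apply: bmf_powR; [exact: ltW|exact: dist_quotient_ge0|].
  exact: (dist_quotient_bmf cbm cE Ew r0 L0 uL uE).
have bgq : bounded_mfun (fun x => lipR u x `^ q).
  exact: (lip_powR_bmf cbm (ltW L0) uL (ltW q0)).
have hKd : Rint_on mu V (\1_B12) <= Kd * Rint_on mu V (\1_D8).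
  apply: (mass_doubling cbm pos hCD dbl rho0 _ _ D8V B12V).
  - by rewrite mulr_gt0.
  - by rewrite mulr_gt0.
  - by rewrite mdistxx add0r mulrA ler_pM2r.
have hout := outer_estimate cbm pos hCP htau p01 hP cE Ew r0 L0 uL uE (ltW p0q) qp Kd0 hKd.
have hin := hardy_estimate cbm pos hCD dbl hCP htau p01 p0p hP cE hardy Ew r0 rd L0 uL uE e0 e1 p0q.
set S := Rint_on mu V (fun x => lipR u x `^ q).
have S0 : 0 <= S by apply: Rint_on_ge0 => x _; exact: powR_ge0.
have SE : (\int[mu]_(x in V) (pointwise_lip u x `^ q) = S%:E)%E.
  rewrite (eq_integral (fun x => (lipR u x `^ q)%:E)); last first.
    by move=> x _; rewrite (lipRE (ltW L0) uL).
  rewrite (Rint_on_EFin mV muV mV (@subset_refl _ V) bgq); congr (_%:E).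
  apply/eqP; rewrite eq_le; apply/andP; split; apply: Rint_on_le => //;
    try (by apply: bmfM => //; exact: bmf_indic);
    by move=> x Vx; rewrite indicE mem_set// mul1r.
rewrite -/V SE.
have mBE : measurable (B12 `\` EB) by exact: measurableD.
have BEV : B12 `\` EB `<=` V by move=> x [/B12V].
rewrite (eq_integral (fun x => (dist_quotient E w r u x `^ q)%:E)); last first.
  move=> x _; rewrite /dist_quotient powR_div// dist_to_ge0//.
  by exists w; exact: trunc_center.
rewrite (Rint_on_EFin mV muV mBE BEV rq) -EFinM lee_fin.
have bB : bounded_mfun (fun x => \1_B12 x * dist_quotient E w r u x `^ q).
  by apply: bmfM => //; exact: bmf_indic.
have bW : bounded_mfun (fun x => \1_W x * dist_quotient E w r u x `^ q).
  by apply: bmfM => //; exact: bmf_indic.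
have indic_le (A B : set X) x (h : R) : A `<=` B -> 0 <= h -> \1_A x * h <= \1_B x * h.
  move=> AB hx; rewrite ler_wpM2r// !indicE; have [xA|//] := boolP (x \in A).
  by rewrite mem_set//; apply: AB; exact: set_mem.
apply: (@le_trans _ _ (Rint_on mu V (fun x => \1_B12 x * dist_quotient E w r u x `^ q))).
  apply: Rint_on_le => //; first by apply: bmfM => //; exact: bmf_indic.
  by move=> x _; apply: indic_le; [exact: subDsetl|exact: powR_ge0].
have A0 : 0 <= Rint_on mu V (fun x => \1_D8 x * dist_quotient E w r u x `^ q).
  by apply: Rint_on_ge0 => x _; rewrite mulr_ge0 ?powR_ge0.
apply: (@le_trans _ _ (M * S)); last first.
  by rewrite ler_wpM2r// (le_trans (ler_norm M))// lerDl.
apply: (absorb_small_term A0 S0 _ Hc0 K0 (ltW e0) (powR_ge0 _ _) C10 _ hin).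
- apply: Rint_on_le => //; first by apply: bmfM => //; exact: bmf_indic.
  by move=> x _; rewrite -[leRHS]mul1r ler_wpM2r ?powR_ge0// indicE; case: (_ \in _).
- have den1 : den * eps <= 1 by rewrite -ler_pdivlMl// mulr1.
  by apply: le_trans den1; rewrite ler_wpM2r ?(ltW e0)// lerDl.
- by apply: Rint_on_le => // x _; apply: indic_le => //; exact: powR_ge0.
apply: (le_trans hout); rewrite lerD2r ler_wpM2r// lerD2l.
apply: ler_pM; rewrite ?mulr_ge0 ?powR_ge0//.
  by rewrite ler_wpM2r// ler_powR// ler1n.
by rewrite ler_powR.
Qed.
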